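(* Let $u_0\in H_{0,\infty}(\mathbb R)$. Consider a sequence of initial data $(u_0^n,\rho_0^n,\mu_0^n)\in\mathcal D$ such that $u_0^n\in C^\infty(\mathbb R)$ with $\lim_{n\to\infty}u_0^n=u_0$ in $H_\infty(\mathbb R)$; $\rho_0^n\in C^\infty(\mathbb R)$ with $\lim_{n\to\infty}\rho_0^n=0$ in $L^2_{\rm const}(\mathbb R)$; for every $n$ there is a constant $d_n>0$ with $(\rho_0^n)^2\ge d_n$ on $\mathbb R$; and $\mu_0^n=((u_{0,x}^n)^2+(\bar\rho_0^n)^2)\,dx$. Denote by $(u^n,\rho^n)\in C^\infty([0,\infty)\times\mathbb R)\times C^\infty([0,\infty)\times\mathbb R)$ the unique classical solution, with initial data $(u_0^n,\rho_0^n)$, of $$u_t+uu_x+P_x=0,\qquad \rho_t+(u\rho)_x=0,\qquad P-P_{xx}=u^2+\tfrac12u_x^2+\tfrac12\rho^2 .$$ Then for every $t\in[0,\infty)$ the sequence $u^n(t,\cdot)$ converges to $u(t,\cdot)$ in $L^\infty(\mathbb R)$, where $u$ is the conservative solution of the Camassa--Holm equation $$u_t-u_{txx}+3uu_x-2u_xu_{xx}-uu_{xxx}=0$$ with initial data $u_0$.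
   Context: **Function spaces.** Fix a smooth function $\chi:\mathbb R\to\mathbb R$ with support in $[0,\infty)$, $\chi(x)=1$ for $x\ge1$, $\chi'\ge0$. $H_\infty(\mathbb R)$ is the space of functions $v(x)=\bar v(x)+c_-\chi(-x)+c_+\chi(x)$ with $\bar v\in H^1(\mathbb R)$, $c_\pm\in\mathbb R$, normed by $\|\bar v\|_{H^1}+|c_-|+|c_+|$; $H_{0,\infty}(\mathbb R)$ is the subspace with $c_-=0$. $L^2_{\rm const}(\mathbb R)$ is the space of functions $\rho=\bar\rho+k$ with $\bar\rho\in L^2(\mathbb R)$, $k\in\mathbb R$, normed by $\|\bar\rho\|_{L^2}+|k|$; for $\rho\in L^2_{\rm const}$, $\bar\rho$ denotes this $L^2$ part. $V=\{f\in C(\mathbb R)\cap L^\infty(\mathbb R): f_\xi\in L^2(\mathbb R)\}$ with norm $\|f\|_{L^\infty}+\|f_\xi\|_{L^2}$. $E=V\times H_{0,\infty}(\mathbb R)\times L^2(\mathbb R)\times L^2_{\rm const}(\mathbb R)$ with the sum of the norms. **Lagrangian notation.** For $X=(\zeta,U,h,r)\in E$ put $y(\xi)=\xi+\zeta(\xi)$ (one also writes $X=(y,U,h,r)$), let $c$ and $k$ be the constants attached to $U\in H_{0,\infty}$ (i.e. $c=c_+$) and $r\in L^2_{\rm const}$, and set $\bar U=U-c\,\chi\circ y\in H^1$, $\bar r=r-k\,y_\xi\in L^2$. $X$ is identified with $(\zeta,\bar U,c,h,\bar r,k)$. **Lagrangian system.** $$\zeta_t=U,\quad \bar U_t=-Q-c(\chi'\circ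 y)U,\quad h_t=2(U^2+\tfrac12k^2-P)U_\xi,\quad \bar r_t=-kU_\xi,\quad c_t=0,\quad k_t=0,$$ where (Lagrangian $P$, $Q$) $$P(\xi)=\tfrac14\int_{\mathbb R}e^{-|y(\xi)-y(\eta)|}\big((2\bar U^2+4c\bar U\chi\circ y)y_\xi+2k\bar r+h\big)(\eta)\,d\eta+c^2g\circ y(\xi)+\tfrac12k^2,$$ $$Q(\xi)=-\tfrac14\int_{\mathbb R}\operatorname{sign}(\xi-\eta)e^{-|y(\xi)-y(\eta)|}\big((2\bar U^2+4c\bar U\chi\circ y)y_\xi+2k\bar r+h\big)(\eta)\,d\eta+c^2g'\circ y(\xi),$$ $$g(x)=\chi^2(x)+\tfrac12\int_{\mathbb R}e^{-|x-z|}(2\chi'^2+2\chi\chi'')(z)\,dz.$$ $\mathcal G$ is the set of $X=(\zeta,U,h,r)\in E$ with $\zeta,U\in W^{1,\infty}(\mathbb R)$, $h,r\in L^\infty(\mathbb R)$, and, almost everywhere, $y_\xi\ge0$, $h\ge0$, $y_\xi+h>0$, $y_\xi h=U_\xi^2+\bar r^2$. For $X_0\in\mathcal G$ the system has a unique global solution $X(t)\in\mathcal G$ in $C^1([0,\infty),E)$, and $S_t(X_0)=X(t)$. **Subsets of $\mathcal G$.** $G$ is the group of homeomorphisms $f$ of $\mathbb R$ with $f-\mathrm{Id},f^{-1}-\mathrm{Id}\in W^{1,\infty}(\mathbb R)$ and $f_\xi-1\in L^2(\mathbb R)$. With $H(\xi)=\int_{-\infty}^\xi h\,d\tau$, $\mathcal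 F=\{X\in\mathcal G: y+H\in G\}$ and $\mathcal F_0=\{X\in\mathcal G: y+H=\mathrm{Id}\}$. $S_t$ maps $\mathcal F$ into $\mathcal F$. **Eulerian set.** $\mathcal D$ is the set of triples $(u,\rho,\mu)$ with $u\in H_{0,\infty}(\mathbb R)$, $\rho\in L^2_{\rm const}(\mathbb R)$ and $\mu$ a positive finite Radon measure on $\mathbb R$ whose absolutely continuous part is $\mu_{\rm ac}=(u_x^2+\bar\rho^2)\,dx$. **Maps.** $L:\mathcal D\to\mathcal F_0$, $L(u,\rho,\mu)=(y,U,h,r)$ with $y(\xi)=\sup\{y:\mu((-\infty,y))+y<\xi\}$, $h=1-y_\xi$, $U=u\circ y$, $r=(\rho\circ y)\,y_\xi$. $M:\mathcal F\to\mathcal D$, $M(y,U,h,r)=(u,\rho,\mu)$ with $u(x)=U(\xi)$ for any $\xi$ with $y(\xi)=x$, $\mu=y_\#(h\,d\xi)$, $\bar\rho\,dx=y_\#(\bar r\,d\xi)$, $\rho=k+\bar\rho$ ($y_\#$ is push-forward of measures). $T_t=M\circ S_t\circ L$. **Solutions.** For data as in the theorem, the classical solution $(u^n,\rho^n)(t,\cdot)$ is given by the first two components of $T_t(u_0^n,\rho_0^n,\mu_0^n)$ (Eulerian $P$ being $\frac12\int_{\mathbb R}e^{-|x-z|}(u^2+\frac12u_x^2+\frac12\rho^2)(t,z)\,dz$). The conservative solution $u(t,\cdot)$ of the Camassa--Holm equation with initial data $u_0\in H_{0,\infty}(\mathbb R)$ is the first component of $T_t(u_0,0,u_{0,x}^2\,dx)$.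 *)

(* Defs.v *)
From HB Require Import structures.
From mathcomp Require Import all_boot all_order all_algebra.
From mathcomp Require Import all_classical all_reals all_analysis.

Set Implicit Arguments.
Unset Strict Implicit.
Unset Printing Implicit Defensive.

Import Order.TTheory GRing.Theory Num.Theory.
Import numFieldNormedType.Exports.

Local Open Scope classical_set_scope.
Local Open Scope ring_scope.

(* Elements of the function spaces are represented by functions R -> R.  For
   H^1, V and H_{0,oo} the continuous representative is meant, since these
   functions are evaluated at points; elements of L^2 and L^2_const matter only
   up to equality almost everywhere. *)

Section Spaces.
Context {R : realType}.
Implicit Types (f g v rho phi : R -> R).

Local Notation leb := (@lebesgue_measure R).

Definition smooth f := forall n x, derivable (derive1n n f) x 1.

Definition test_function phi :=
  smooth phi /\ exists M : R, forall x, M < `|x| -> phi x = 0.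

Definition weak_derivative f g :=
  [/\ locally_integrable setT f, locally_integrable setT g &
      forall phi, test_function phi ->
        \int[leb]_(x in setT) (f x * derive1 phi x) =
        - \int[leb]_(x in setT) (g x * phi x)].

(* The weak derivative f_x; it is unique up to a null set, and every use below
   is insensitive to the representative.  It is 0 if f has no weak derivative. *)
Definition wd f : R -> R := xget (cst 0) [set g | weak_derivative f g].

Definition L2 : set (R -> R) := [set f | f \in Lfun leb 2%:E].
Definition Linf : set (R -> R) := [set f | f \in Lfun leb +oo%E].

Definition L2_norm f : \bar R := ('N[leb]_(2%:E)[EFin \o f])%E.
Definition Linf_norm f : \bar R := ('N[leb]_(+oo)[EFin \o f])%E.

Definition H1 : set (R -> R) :=
  [set f | [/\ continuous f, L2 f & exists2 g, weak_derivative f g & L2 g]].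

Definition H1_norm f : \bar R :=
  ((\int[leb]_x ((f x) ^+ 2 + (wd f x) ^+ 2)%:E) `^ 2^-1)%E.

Definition W1inf : set (R -> R) :=
  [set f | Linf f /\ exists2 g, weak_derivative f g & Linf g].

Definition V : set (R -> R) :=
  [set f | [/\ continuous f, Linf f & exists2 g, weak_derivative f g & L2 g]].

Definition V_norm f : \bar R := (Linf_norm f + L2_norm (wd f))%E.

Definition L2const : set (R -> R) :=
  [set rho | exists k : R, L2 (fun x => rho x - k)].

(* The constant k in rho = k + rhobar; it is unique as L^2(R) contains no
   nonzero constant. *)
Definition const_part rho : R := xget 0 [set k | L2 (fun x => rho x - k)].

Definition L2_part rho : R -> R := fun x => rho x - const_part rho.

Definition L2const_norm rho : \bar R :=
  (L2_norm (L2_part rho) + `|const_part rho|%:E)%E.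

Definition cutoff (chi : R -> R) :=
  [/\ smooth chi, forall x, x < 0 -> chi x = 0, forall x, 1 <= x -> chi x = 1 &
      forall x, 0 <= derive1 chi x].

Definition Hinf_bar (chi : R -> R) v (c : R * R) : R -> R :=
  fun x => v x - c.1 * chi (- x) - c.2 * chi x.

Definition Hinf (chi : R -> R) : set (R -> R) :=
  [set v | exists c, H1 (Hinf_bar chi v c)].

(* The pair (c_-, c_+) of v in H_oo, which is unique since functions in H^1
   vanish at infinity. *)
Definition Hinf_coef (chi : R -> R) v : R * R :=
  xget (0, 0) [set c | H1 (Hinf_bar chi v c)].

Definition Hinf_norm (chi : R -> R) v : \bar R :=
  (H1_norm (Hinf_bar chi v (Hinf_coef chi v))
   + `|(Hinf_coef chi v).1|%:E + `|(Hinf_coef chi v).2|%:E)%E.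

Definition H0inf (chi : R -> R) : set (R -> R) :=
  [set v | Hinf chi v /\ (Hinf_coef chi v).1 = 0].

(* Derivatives with respect to time on [0, oo): one-sided at t = 0. *)
Definition time_deriv (f : R -> R) (t l : R) :=
  (s - t)^-1 * (f s - f t) @[s --> within [set s | 0 <= s] t^'] --> l.

(* The curve t |-> f t is C^1 from [0, oo) into the normed space (B, N), with
   derivative t |-> f' t. *)
Definition C1_curve (B : set (R -> R)) (N : (R -> R) -> \bar R)
    (f f' : R -> R -> R) :=
  forall t : R, 0 <= t ->
  [/\ B (f t), B (f' t),
      N (fun x => (s - t)^-1 * (f s x - f t x) - f' t x)
        @[s --> within [set s | 0 <= s] t^'] --> 0%E &
      N (fun x => f' s x - f' t x)
        @[s --> within [set s | 0 <= s] (nbhs t)] --> 0%E].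

(* C^oo([0, oo) x R): D i j is the partial derivative of order i in t and j in
   x, continuous up to the boundary t = 0. *)
Definition smooth_halfplane (u : R -> R -> R) :=
  exists D : nat -> nat -> R -> R -> R,
  [/\ forall t x : R, 0 <= t -> D 0%N 0%N t x = u t x,
      forall i j, {within [set z : R * R | 0 <= z.1],
                    continuous (fun z : R * R => D i j z.1 z.2)},
      forall i j (t x : R), 0 <= t -> time_deriv (fun s => D i j s x) t (D i.+1 j t x) &
      forall i j (t x : R), 0 <= t -> is_derive x (1 : R) (D i j t) (D i j.+1 t x)].

End Spaces.

Section Lagrangian.
Context {R : realType}.
Variable chi : R -> R.

Local Notation leb := (@lebesgue_measure R).

Record lagrangian := Lag {
  lzeta : R -> R;
  lU : R -> R;
  lh : R -> R;
  lr : R -> R }.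

Implicit Types X Y : lagrangian.

Definition E_set X :=
  [/\ V (lzeta X), H0inf chi (lU X), L2 (lh X) & L2const (lr X)].

Definition ly X : R -> R := fun xi => xi + lzeta X xi.
Definition ly_xi X : R -> R := wd (ly X).
Definition lc X : R := (Hinf_coef chi (lU X)).2.
Definition lk X : R := const_part (lr X).
Definition lUbar X : R -> R := fun xi => lU X xi - lc X * chi (ly X xi).
Definition lrbar X : R -> R := fun xi => lr X xi - lk X * ly_xi X xi.

Definition g_chi (x : R) : R :=
  chi x ^+ 2 + 2^-1 * \int[leb]_(z in setT) (expR (- `|x - z|) *
    (2 * derive1 chi z ^+ 2 + 2 * (chi z * derive1n 2 chi z))).

Definition PQ_density X (eta : R) : R :=
  (2 * lUbar X eta ^+ 2 + 4 * (lc X * lUbar X eta * chi (ly X eta)))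
    * ly_xi X eta + 2 * (lk X * lrbar X eta) + lh X eta.

Definition lP X (xi : R) : R :=
  4^-1 * \int[leb]_(eta in setT)
    (expR (- `|ly X xi - ly X eta|) * PQ_density X eta)
  + lc X ^+ 2 * g_chi (ly X xi) + 2^-1 * lk X ^+ 2.

Definition lQ X (xi : R) : R :=
  - (4^-1 * \int[leb]_(eta in setT)
    (Num.sg (xi - eta) * expR (- `|ly X xi - ly X eta|) * PQ_density X eta))
  + lc X ^+ 2 * derive1 g_chi (ly X xi).

Definition G_set X :=
  [/\ E_set X, W1inf (lzeta X) /\ W1inf (lU X), Linf (lh X) /\ Linf (lr X) &
    {ae leb, forall xi,
      [/\ 0 <= ly_xi X xi, 0 <= lh X xi, 0 < ly_xi X xi + lh X xi &
          ly_xi X xi * lh X xi = wd (lU X) xi ^+ 2 + lrbar X xi ^+ 2]}].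

(* Global solutions in C^1([0, oo), E), X being identified with
   (zeta, Ubar, c, h, rbar, k) in V x H^1 x R x L^2 x L^2 x R. *)
Definition lagrangian_solution (X : R -> lagrangian) :=
  (forall t : R, 0 <= t -> G_set (X t)) /\
  [/\ C1_curve V V_norm (fun t => lzeta (X t)) (fun t => lU (X t)),
      C1_curve H1 H1_norm (fun t => lUbar (X t))
        (fun t xi => - lQ (X t) xi
           - lc (X t) * derive1 chi (ly (X t) xi) * lU (X t) xi),
      C1_curve L2 L2_norm (fun t => lh (X t))
        (fun t xi => 2 * (lU (X t) xi ^+ 2 + 2^-1 * lk (X t) ^+ 2
           - lP (X t) xi) * wd (lU (X t)) xi),
      C1_curve L2 L2_norm (fun t => lrbar (X t))
        (fun t xi => - (lk (X t) * wd (lU (X t)) xi)) &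
      forall t : R, 0 <= t -> time_deriv (fun s => lc (X s)) t 0 /\
                          time_deriv (fun s => lk (X s)) t 0].

Definition lag_eq X Y :=
  [/\ lzeta X = lzeta Y, lU X = lU Y,
      {ae leb, forall xi, lh X xi = lh Y xi} &
      {ae leb, forall xi, lr X xi = lr Y xi}].

(* The graph of S_t: semigroup_S t X0 Y means S_t(X0) = Y. *)
Definition semigroup_S (t : R) X0 Y :=
  exists X : R -> lagrangian,
    [/\ lagrangian_solution X, lag_eq (X 0) X0 & lag_eq (X t) Y].

Definition group_G (f : R -> R) :=
  exists finv : R -> R,
  [/\ cancel f finv /\ cancel finv f, continuous f /\ continuous finv,
      W1inf (fun x => f x - x), W1inf (fun x => finv x - x) &
      L2 (fun x => wd f x - 1)].

Definition lH X (xi : R) : R := \int[leb]_(tau in `]-oo, xi]) lh X tau.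

Definition F_set X := G_set X /\ group_G (fun xi => ly X xi + lH X xi).

End Lagrangian.

Section Eulerian.
Context {R : realType}.
Variable chi : R -> R.

Local Notation leb := (@lebesgue_measure R).
(* Every finite Borel measure on R is a Radon measure. *)
Local Notation radon :=
  {finite_measure set (measurableTypeR R) -> \bar R}.

Record eulerian := Eul {
  eu : R -> R;
  erho : R -> R;
  emu : radon }.

Implicit Types d : eulerian.

Definition has_density (mu : set R -> \bar R) (f : R -> R) :=
  forall A : set (measurableTypeR R), measurable A ->
    mu A = (\int[leb]_(x in A) (f x)%:E)%E.

(* Lebesgue decomposition: mu = f dx + nu with nu singular. *)
Definition ac_part_density (mu : radon) (f : R -> R) :=
  exists nu : radon,
    (exists N : set (measurableTypeR R),
       [/\ measurable N, leb N = 0%E & nu (~` N) = 0%E]) /\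
    (forall A : set (measurableTypeR R), measurable A ->
       mu A = (\int[leb]_(x in A) (f x)%:E + nu A)%E).

Definition D_set d :=
  [/\ H0inf chi (eu d), L2const (erho d) &
      ac_part_density (emu d)
        (fun x => wd (eu d) x ^+ 2 + L2_part (erho d) x ^+ 2)].

Definition L_y (mu : radon) (xi : R) : R :=
  sup [set y : R | (mu `]-oo, y[%classic + y%:E < xi%:E)%E].

Definition map_L d : @lagrangian R :=
  let y := L_y (emu d) in
  {| lzeta := fun xi => y xi - xi;
     lU := fun xi => eu d (y xi);
     lh := fun xi => 1 - wd y xi;
     lr := fun xi => erho d (y xi) * wd y xi |}.

(* The graph of the map M : F -> D.  As rbar is only square integrable, rbar dxi is a
   signed Radon measure, and its push-forward (y - Id is bounded) is compared
   with rhobar dx on bounded Borel sets. *)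
Definition map_M (X : lagrangian) d :=
  [/\ F_set chi X,
      forall xi, eu d (ly X xi) = lU X xi,
      forall A : set (measurableTypeR R), measurable A ->
        emu d A = (\int[leb]_(xi in ly X @^-1` A) (lh X xi)%:E)%E &
      exists rhobar : R -> R,
      [/\ L2 rhobar, forall x, erho d x = lk X + rhobar x &
        forall A : set (measurableTypeR R), measurable A ->
          (exists b : R, A `<=` `[- b, b]) ->
          \int[leb]_(x in A) rhobar x =
          \int[leb]_(xi in ly X @^-1` A) lrbar X xi]].

(* The graph of T_t = M o S_t o L. *)
Definition semigroup_T (t : R) d d' :=
  exists2 X, semigroup_S chi t (map_L d) X & map_M X d'.

Definition eulerian_P (u rho : R -> R -> R) (t x : R) : R :=
  2^-1 * \int[leb]_(z in setT) (expR (- `|x - z|) *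
    (u t z ^+ 2 + 2^-1 * derive1 (u t) z ^+ 2 + 2^-1 * rho t z ^+ 2)).

Definition classical_solution (u0 rho0 : R -> R) (u rho : R -> R -> R) :=
  let P := eulerian_P u rho in
  [/\ smooth_halfplane u /\ smooth_halfplane rho,
      u 0 = u0 /\ rho 0 = rho0 &
      forall t x : R, 0 <= t ->
      [/\ time_deriv (fun s => u s x) t
            (- (u t x * derive1 (u t) x + derive1 (P t) x)),
          time_deriv (fun s => rho s x) t
            (- derive1 (fun z => u t z * rho t z) x),
          derivable (P t) x 1 /\ derivable (derive1 (P t)) x 1 &
          P t x - derive1n 2 (P t) x =
            u t x ^+ 2 + 2^-1 * derive1 (u t) x ^+ 2
            + 2^-1 * rho t x ^+ 2]].

(* u(t) is the first component of T_t(u0, 0, u0_x^2 dx). *)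
Definition CH_conservative_solution (u0 : R -> R) (u : R -> R -> R) :=
  exists2 mu0 : radon, has_density mu0 (fun x => wd u0 x ^+ 2) &
  forall t : R, 0 <= t ->
    exists rho mu, semigroup_T t (Eul u0 (cst 0) mu0) (Eul (u t) rho mu).

End Eulerian.

(* Main.v *)
Require Import Defs.
From mathcomp Require Import all_boot all_order all_algebra.
From mathcomp Require Import all_classical all_reals all_analysis.
From mathcomp Require Import measurable_realfun ess_sup_inf ring lra.

(* The solutions are compared in Lagrangian coordinates through the quantity
     sup |y_n - y| + sup |U_n - U| + sup_{0 <= b - a <= 1} |int_a^b (h_n - h)|
       + |c_n - c| + |k_n|.
   Since |U_xi| and |rbar| are at most (y_xi + h) / 2 and y + int h has bounded
   increments on unit intervals, an integration by parts against the kernel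
   exp (- |y(xi) - y(eta)|) shows that P, Q and int_a^b 2 (U^2 + k^2 / 2 - P) U_xi
   are Lipschitz with respect to it; no derivative of the difference is needed.
   Gronwall's lemma, with the bounds on the n-th solution obtained from those on
   the limit by a continuity argument in time, propagates the smallness of the
   quantity from time 0.  At time 0 it follows from the convergence of the
   distribution functions of mu_0^n; at time t it yields the convergence of u^n
   because |U(xi) - U(xi')| <= (m |y(xi) - y(xi')| + int h / m) / 2 for m > 0. *)

Set Implicit Arguments.
Unset Strict Implicit.
Unset Printing Implicit Defensive.

Import Order.TTheory GRing.Theory Num.Theory.
Import numFieldNormedType.Exports.

Local Open Scope classical_set_scope.
Local Open Scope ring_scope.

(** * Integrals of bounded functions over intervals *)

Section BoundedMeasurable.
Context {R : realType}.
Implicit Types (f g A V D d : R -> R) (a b c x y e K M S : R).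
Local Notation leb := (@lebesgue_measure R).

(** What the distribution functions control at time 0 is the closeness of [y] and of the increments
    of [int h]; closeness of the densities themselves would need a separate argument, and
    [y_xi h = U_xi^2 + rbar^2] does not pass to differences. The estimates close because the
    densities enter linearly: the integrands of [P] and [Q] are linear in [y_xi], [rbar], [h], and
    the energy rate is linear in [U_xi]. Each difference of [y_xi], [h] or [U_xi] can therefore be
    paired with a weight taken from the limit solution, whose variation is controlled by
    [y + int h]. The density [rbar] is the exception, as no primitive of it is compared. It always
    comes with a factor [k], and the limit has [k = 0] because its density starts from 0, so this
    term is small through [k] alone. The energy identity is used only as the bound of [U_xi^2] and
    [rbar^2] by [y_xi h]. Since the energy is measured on unit intervals, integrals over the line
    are cut into unit windows around [xi], on which the kernel decays geometrically. *)

Definition bmeas f := measurable_fun setT f /\ exists M, forall x, `|f x| <= M.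

Lemma bmeas_cst c : bmeas (fun=> c).
Proof. by split => //; exists `|c|. Qed.

Lemma bmeas_cont f M : continuous f -> (forall x, `|f x| <= M) -> bmeas f.
Proof. by move=> cf fM; split; [exact: continuous_measurable_fun|exists M]. Qed.

Lemma bmeasD f g : bmeas f -> bmeas g -> bmeas (fun x => f x + g x).
Proof.
move=> [mf [M fM]] [mg [N gN]]; split; first exact: measurable_funD.
by exists (M + N) => x; rewrite (le_trans (ler_normD _ _))// lerD.
Qed.

Lemma bmeasN f : bmeas f -> bmeas (fun x => - f x).
Proof.
move=> [mf [M fM]]; split; first exact: measurableT_comp.
by exists M => x; rewrite normrN.
Qed.

Lemma bmeasB f g : bmeas f -> bmeas g -> bmeas (fun x => f x - g x).
Proof. by move=> hf hg; apply: bmeasD => //; exact: bmeasN. Qed.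

Lemma bmeasM f g : bmeas f -> bmeas g -> bmeas (fun x => f x * g x).
Proof.
move=> [mf [M fM]] [mg [N gN]]; split; first exact: measurable_funM.
by exists (M * N) => x; rewrite normrM ler_pM.
Qed.

Lemma bmeasZ c f : bmeas f -> bmeas (fun x => c * f x).
Proof. by apply: bmeasM; exact: bmeas_cst. Qed.

Lemma bmeasX f n : bmeas f -> bmeas (fun x => f x ^+ n).
Proof.
move=> hf; elim: n => [|n ih]; first exact: bmeas_cst.
rewrite (_ : (fun x => _) = (fun x => f x * f x ^+ n)); first exact: bmeasM.
by apply/funext => x; rewrite exprS.
Qed.

Lemma bmeas_norm f : bmeas f -> bmeas (fun x => `|f x|).
Proof.
move=> [mf [M fM]]; split; first exact: measurableT_comp.
by exists M => x; rewrite normr_id.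
Qed.

Lemma leb_seg a b : leb `[a, b] = (if a < b then b - a else 0)%:E.
Proof.
have := @lebesgue_measure_itv R (Interval (BLeft a) (BRight b)).
by move=> /= H; apply: etrans H _ => /=; rewrite lte_fin; case: ifP => // _; rewrite EFinB.
Qed.

Lemma bmeas_itv f a b : bmeas f -> leb.-integrable `[a, b] (EFin \o f).
Proof.
move=> [mf [M fM]]; apply: measurable_bounded_integrable => //.
- by apply: (le_lt_trans _ (ltry (if a < b then b - a else 0))); rewrite -leb_seg.
- exact: measurable_funTS.
- exists M; split; first by rewrite num_real.
  by move=> N MN x _ /=; rewrite (le_trans (fM x))// ltW.
Qed.

Lemma Rintegral_split f a b c : a <= b -> b <= c ->
  leb.-integrable `[a, c] (EFin \o f) ->
  \int[leb]_(x in `[a, c]) f x =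
  \int[leb]_(x in `[a, b]) f x + \int[leb]_(x in `[b, c]) f x.
Proof.
move=> ab bc fi.
have := @Rintegral_itvB _ f (BLeft a) (BRight c) b fi.
rewrite !bnd_simp => /(_ ab bc) H.
have fi' : leb.-integrable `]b, c] (EFin \o f).
  by apply: integrableS fi => //; apply: subset_itvr; rewrite bnd_simp.
by rewrite -(Rintegral_itv_obnd_cbnd fi') -H addrC subrK.
Qed.

Lemma Rintegral_seg f g a b : a <= b -> bmeas f -> bmeas g ->
  (forall x, a <= x <= b -> f x <= g x) ->
  \int[leb]_(x in `[a, b]) f x <= \int[leb]_(x in `[a, b]) g x.
Proof.
move=> ab hf hg fg; by apply: le_Rintegral => //; exact: bmeas_itv.
Qed.

Lemma norm_Rintegral_seg f g a b : a <= b -> bmeas f -> bmeas g ->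
  (forall x, a <= x <= b -> `|f x| <= g x) ->
  `|\int[leb]_(x in `[a, b]) f x| <= \int[leb]_(x in `[a, b]) g x.
Proof.
move=> ab hf hg fg; apply: le_trans (le_normr_Rintegral _ (bmeas_itv _ _ _)) _ => //.
apply: Rintegral_seg => //; exact: bmeas_norm.
Qed.

Lemma Rintegral_seg_cst a b c : a <= b ->
  \int[leb]_(x in `[a, b]) c = c * (b - a).
Proof.
move=> ab; rewrite Rintegral_cst//; congr (_ * _).
have /= H := leb_seg a b; rewrite [LHS](congr1 fine H); case: ltP => //= ba.
by apply/eqP; rewrite eq_sym subr_eq0 eq_le ab ba.
Qed.

Lemma Rintegral_segD f g a b : bmeas f -> bmeas g ->
  \int[leb]_(x in `[a, b]) (f x + g x) =
  \int[leb]_(x in `[a, b]) f x + \int[leb]_(x in `[a, b]) g x.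
Proof. by move=> hf hg; apply: RintegralD => //; exact: bmeas_itv. Qed.

Lemma Rintegral_segB f g a b : bmeas f -> bmeas g ->
  \int[leb]_(x in `[a, b]) (f x - g x) =
  \int[leb]_(x in `[a, b]) f x - \int[leb]_(x in `[a, b]) g x.
Proof. by move=> hf hg; apply: RintegralB => //; exact: bmeas_itv. Qed.

Lemma Rintegral_segZ f c a b : bmeas f ->
  \int[leb]_(x in `[a, b]) (c * f x) = c * \int[leb]_(x in `[a, b]) f x.
Proof. by move=> hf; apply: RintegralZl => //; exact: bmeas_itv. Qed.

Definition primitive D d :=
  forall a b, a <= b -> D b - D a = \int[leb]_(x in `[a, b]) d x.

Lemma primitive_lip D d M : bmeas d -> (forall x, `|d x| <= M) ->
  primitive D d -> forall x y, x <= y -> `|D y - D x| <= M * (y - x).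
Proof.
move=> hd dM Dd x y xy; rewrite Dd// -Rintegral_seg_cst//.
by apply: norm_Rintegral_seg => //; exact: bmeas_cst.
Qed.

Lemma lip_continuous D M : (forall x y, x <= y -> `|D y - D x| <= M * (y - x)) ->
  continuous D.
Proof.
move=> DM x; apply/cvgrPdist_le => e e0; near=> y.
have H : `|D x - D y| <= (`|M| + 1) * `|x - y|.
  have [xy|/ltW yx] := leP x y.
    rewrite distrC (le_trans (DM _ _ xy))// [`|x - y|]distrC.
    rewrite [`|y - x|]ger0_norm ?subr_ge0//.
    apply: ler_wpM2r; first by rewrite subr_ge0.
    by rewrite (le_trans (ler_norm _))// lerDl.
  rewrite (le_trans (DM _ _ yx))// [`|x - y|]ger0_norm ?subr_ge0//.
  apply: ler_wpM2r; first by rewrite subr_ge0.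
  by rewrite (le_trans (ler_norm _))// lerDl.
apply: le_trans H _.
have M1 : 0 < `|M| + 1 by rewrite ltr_wpDl.
rewrite -ler_pdivlMl//; near: y; apply: cvgr_dist_le => //.
by rewrite mulr_gt0// invr_gt0.
Unshelve. all: by end_near. Qed.

(** The infimum of the failures satisfies [P] by the first hypothesis, and the second then keeps all
    failures away from it. The continuation arguments below rest on this principle. *)
Lemma real_induction (P : R -> Prop) T :
  (forall s, 0 <= s <= T -> (forall r, 0 <= r < s -> P r) -> P s) ->
  (forall s, 0 <= s < T -> (forall r, 0 <= r <= s -> P r) ->
     exists2 d : R, 0 < d & forall r, s <= r <= s + d -> P r) ->
  forall s, 0 <= s <= T -> P s.
Proof.
move=> Pl Pr s0 s0T; apply: contrapT => nP.
pose A := [set s | 0 <= s <= T /\ ~ P s].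
have As0 : A s0 by [].
have lA : lbound A 0 by move=> s [/andP[]].
have hA : has_inf A by split; [exists s0|exists 0].
set m := inf A.
have m0 : 0 <= m by apply: lb_le_inf => //; exists s0.
have mlt r : 0 <= r < m -> P r.
  move=> /andP[r0 rm]; apply: contrapT => nr.
  have : m <= r.
    apply: ge_inf => //; first by exists 0.
    split => //; rewrite r0/= (le_trans (ltW rm))//.
    by apply: le_trans (ge_inf hA.2 As0) _; case/andP: s0T.
  by rewrite leNgt rm.
have ms0 : m <= s0 by apply: ge_inf => //; exists 0.
have mT : m <= T by apply: le_trans ms0 _; case/andP: s0T.
have Pm : P m by apply: Pl => //; rewrite m0.
have Pm' r : 0 <= r <= m -> P r.
  by move=> /andP[r0]; rewrite le_eqVlt => /predU1P[->//|rm]; apply: mlt; rewrite r0.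
have [mT'|Tm] := ltP m T; last first.
  by apply: nP; apply: Pm'; case/andP: s0T => -> /le_trans ->.
have [d d0 Pd] : exists2 d : R, 0 < d & forall r, m <= r <= m + d -> P r.
  by apply: Pr => //; rewrite m0.
have : m + d <= m.
  apply: lb_le_inf; first by exists s0.
  move=> r [/andP[r0 rT] nr]; rewrite leNgt; apply/negP => rmd; apply: nr.
  have [rm|mr] := leP r m; first by apply: Pm'; rewrite r0.
  by apply: Pd; rewrite (ltW mr) ltW.
by rewrite gerDl leNgt d0.
Qed.

(** On a fine partition the terms with [K] become negligible and the others telescope. In place of
    partitions, the bound with slope [e + c] is carried along [[a, b]] in steps of length at most
    [d], for arbitrarily small [c]. *)
Lemma telescope_le (F V : R -> R) a b e K : a <= b -> 0 <= e -> 0 <= K ->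
  (forall x y, a <= x -> x <= y -> y <= b ->
     `|F y - F x| <= (e + K * (y - x)) * (V y - V x)) ->
  (forall x y, a <= x -> x <= y -> y <= b -> V x <= V y) ->
  `|F b - F a| <= e * (V b - V a).
Proof.
move=> ab e0 K0 H nV; apply/ler_addgt0Pr => z z0.
have VV : 0 < V b - V a + 1 by rewrite ltr_wpDl// subr_ge0 nV.
(* With this [c] the excess [c * (V b - V a)] stays below [z]; the added 1 keeps the denominator
   positive. *)
pose c : R := z / (V b - V a + 1); have c0 : 0 < c by rewrite divr_gt0.
pose P (s : R) : Prop := `|F (a + s) - F a| <= (e + c) * (V (a + s) - V a).
suff : P (b - a).
  rewrite /P (addrC a) subrK => /le_trans; apply; rewrite mulrDl lerD2l.
  by rewrite mulrAC ler_pdivrMr// ler_wpM2l ?(ltW z0)// lerDl.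
pose d : R := c / (K + 1); have d0 : 0 < d by rewrite divr_gt0// ltr_wpDl.
have step (r t : R) : 0 <= r -> r <= t -> t <= b - a -> t <= r + d -> P r -> P t.
  move=> r0 rt tT trd Pr; have ar : a <= a + r by rewrite lerDl.
  have art : a + r <= a + t by rewrite lerD2l.
  have tb : a + t <= b by rewrite addrC -lerBrDr.
  rewrite /P (_ : _ - _ = (F (a + t) - F (a + r)) + (F (a + r) - F a)); last by ring.
  apply: le_trans (ler_normD _ _) _; apply: le_trans (lerD (H _ _ ar art tb) Pr) _.
  have -> : a + t - (a + r) = t - r by ring.
  have Kc : K * (t - r) <= c.
    apply: (@le_trans _ _ ((K + 1) * d)); last by rewrite /d mulrC divfK// gt_eqF// ltr_wpDl.
    by apply: ler_pM => //; lra.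
  have Vt : 0 <= V (a + t) - V (a + r) by rewrite subr_ge0 nV.
  by have := ler_wpM2r Vt (_ : e + K * (t - r) <= e + c); rewrite lerD2l => /(_ Kc); lra.
have P0 : P 0 by rewrite /P addr0 !subrr normr0 mulr0.
apply: (@real_induction P (b - a)) => [s /andP[s0 sT] Ps|s /andP[s0 sT] Ps|]; last first.
- by rewrite subr_ge0 ab lexx.
- exists (Num.min d (b - a - s)) => [|r]; first by rewrite lt_min d0 subr_gt0.
  rewrite -lerBlDl le_min lerBlDl lerD2r => /andP[sr /andP[rd rT]].
  by apply: (step s) => //; apply: Ps; rewrite s0/=.
- move: s0; rewrite le_eqVlt => /predU1P[<-//|s0].
  apply: (step (Num.max 0 (s - d))) => //.
  + by rewrite le_max lexx.
  + by rewrite ge_max (ltW s0) gerBl ltW.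
  + by rewrite -lerBlDr le_max lexx orbT.
  + by apply: Ps; rewrite le_max lexx gt_max s0 gtrBl.
Qed.

(* Summation by parts: the bound involves only a primitive [D] of [d], not [d]
   itself, so that no derivative ever has to be compared. *)
Lemma abel_estimate A V D d a b (S e : R) : a <= b -> 0 <= e ->
  bmeas A -> bmeas d -> primitive D d ->
  (forall x y, a <= x -> x <= y -> y <= b -> `|A y - A x| <= V y - V x) ->
  (forall x, a <= x <= b -> `|A x| <= S) ->
  (forall x, a <= x <= b -> `|D x| <= e) ->
  `|\int[leb]_(x in `[a, b]) (A x * d x)| <= e * (2 * S + (V b - V a)).
Proof.
move=> ab e0 hA hd Dd AV AS De.
have hAd := bmeasM hA hd.
have [M0 dM0] := hd.2; pose M : R := `|M0|.
have M0' : 0 <= M by exact: normr_ge0.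
have dM x : `|d x| <= M by rewrite (le_trans (dM0 x))// ler_norm.
(* Subtracting [A x * D x] is the integration by parts: over [[x, y]] what is left of the integral
   is at most [M * (y - x) * (V y - V x)], and the boundary part at most [e * (V y - V x)], as
   [telescope_le] requires. *)
pose F x := \int[leb]_(x in `[a, x]) (A x * d x) - A x * D x.
have FE x y : a <= x -> x <= y -> F y - F x =
    \int[leb]_(t in `[x, y]) ((A t - A x) * d t) - (A y - A x) * D y.
  move=> ax xy; rewrite /F (@Rintegral_split _ a x y)//; last exact: bmeas_itv.
  have -> : \int[leb]_(t in `[x, y]) ((A t - A x) * d t) =
      \int[leb]_(t in `[x, y]) (A t * d t) - A x * (D y - D x).
    rewrite Dd// -Rintegral_segZ// -Rintegral_segB//; last first.
      by apply: bmeasM => //; exact: bmeas_cst.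
    by apply: eq_Rintegral => t _; rewrite mulrBl.
  ring.
have H : `|F b - F a| <= e * (V b - V a).
  apply: (@telescope_le _ _ _ _ _ M) => // x y ax xy yb.
    rewrite FE// [leRHS]mulrDl (le_trans (ler_normB _ _))// addrC; apply: lerD.
      rewrite normrM mulrC; apply: ler_pM => //; last by apply: AV.
      by apply: De; rewrite (le_trans ax xy) yb.
    rewrite mulrAC -Rintegral_seg_cst//.
    apply: norm_Rintegral_seg => //.
      by apply: bmeasM => //; apply: bmeasB => //; exact: bmeas_cst.
      exact: bmeas_cst.
    move=> t /andP[xt ty]; rewrite normrM mulrC.
    apply: ler_pM => //.
    have h1 := AV _ _ ax xt (le_trans ty yb).
    have h2 : V t <= V y.
      rewrite -subr_ge0; apply: le_trans (AV t y _ ty yb) => //.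
      exact: le_trans ax xt.
    by rewrite (le_trans h1)// lerD2r.
  by rewrite -subr_ge0; apply: le_trans (AV _ _ ax xy yb).
have E : \int[leb]_(x in `[a, b]) (A x * d x) = (F b - F a) + (A b * D b - A a * D a).
  by rewrite /F set_itv1 Rintegral_set1; ring.
rewrite E (le_trans (ler_normD _ _))// mulrDr addrC; apply: lerD => //.
have aab : a <= a <= b by rewrite lexx.
have bab : a <= b <= b by rewrite lexx andbT.
have h (x : R) : a <= x <= b -> `|A x * D x| <= S * e.
  by move=> xab; rewrite normrM ler_pM// ?AS ?De.
rewrite (le_trans (ler_normB _ _))//.
by rewrite (le_trans (lerD (h _ bab) (h _ aab)))//; lra.
Qed.

End BoundedMeasurable.

(** * Integrals over the line with exponentially decaying windows *)

Section LineIntegrals.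
Context {R : realType}.
Implicit Types (f g : R -> R) (a b c x y K M xi : R).
Local Notation leb := (@lebesgue_measure R).

Lemma expR_NnatS (j : nat) : 2 * expR (- j.+1%:R : R) <= expR (- j%:R).
Proof.
have -> : - j.+1%:R = - j%:R - 1 :> R by rewrite -[in LHS]natr1 opprD.
rewrite expRD mulrCA ler_piMr ?expR_ge0//.
rewrite expRN -ler_pdivlMl// mulr1 lef_pV2 ?posrE ?expR_gt0//.
by have := @expR_ge1Dx R 1; lra.
Qed.

Lemma measurable_EFinR f (A : set R) : measurable_fun (A : set (measurableTypeR R)) (EFin \o f :
  measurableTypeR R -> \bar R) <->
  measurable_fun A f.
Proof. by split => h; have /measurable_EFinP := h. Qed.

Lemma integrable_meas f (A : set R) :
  leb.-integrable A (EFin \o f) -> measurable_fun A f.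
Proof. by move=> /integrableP[mf _]; exact/measurable_EFinR. Qed.

Section IntegrableReal.
Context d (T : measurableType d) (mu : {measure set T -> \bar R}).
Implicit Types (A : set T) (u v : T -> R).

Lemma integrableDR A u v : measurable A -> mu.-integrable A (EFin \o u) ->
  mu.-integrable A (EFin \o v) -> mu.-integrable A (EFin \o (fun t => u t + v t)).
Proof. by move=> mA hu hv; apply: eq_integrable (integrableD mA hu hv). Qed.

Lemma integrableBR A u v : measurable A -> mu.-integrable A (EFin \o u) ->
  mu.-integrable A (EFin \o v) -> mu.-integrable A (EFin \o (fun t => u t - v t)).
Proof. by move=> mA hu hv; apply: eq_integrable (integrableB mA hu hv). Qed.

Lemma integrableZR A (k : R) u : measurable A -> mu.-integrable A (EFin \o u) ->
  mu.-integrable A (EFin \o (fun t => k * u t)).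
Proof. by move=> mA hu; apply: eq_integrable (integrableZl mA k hu). Qed.

Lemma integrable_normR A u : measurable A -> mu.-integrable A (EFin \o u) ->
  mu.-integrable A (EFin \o (fun t => `|u t|)).
Proof. by move=> mA hu; apply: eq_integrable (integrable_abse hu). Qed.

End IntegrableReal.

Lemma window_cvg f xi : leb.-integrable setT (EFin \o f) ->
  \int[leb]_(x in `[xi - N%:R, xi + N%:R]) f x @[N --> \oo] -->
  \int[leb]_(x in setT) f x.
Proof.
move=> fi; have mf := integrable_meas fi.
pose F N : set (measurableTypeR R) := `[xi - N%:R, xi + N%:R]%classic.
under eq_fun do rewrite Rintegral_mkcond.
apply: (@fine_cvg _ _ _ _ (fun N => \int[leb]_x ((f \_ (F N)) x)%:E)%E).
rewrite fineK; last exact: integrable_fin_num.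
apply: (@dominated_cvg _ _ _ leb setT measurableT _ _ (fun x => `|f x|%:E)).
- move=> N; apply/measurable_EFinR.
  by apply/(measurable_restrictT f (measurable_itv _)); exact: measurable_funTS.
- move=> x _; apply: cvg_near_cst; near=> N.
  rewrite patchE mem_set//= /F /= in_itv/=.
  have : `|x - xi| <= N%:R.
    near: N; exists (Num.bound `|x - xi|) => // n /= hn.
    by rewrite (le_trans (ltW (archi_boundP _)))// ler_nat.
  by rewrite ler_distl.
- by [].
- by move/integrable_abse : fi.
- move=> N x _; rewrite patchE; case: ifP => //= _.
  by rewrite normr0 lee_fin.
Unshelve. all: by end_near. Qed.

Lemma window_bound f xi K (N : nat) : bmeas f ->
  (forall j : nat, `|\int[leb]_(x in `[xi + j%:R, xi + j.+1%:R]) f x| <= K * expR (- j%:R)) ->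
  (forall j : nat, `|\int[leb]_(x in `[xi - j.+1%:R, xi - j%:R]) f x| <= K * expR (- j%:R)) ->
  `|\int[leb]_(x in `[xi - N%:R, xi + N%:R]) f x| <= 4 * K.
Proof.
move=> hf hr hl.
have K0 : 0 <= K.
  by have := hr 0%N; rewrite oppr0 expR0 mulr1; apply: le_trans.
(* The induction needs this sharper bound: one more window on each side costs
   [2 * K * expR (- N%:R)], which the growth of the right-hand side pays for because [expR] at least
   halves at each step. *)
suff H : `|\int[leb]_(x in `[xi - N%:R, xi + N%:R]) f x| <=
    4 * K * (1 - expR (- N%:R)).
  apply: le_trans H _; rewrite -[leRHS]mulr1; apply: ler_wpM2l; first by rewrite mulr_ge0.
  by rewrite lerBlDr lerDl expR_ge0.
elim: N => [|N ih].
  by rewrite !subr0 addr0 set_itv1 Rintegral_set1 normr0 oppr0 expR0 subrr mulr0.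
have N1 : N%:R <= N.+1%:R :> R by rewrite ler_nat.
have N0 : 0 <= N%:R :> R by [].
rewrite (@Rintegral_split _ f (xi - N.+1%:R) (xi - N%:R) (xi + N.+1%:R)); first last.
- exact: bmeas_itv.
- by lra.
- by lra.
rewrite (@Rintegral_split _ f (xi - N%:R) (xi + N%:R) (xi + N.+1%:R)); first last.
- exact: bmeas_itv.
- by lra.
- by lra.
rewrite (le_trans (ler_normD _ _))//.
apply: (le_trans (lerD (hl N) (le_trans (ler_normD _ _) (lerD ih (hr N))))).
have := @expR_NnatS N; set p := expR _; set q := expR _ => pq.
have := ler_wpM2l K0 pq; rewrite !(mulrBr, mulrDr) !mulr1; lra.
Qed.

(** Reduces every global estimate below to unit windows to the right and to the left of [xi], where
    only local energy bounds are available. *)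
Lemma line_bound f xi K : bmeas f -> leb.-integrable setT (EFin \o f) ->
  (forall j : nat, `|\int[leb]_(x in `[xi + j%:R, xi + j.+1%:R]) f x| <= K * expR (- j%:R)) ->
  (forall j : nat, `|\int[leb]_(x in `[xi - j.+1%:R, xi - j%:R]) f x| <= K * expR (- j%:R)) ->
  `|\int[leb]_(x in setT) f x| <= 4 * K.
Proof.
move=> hf fi hr hl; have /(cvg_comp _ _) := window_cvg xi fi.
move=> /(_ _ (fun x => `|x|) _ (@norm_continuous _ R _)) h.
rewrite -(cvg_lim (@Rhausdorff R) h); apply: limr_le; first by apply/cvg_ex; eexists; exact: h.
by near=> N; exact: window_bound.
Unshelve. all: by end_near. Qed.

Lemma exp_kernel_cont xi : continuous (fun x => expR (- `|xi - x|)).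
Proof.
move=> x; apply: continuous_comp; last exact: continuous_expR.
apply: continuousN; apply: continuous_comp; last exact: norm_continuous.
by apply: continuousB => //; exact: cst_continuous.
Qed.

Lemma exp_kernel_le1 xi x : expR (- `|xi - x|) <= 1.
Proof. by rewrite expR_le1 oppr_le0. Qed.

Lemma exp_kernel_bmeas xi : bmeas (fun x => expR (- `|xi - x|)).
Proof.
apply: (@bmeas_cont _ _ 1); first exact: exp_kernel_cont.
by move=> x; rewrite ger0_norm ?expR_ge0 ?exp_kernel_le1.
Qed.

Lemma exp_kernel_right xi (j : nat) x : xi + j%:R <= x -> expR (- `|xi - x|) <= expR (- j%:R).
Proof.
move=> h; rewrite ler_expR lerN2 distrC (le_trans _ (ler_norm _))//; lra.
Qed.

Lemma exp_kernel_left xi (j : nat) x : x <= xi - j%:R -> expR (- `|xi - x|) <= expR (- j%:R).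
Proof.
move=> h; rewrite ler_expR lerN2 (le_trans _ (ler_norm _))//; lra.
Qed.

(** The windows around [xi] have integrals at most 4 by [window_bound] with [K = 1]; monotone
    convergence passes to the line. *)
Lemma exp_kernel_integrable xi :
  leb.-integrable setT (EFin \o (fun x => expR (- `|xi - x|))).
Proof.
have hk := exp_kernel_bmeas xi.
apply/integrableP; split; first by apply/measurable_EFinR; exact: hk.1.
under eq_integral do rewrite /= ger0_norm ?expR_ge0//.
pose F N : set (measurableTypeR R) := `[xi - N%:R, xi + N%:R]%classic.
have FT : \bigcup_N F N = setT.
  rewrite -subTset => x _; exists (Num.bound `|x - xi|) => //.
  rewrite /F /= in_itv/= -ler_distl ltW// archi_boundP//.
rewrite -FT; apply: (@le_lt_trans _ _ 4%:E); last exact: ltry.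
have nF : nondecreasing_seq F.
  move=> m n mn; apply/subsetPset; apply: subset_itv; rewrite bnd_simp.
    by rewrite lerD2l lerN2 ler_nat.
  by rewrite lerD2l ler_nat.
have mF N : measurable_fun (F N) (EFin \o (fun x => expR (- `|xi - x|)) : measurableTypeR R ->
  \bar R).
  by apply/measurable_EFinR/measurable_funTS; exact: hk.1.
have pF N x : F N x -> (0 <= (expR (- `|xi - x|))%:E)%E.
  by move=> _; rewrite lee_fin expR_ge0.
have mF' N : measurable (F N) by exact: measurable_itv.
have h := @ge0_nondecreasing_set_cvg_integral _ _ _ F _ leb nF mF' mF pF.
rewrite -(cvg_lim (@ereal_hausdorff R) h).
apply: lime_le.
  by apply/cvg_ex; eexists; exact: h.
near=> N; have hi : leb.-integrable (F N) (EFin \o (fun x => expR (- `|xi - x|))) by exact: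
  bmeas_itv.
rewrite -(fineK (integrable_fin_num _ hi))// lee_fin.
apply: le_trans (ler_norm _) _; rewrite -[leRHS]mulr1.
have piece (a b : R) (j : nat) : a <= b -> b - a = 1 ->
    (forall x, a <= x <= b -> expR (- `|xi - x|) <= expR (- j%:R)) ->
    `|\int[leb]_(x in `[a, b]) expR (- `|xi - x|)| <= 1 * expR (- j%:R).
  move=> ab ba h1; rewrite mul1r (_ : expR (- j%:R) = expR (- j%:R) * (b - a)); last first.
    by rewrite ba mulr1.
  rewrite -Rintegral_seg_cst//.
  apply: norm_Rintegral_seg => //; first exact: bmeas_cst.
  by move=> x xab; rewrite ger0_norm ?expR_ge0// h1.
apply: window_bound => // j.
- have jj : xi + j%:R <= xi + j.+1%:R by rewrite lerD2l ler_nat.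
  apply: (piece _ _ j jj) => [|x /andP[h1 _]]; first by rewrite -natr1; ring.
  exact: exp_kernel_right.
- have jj : xi - j.+1%:R <= xi - j%:R by rewrite lerD2l lerN2 ler_nat.
  apply: (piece _ _ j jj) => [|x /andP[_ h1]]; first by rewrite -natr1; ring.
  exact: exp_kernel_left.
Unshelve. all: by end_near. Qed.

Lemma kernel_integrable f xi M : measurable_fun setT f ->
  (forall x, `|f x| <= M * expR (- `|xi - x|)) ->
  leb.-integrable setT (EFin \o f).
Proof.
move=> mf fM.
have M0 : 0 <= M.
  have := fM xi; rewrite subrr normr0 oppr0 expR0 mulr1; exact: le_trans.
apply: (@le_integrable _ _ _ leb setT _ _ (fun x => (M * expR (- `|xi - x|))%:E)).
- by [].
- exact/measurable_EFinR.
- move=> x _ /=; rewrite lee_fin (le_trans (fM x))// ler_norm//.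
- under eq_fun do rewrite EFinM; apply: integrableZl => //.
  exact: exp_kernel_integrable.
Qed.

Lemma sg_bmeas xi : bmeas (fun x => Num.sg (xi - x)).
Proof.
split; last by exists 1 => x; rewrite normr_sg lern1 leq_b1.
have -> : (fun x => Num.sg (xi - x)) = (fun x => \1_(`]-oo, xi[ : set R) x - \1_(`]xi, +oo[ : set
  R) x).
  apply/funext => x; rewrite !indicE !mem_setE !in_itv/= andbT.
  by case: ltgtP => h; rewrite ?subr0 ?sub0r; [rewrite gtr0_sg ?subr_gt0|rewrite ltr0_sg
    ?subr_lt0|rewrite h subrr sgr0].
by apply: measurable_funB; exact: measurable_indic.
Qed.

(** On a segment lying on one side of [xi] the sign is constant except perhaps at [xi], a null set.
    The windows of [line_bound] never straddle [xi], so the estimates for [P] carry over to [Q]. *)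
Lemma Rintegral_sg f xi a b : a <= b -> bmeas f -> xi <= a \/ b <= xi ->
  `|\int[leb]_(x in `[a, b]) (Num.sg (xi - x) * f x)| =
  `|\int[leb]_(x in `[a, b]) f x|.
Proof.
move=> ab hf xab.
have hs := sg_bmeas xi.
have hsf := bmeasM hs hf.
have key c : (forall x, x != xi -> a <= x <= b -> Num.sg (xi - x) = c) -> `|c| = 1 ->
    `|\int[leb]_(x in `[a, b]) (Num.sg (xi - x) * f x)| = `|\int[leb]_(x in `[a, b]) f x|.
  move=> hc c1; rewrite -[RHS]mul1r -c1 -normrM -Rintegral_segZ//; congr `|_|.
  congr fine; apply: ae_eq_integral => //.
  - by apply/measurable_EFinR/measurable_funTS; exact: hsf.1.
  - by apply/measurable_EFinR/measurable_funTS; apply: (bmeasM (bmeas_cst c) hf).1.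
  - exists [set xi]; split => //; first exact: lebesgue_measure_set1.
    move=> x /=; apply: contra_notP => /eqP xxi.
    by rewrite in_itv/= => xab'; rewrite hc.
case: xab => [xa|bx].
- apply: (key (-1)); last by rewrite normrN1.
  by move=> x xxi /andP[ax _]; rewrite ltr0_sg// subr_lt0 lt_neqAle eq_sym xxi (le_trans xa).
- apply: (key 1); last by rewrite normr1.
  by move=> x xxi /andP[_ xb]; rewrite gtr0_sg// subr_gt0 lt_neqAle xxi (le_trans xb).
Qed.

End LineIntegrals.

(** * Lipschitz estimates for P, Q and the energy *)

Section Profiles.
Context {R : realType}.
Local Notation leb := (@lebesgue_measure R).

(* Pointwise data of a Lagrangian state: [pH] is a primitive of the energy
   density [ph], and [pyx], [pUx], [ph], [prb] are representatives for which
   the relations defining G hold at every point. *)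
Record profile := Profile {
  py : R -> R; pU : R -> R; pH : R -> R;
  pyx : R -> R; pUx : R -> R; ph : R -> R; prb : R -> R;
  pc : R; pk : R }.

Implicit Types (p q : profile) (a b x y xi eta w : R).

(** Only undifferentiated quantities and the local energy are bounded by [B]. The densities are
    bounded through [bmeas], with no bound named, so that constants built from [B] do not depend on
    their size. *)
Record admissible (B : R) p : Prop := Admissible {
  adm_yx : bmeas (pyx p);
  adm_Ux : bmeas (pUx p);
  adm_h : bmeas (ph p);
  adm_rb : bmeas (prb p);
  adm_yx0 : forall x, 0 <= pyx p x;
  adm_h0 : forall x, 0 <= ph p x;
  adm_energy : forall x, pyx p x * ph p x = pUx p x ^+ 2 + prb p x ^+ 2;
  adm_y : primitive (py p) (pyx p);
  adm_U : primitive (pU p) (pUx p);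
  adm_H : primitive (pH p) (ph p);
  adm_yB : forall x, `|py p x - x| <= B;
  adm_UB : forall x, `|pU p x| <= B;
  adm_HB : forall a b, a <= b -> b <= a + 1 -> pH p b - pH p a <= B;
  adm_cB : `|pc p| <= B;
  adm_kB : `|pk p| <= B }.

(* Neither derivatives nor [prb] are compared, and [ph] only through its
   integrals over intervals of length at most 1.  The terms with [prb] carry a
   factor [k], which is why the reference profile [q] has [k = 0]. *)
Record profile_close (e : R) p q : Prop := Close {
  close_y : forall x, `|py p x - py q x| <= e;
  close_U : forall x, `|pU p x - pU q x| <= e;
  close_H : forall a b, a <= b -> b <= a + 1 ->
    `|(pH p b - pH p a) - (pH q b - pH q a)| <= e;
  close_c : `|pc p - pc q| <= e;
  close_k : `|pk p| <= e;
  close_k0 : pk q = 0 }.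

(** This nondecreasing function dominates the variation of [py] and [pU], and serves as [V] in
    [abel_estimate]. *)
Definition pv p x := py p x + pH p x.
Definition pvx p x := pyx p x + ph p x.

Lemma expR_dist (s t m : R) : expR (- s) <= m -> expR (- t) <= m ->
  `|expR (- s) - expR (- t)| <= `|s - t| * m.
Proof.
wlog st : s t / s <= t.
  move=> H hs ht; have [st|/ltW ts] := leP s t; first exact: H.
  by rewrite distrC [`|s - t|]distrC; apply: H.
move=> hs ht; have d0 : 0 <= t - s by rewrite subr_ge0.
rewrite distrC [`|s - t|]distrC (ger0_norm d0) ler0_norm; last first.
  by rewrite subr_le0 ler_expR lerN2.
rewrite opprB (_ : - t = - s - (t - s)); last by ring.
rewrite expRD (_ : _ - _ = expR (- s) * (1 - expR (- (t - s)))); last by ring.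
rewrite mulrC; apply: ler_pM => //.
- by rewrite subr_ge0 expR_le1 oppr_le0.
- by have := @expR_ge1Dx R (- (t - s)); lra.
Qed.

Section Fixed.
Variables (chi g gd : R -> R) (X B : R).
Hypothesis B1 : 1 <= B.
Hypothesis X0 : 0 <= X.
Hypothesis chi01 : forall x, `|chi x| <= 1.
Hypothesis chiL : forall x y, `|chi x - chi y| <= X * `|x - y|.
Hypothesis gL : forall x y, `|g x - g y| <= X * `|x - y|.
Hypothesis gdL : forall x y, `|gd x - gd y| <= X * `|x - y|.
Hypothesis gB : forall x, `|g x| <= X.
Hypothesis gdB : forall x, `|gd x| <= X.

Definition pkern p xi eta := expR (- `|py p xi - py p eta|).
Definition pubar p x := pU p x - pc p * chi (py p x).
Definition pS p x := 2 * pubar p x ^+ 2 + 4 * (pc p * pubar p x * chi (py p x)).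
Definition pW p x := pS p x * pyx p x + 2 * (pk p * prb p x) + ph p x.
Definition pP p xi := 4^-1 * \int[leb]_(eta in setT) (pkern p xi eta * pW p eta)
  + pc p ^+ 2 * g (py p xi) + 2^-1 * pk p ^+ 2.
Definition pQ p xi := - (4^-1 * \int[leb]_(eta in setT)
    (Num.sg (xi - eta) * pkern p xi eta * pW p eta)) + pc p ^+ 2 * gd (py p xi).
(** The energy density has time derivative [2 * pA * pUx]. *)
Definition pA p x := pU p x ^+ 2 + 2^-1 * pk p ^+ 2 - pP p x.

Let B0 : 0 <= B. Proof. exact: le_trans B1. Qed.
(** The price of replacing [y(xi) - y(eta)] by [xi - eta] in the kernel, since [y - Id] is bounded
    by [B] at both points. *)
Definition kexp : R := expR (2 * B).
Local Notation E := kexp.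
Definition KS : R := 2 * B + 4 * B ^+ 2 * X.
Definition KW : R := 4 * B ^+ 2 + B + 1.
Let KW0 : 0 <= KW.
Proof. by have := sqr_ge0 B; have := B0; rewrite /KW; lra. Qed.
Let KS0 : 0 <= KS.
Proof. by rewrite /KS addr_ge0 ?mulr_ge0// sqr_ge0. Qed.
Let E0 : 0 <= E. Proof. exact: expR_ge0. Qed.

Section One.
Variable p : profile.
Hypothesis pB : admissible B p.

(** Completing the square eliminates [pubar] and leaves two squares of quantities bounded by [B]. *)
Lemma pS_E x : pS p x = 2 * pU p x ^+ 2 - 2 * (pc p * chi (py p x)) ^+ 2.
Proof. by rewrite /pS /pubar; ring. Qed.

Lemma pvx_bmeas : bmeas (pvx p).
Proof. by apply: bmeasD; [exact: adm_yx pB|exact: adm_h pB]. Qed.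

Lemma pvx_ge0 x : 0 <= pvx p x.
Proof. by rewrite addr_ge0 ?(adm_yx0 pB) ?(adm_h0 pB). Qed.

(** The energy identity gives [pUx ^+ 2 <= pyx * ph], and the geometric mean is at most the
    arithmetic one. *)
Lemma Ux_le x : `|pUx p x| <= 2^-1 * pvx p x.
Proof.
have h0 := adm_h0 pB x; have y0 := adm_yx0 pB x; have en := adm_energy pB x.
rewrite -ler_sqr ?nnegrE ?normr_ge0// ?mulr_ge0 ?pvx_ge0// real_normK ?num_real//.
rewrite /pvx; have := sqr_ge0 (pyx p x - ph p x); have := sqr_ge0 (prb p x); nra.
Qed.

Lemma rb_le x : `|prb p x| <= 2^-1 * pvx p x.
Proof.
have h0 := adm_h0 pB x; have y0 := adm_yx0 pB x; have en := adm_energy pB x.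
rewrite -ler_sqr ?nnegrE ?normr_ge0// ?mulr_ge0 ?pvx_ge0// real_normK ?num_real//.
rewrite /pvx; have := sqr_ge0 (pyx p x - ph p x); have := sqr_ge0 (pUx p x); nra.
Qed.

Lemma pv_primitive : primitive (pv p) (pvx p).
Proof.
move=> a b ab; rewrite Rintegral_segD; [|exact: adm_yx pB|exact: adm_h pB].
by rewrite -(adm_y pB)// -(adm_H pB)// /pv; ring.
Qed.

Lemma y_incr a b : a <= b -> 0 <= py p b - py p a.
Proof.
by move=> ab; rewrite (adm_y pB)//; apply: Rintegral_ge0 => x _; exact: adm_yx0 pB x.
Qed.

Lemma H_incr a b : a <= b -> 0 <= pH p b - pH p a.
Proof.
by move=> ab; rewrite (adm_H pB)//; apply: Rintegral_ge0 => x _; exact: adm_h0 pB x.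
Qed.

Lemma y_le_v a b : a <= b -> `|py p b - py p a| <= pv p b - pv p a.
Proof.
by move=> ab; have := H_incr ab; rewrite ger0_norm ?y_incr// /pv; lra.
Qed.

Lemma U_le_v a b : a <= b -> `|pU p b - pU p a| <= 2^-1 * (pv p b - pv p a).
Proof.
move=> ab; rewrite (adm_U pB)// pv_primitive// -Rintegral_segZ; last exact: pvx_bmeas.
apply: norm_Rintegral_seg => //; first exact: adm_Ux pB.
  by apply: bmeasZ; exact: pvx_bmeas.
by move=> x _; exact: Ux_le.
Qed.

(** The increment of [py] is at most [1 + 2 * B], that of [pH] at most [B], and [1 <= B]. *)
Lemma v_unit a b : a <= b -> b <= a + 1 -> pv p b - pv p a <= 4 * B.
Proof.
move=> ab ba; have h5 := adm_HB pB ab ba; have := B1.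
have /ler_normlP[h1 h2] := adm_yB pB a; have /ler_normlP[h3 h4] := adm_yB pB b.
by rewrite /pv; lra.
Qed.

Lemma y_cont : continuous (py p).
Proof.
have [M hM] := (adm_yx pB).2.
exact: lip_continuous (primitive_lip (adm_yx pB) hM (adm_y pB)).
Qed.

Lemma U_cont : continuous (pU p).
Proof.
have [M hM] := (adm_Ux pB).2.
exact: lip_continuous (primitive_lip (adm_Ux pB) hM (adm_U pB)).
Qed.

Lemma lip_comp_cont (f : R -> R) : (forall x y, `|f x - f y| <= X * `|x - y|) ->
  continuous f.
Proof.
move=> fL; apply: (@lip_continuous _ _ X) => x y xy.
by rewrite (le_trans (fL _ _))// ger0_norm// subr_ge0.
Qed.

Lemma chiy_cont : continuous (fun x => chi (py p x)).
Proof. by move=> x; apply: continuous_comp; [exact: y_cont|exact: lip_comp_cont]. Qed.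

Lemma cchi_le x : `|pc p * chi (py p x)| <= B.
Proof. by rewrite normrM -[B]mulr1 ler_pM ?(adm_cB pB). Qed.

Lemma pS_le x : `|pS p x| <= 4 * B ^+ 2.
Proof.
rewrite pS_E; have := adm_UB pB x; have := cchi_le x.
set c := pc p * _; set u := pU p x => hc hu.
have c2 : c ^+ 2 <= B ^+ 2 by rewrite -(real_normK (num_real c)) lerXn2r ?nnegrE.
have u2 : u ^+ 2 <= B ^+ 2 by rewrite -(real_normK (num_real u)) lerXn2r ?nnegrE.
have := sqr_ge0 c; have := sqr_ge0 u.
by rewrite ler_norml => *; apply/andP; split; lra.
Qed.

Lemma sqr_dist (u v M : R) : `|u| <= M -> `|v| <= M ->
  `|u ^+ 2 - v ^+ 2| <= 2 * M * `|u - v|.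
Proof.
move=> uM vM; rewrite subr_sqr normrM mulrC ler_wpM2r//.
by rewrite (le_trans (ler_normD _ _))//; lra.
Qed.

Lemma pS_var a b : a <= b -> `|pS p b - pS p a| <= KS * (pv p b - pv p a).
Proof.
move=> ab; rewrite !pS_E.
have h1 := sqr_dist (adm_UB pB b) (adm_UB pB a).
have h2 := sqr_dist (cchi_le b) (cchi_le a).
have h3 : `|pc p * chi (py p b) - pc p * chi (py p a)| <= B * (X * (pv p b - pv p a)).
  rewrite -mulrBr normrM ler_pM ?(adm_cB pB)//.
  by rewrite (le_trans (chiL _ _))// ler_wpM2l// y_le_v.
have h4 := U_le_v ab.
rewrite (_ : _ - _ = 2 * (pU p b ^+ 2 - pU p a ^+ 2) -
   2 * ((pc p * chi (py p b)) ^+ 2 - (pc p * chi (py p a)) ^+ 2)); last by ring.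
rewrite (le_trans (ler_normB _ _))// !normrM (ger0_norm (ler0n _ _)).
have h5 : `|pU p b ^+ 2 - pU p a ^+ 2| <= 2 * B * (2^-1 * (pv p b - pv p a)).
  by rewrite (le_trans h1)// ler_wpM2l// mulr_ge0.
have h6 : `|(pc p * chi (py p b)) ^+ 2 - (pc p * chi (py p a)) ^+ 2| <=
    2 * B * (B * (X * (pv p b - pv p a))).
  by rewrite (le_trans h2)// ler_wpM2l// mulr_ge0.
by apply: le_trans (lerD (ler_wpM2l _ h5) (ler_wpM2l _ h6)) _ => //; rewrite /KS; lra.
Qed.

Lemma pS_bmeas : bmeas (pS p).
Proof.
rewrite (_ : pS p = fun x => 2 * pU p x ^+ 2 - 2 * (pc p * chi (py p x)) ^+ 2); last first.
  by apply/funext => x; rewrite pS_E.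
have hU := bmeas_cont U_cont (adm_UB pB).
have hc := bmeas_cont chiy_cont (fun x => chi01 (py p x)).
apply: bmeasB; apply: bmeasM; (try exact: bmeas_cst); apply: bmeasX => //.
by apply: bmeasM => //; exact: bmeas_cst.
Qed.

Lemma pW_bmeas : bmeas (pW p).
Proof.
apply: bmeasD; last exact: adm_h pB.
apply: bmeasD; first by apply: bmeasM; [exact: pS_bmeas|exact: adm_yx pB].
apply: bmeasZ.
by apply: bmeasZ; exact: adm_rb pB.
Qed.

Lemma pW_le x : `|pW p x| <= KW * pvx p x.
Proof.
have y0 := adm_yx0 pB x; have h0 := adm_h0 pB x.
have h1 : `|pS p x * pyx p x| <= 4 * B ^+ 2 * pyx p x.
  by rewrite normrM (ger0_norm y0) ler_wpM2r// pS_le.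
have h2 : `|2 * (pk p * prb p x)| <= B * pvx p x.
  rewrite normrM (ger0_norm (ler0n _ _)) normrM.
  have := ler_pM (normr_ge0 _) (normr_ge0 _) (adm_kB pB) (rb_le x); lra.
rewrite /pW (le_trans (ler_normD _ _))// (le_trans (lerD (ler_normD _ _) (lexx _)))//.
rewrite (ger0_norm h0); apply: le_trans (lerD (lerD h1 h2) (lexx _)) _.
have : 0 <= 4 * B ^+ 2 * ph p x by rewrite !mulr_ge0.
rewrite /KW /pvx; lra.
Qed.

Lemma pW_unit a b : a <= b -> b <= a + 1 ->
  \int[leb]_(x in `[a, b]) `|pW p x| <= KW * (4 * B).
Proof.
move=> ab ba.
apply: (@le_trans _ _ (\int[leb]_(x in `[a, b]) (KW * pvx p x))).
  apply: Rintegral_seg => //.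
  - exact/bmeas_norm/pW_bmeas.
  - by apply: bmeasZ; exact: pvx_bmeas.
  - by move=> x _; exact: pW_le.
rewrite Rintegral_segZ; last exact: pvx_bmeas.
by rewrite -pv_primitive// ler_wpM2l// v_unit.
Qed.

Lemma pkern_le xi eta : pkern p xi eta <= E * expR (- `|xi - eta|).
Proof.
rewrite /pkern /kexp -expRD ler_expR.
have /ler_normlP[h1 h2] := adm_yB pB xi; have /ler_normlP[h3 h4] := adm_yB pB eta.
suff : `|xi - eta| <= `|py p xi - py p eta| + 2 * B by lra.
rewrite (_ : xi - eta = (py p xi - py p eta) + (- (py p xi - xi) + (py p eta - eta))); last by ring.
rewrite (le_trans (ler_normD _ _))// lerD2l (le_trans (ler_normD _ _))// normrN.
by rewrite mulr_natl mulr2n lerD// (adm_yB pB).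
Qed.

Lemma pkern_w xi eta w : expR (- `|xi - eta|) <= w -> pkern p xi eta <= E * w.
Proof. by move=> h; rewrite (le_trans (pkern_le _ _))// ler_wpM2l. Qed.

Lemma pkern_ge0 xi eta : 0 <= pkern p xi eta. Proof. exact: expR_ge0. Qed.

Lemma pkern_bmeas xi : bmeas (pkern p xi).
Proof.
apply: (@bmeas_cont _ _ 1).
  move=> x; apply: (@continuous_comp _ _ _ (py p) (fun z => expR (- `|py p xi - z|))).
    exact: y_cont.
  exact: exp_kernel_cont.
by move=> x; rewrite ger0_norm ?pkern_ge0 ?exp_kernel_le1.
Qed.

Lemma pkern_var xi a b w : expR (- `|xi - a|) <= w -> expR (- `|xi - b|) <= w ->
  `|pkern p xi b - pkern p xi a| <= `|py p b - py p a| * (E * w).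
Proof.
move=> ha hb; rewrite (le_trans (expR_dist (pkern_w hb) (pkern_w ha)))//.
apply: ler_wpM2r; first exact: le_trans (pkern_ge0 xi a) (pkern_w ha).
rewrite (le_trans (ler_dist_dist _ _))// (_ : _ - _ = - (py p b - py p a)) ?normrN//; ring.
Qed.

Lemma pkern_integrable xi f : bmeas f ->
  leb.-integrable setT (EFin \o (fun eta => pkern p xi eta * f eta)).
Proof.
move=> hf; have [M hM] := hf.2.
apply: (@kernel_integrable _ _ xi (E * M)).
  exact: (bmeasM (pkern_bmeas xi) hf).1.
move=> x; rewrite normrM (ger0_norm (pkern_ge0 _ _)) mulrAC ler_pM ?pkern_ge0//.
exact: pkern_le.
Qed.

End One.

Section Two.
Variables (p q : profile) (e : R).
Hypothesis e0 : 0 <= e.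
Hypothesis pB : admissible B p.
Hypothesis qB : admissible B q.
Hypothesis pq : profile_close e p q.

(** * Differences on one window, with [w] bounding the undistorted kernel there *)

Section Piece.
Variables (xi a b w : R).
Hypothesis ab : a <= b.
Hypothesis ba : b <= a + 1.
Hypothesis xw : forall x, a <= x <= b -> expR (- `|xi - x|) <= w.

Let w0 : 0 <= w.
Proof. by apply: le_trans (@xw a _); [exact: expR_ge0|rewrite lexx]. Qed.

Lemma kernel_term_diff : `|\int[leb]_(x in `[a, b]) ((pkern p xi x - pkern q xi x) * pW p x)| <=
  2 * e * (E * w) * (KW * (4 * B)).
Proof.
have hW := pW_bmeas pB.
apply: (@le_trans _ _ (\int[leb]_(x in `[a, b]) (2 * e * (E * w) * `|pW p x|))).
  apply: norm_Rintegral_seg => //.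
  - by apply: bmeasM => //; apply: bmeasB; exact: pkern_bmeas.
  - by apply: bmeasZ; exact: bmeas_norm.
  move=> x xab; rewrite normrM ler_wpM2r//.
  have hx := xw xab.
  rewrite (le_trans (expR_dist (pkern_w pB hx) (pkern_w qB hx)))//.
  rewrite ler_wpM2r ?mulr_ge0//.
  rewrite (le_trans (ler_dist_dist _ _))//.
  rewrite (_ : _ - _ = (py p xi - py q xi) - (py p x - py q x)); last by ring.
  rewrite (le_trans (ler_normB _ _))//.
  by have := close_y pq xi; have := close_y pq x; lra.
rewrite Rintegral_segZ; last exact: bmeas_norm.
by rewrite ler_wpM2l ?mulr_ge0// pW_unit.
Qed.

Lemma pS_diff x : `|pS p x - pS q x| <= (8 * B + 4 * B ^+ 2 * X) * e.
Proof.
rewrite !pS_E.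
have h1 := sqr_dist (adm_UB pB x) (adm_UB qB x).
have h2 := sqr_dist (cchi_le pB x) (cchi_le qB x).
have h3 : `|pc p * chi (py p x) - pc q * chi (py q x)| <= e + B * (X * e).
  rewrite (_ : _ - _ = (pc p - pc q) * chi (py p x) + pc q * (chi (py p x) - chi (py q x)));
    last by ring.
  rewrite (le_trans (ler_normD _ _))// !normrM lerD//.
    by rewrite -[leRHS]mulr1 ler_pM// (close_c pq).
  rewrite ler_pM// ?(adm_cB qB)// (le_trans (chiL _ _))// ler_wpM2l//.
  exact: close_y pq x.
rewrite (_ : _ - _ = 2 * (pU p x ^+ 2 - pU q x ^+ 2) -
   2 * ((pc p * chi (py p x)) ^+ 2 - (pc q * chi (py q x)) ^+ 2)); last by ring.
rewrite (le_trans (ler_normB _ _))// !normrM (ger0_norm (ler0n _ _)).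
have h5 : `|pU p x ^+ 2 - pU q x ^+ 2| <= 2 * B * e.
  by rewrite (le_trans h1)// ler_wpM2l ?mulr_ge0// (close_U pq).
have h6 : `|(pc p * chi (py p x)) ^+ 2 - (pc q * chi (py q x)) ^+ 2| <=
    2 * B * (e + B * (X * e)).
  by rewrite (le_trans h2)// ler_wpM2l// mulr_ge0.
by apply: le_trans (lerD (ler_wpM2l _ h5) (ler_wpM2l _ h6)) _ => //; lra.
Qed.

Lemma S_term_diff :
  `|\int[leb]_(x in `[a, b]) (pkern q xi x * (pS p x - pS q x) * pyx p x)| <=
  E * w * ((8 * B + 4 * B ^+ 2 * X) * e) * (4 * B).
Proof.
set K := _ * ((_ + _) * e).
have K0 : 0 <= K.
  rewrite /K mulr_ge0 ?mulr_ge0// addr_ge0 ?mulr_ge0// sqr_ge0//.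
have hSp := pS_bmeas pB; have hSq := pS_bmeas qB.
apply: (@le_trans _ _ (\int[leb]_(x in `[a, b]) (K * pyx p x))).
  apply: norm_Rintegral_seg => //.
  - apply: bmeasM; last exact: adm_yx pB.
    by apply: bmeasM; [exact: pkern_bmeas|exact: bmeasB].
  - by apply: bmeasZ; exact: adm_yx pB.
  move=> x xab; rewrite normrM (ger0_norm (adm_yx0 pB x)) ler_wpM2r ?(adm_yx0 pB)//.
  rewrite normrM ler_pM// ?pS_diff// ger0_norm ?pkern_ge0//.
  by rewrite pkern_w// xw.
rewrite Rintegral_segZ; last exact: adm_yx pB.
rewrite ler_wpM2l// -(adm_y pB)//.
by have := y_le_v pB ab; have := v_unit pB ab ba; have := ler_norm (py p b - py p a); lra.
Qed.

Lemma pkern_v x y : a <= x -> x <= y -> y <= b ->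
  `|pkern q xi y - pkern q xi x| <= E * w * (pv q y - pv q x).
Proof.
move=> ax xy yb.
have hx : expR (- `|xi - x|) <= w by rewrite xw// ax (le_trans xy).
have hy : expR (- `|xi - y|) <= w by rewrite xw// yb (le_trans ax).
rewrite (le_trans (pkern_var qB hx hy))// mulrC ler_wpM2l ?mulr_ge0//.
exact: y_le_v.
Qed.

(** Here [py p - py q] is small but its derivative need not be: [abel_estimate] moves the derivative
    onto the weight [pkern q * pS q], whose variation is bounded by that of [pv q]. *)
Lemma yx_term_diff :
  `|\int[leb]_(x in `[a, b]) (pkern q xi x * pS q x * (pyx p x - pyx q x))| <=
  e * (2 * (E * w * (4 * B ^+ 2)) + E * w * (4 * B ^+ 2 + KS) * (4 * B)).
Proof.
have hS := pS_bmeas qB; have hk := pkern_bmeas qB xi.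
have Ew0 : 0 <= E * w by rewrite mulr_ge0.
have h := @abel_estimate R (fun x => pkern q xi x * pS q x)
  (fun x => E * w * (4 * B ^+ 2 + KS) * pv q x)
  (fun x => py p x - py q x) (fun x => pyx p x - pyx q x) a b
  (E * w * (4 * B ^+ 2)) e ab e0.
apply: (le_trans (h _ _ _ _ _ _)).
- exact: bmeasM.
- by apply: bmeasB; [exact: adm_yx pB|exact: adm_yx qB].
- move=> x y xy; rewrite Rintegral_segB; [|exact: adm_yx pB|exact: adm_yx qB].
  by rewrite -(adm_y pB)// -(adm_y qB)//; ring.
- move=> x y ax xy yb.
  have hx : expR (- `|xi - x|) <= w by rewrite xw// ax (le_trans xy).
  rewrite (_ : _ - _ = (pkern q xi y - pkern q xi x) * pS q y + pkern q xi x * (pS q y - pS q x));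
    last by ring.
  rewrite (le_trans (ler_normD _ _))// !normrM.
  have h1 := ler_pM (normr_ge0 _) (normr_ge0 _) (pkern_v ax xy yb) (pS_le qB y).
  have h2 : `|pkern q xi x| <= E * w by rewrite ger0_norm ?pkern_ge0// pkern_w.
  have h3 := ler_pM (normr_ge0 _) (normr_ge0 _) h2 (pS_var qB xy).
  by apply: le_trans (lerD h1 h3) _; lra.
- move=> x xab; rewrite normrM ler_pM// ?pS_le//.
  by rewrite ger0_norm ?pkern_ge0// pkern_w// xw.
- by move=> x _; exact: close_y pq x.
rewrite ler_wpM2l// lerD2l -mulrBr ler_wpM2l//; last exact: v_unit.
by rewrite mulr_ge0// addr_ge0// mulr_ge0// sqr_ge0.
Qed.

(** There is no term of [q] to compare with; smallness comes from [pk p] alone, and [prb] is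
    absorbed into [pvx]. *)
Lemma rb_term_diff :
  `|\int[leb]_(x in `[a, b]) (pkern q xi x * (2 * (pk p * prb p x)))| <=
  E * w * e * (4 * B).
Proof.
have Ew0 : 0 <= E * w by rewrite mulr_ge0.
apply: (@le_trans _ _ (\int[leb]_(x in `[a, b]) (E * w * e * pvx p x))).
  apply: norm_Rintegral_seg => //.
  - apply: bmeasM; first exact: pkern_bmeas.
    by do 2 apply: bmeasZ; exact: adm_rb pB.
  - by apply: bmeasZ; exact: pvx_bmeas.
  move=> x xab; rewrite normrM -mulrA ler_pM//.
    by rewrite ger0_norm ?pkern_ge0// pkern_w// xw.
  rewrite !normrM (ger0_norm (ler0n _ _)).
  by have := ler_pM (normr_ge0 _) (normr_ge0 _) (close_k pq) (rb_le pB x); lra.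
rewrite Rintegral_segZ; last exact: pvx_bmeas.
by rewrite -pv_primitive// ler_wpM2l ?mulr_ge0// v_unit.
Qed.

Lemma h_term_diff :
  `|\int[leb]_(x in `[a, b]) (pkern q xi x * (ph p x - ph q x))| <=
  e * (2 * (E * w) + E * w * (4 * B)).
Proof.
have hk := pkern_bmeas qB xi.
have Ew0 : 0 <= E * w by rewrite mulr_ge0.
(* Only increments of [pH] are close, so the primitive is normalised to vanish at [a]; on the window
   it is then at most [e]. *)
have h := @abel_estimate R (pkern q xi) (fun x => E * w * pv q x)
  (fun x => (pH p x - pH p a) - (pH q x - pH q a)) (fun x => ph p x - ph q x) a b
  (E * w) e ab e0.
apply: (le_trans (h _ _ _ _ _ _)) => //.
- by apply: bmeasB; [exact: adm_h pB|exact: adm_h qB].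
- move=> x y xy; rewrite Rintegral_segB; [|exact: adm_h pB|exact: adm_h qB].
  by rewrite -(adm_H pB)// -(adm_H qB)//; ring.
- by move=> x y ax xy yb; rewrite -mulrBr; exact: pkern_v.
- move=> x xab; rewrite ger0_norm ?pkern_ge0// pkern_w// xw//.
- by move=> x /andP[ax xb]; apply: (close_H pq) => //; rewrite (le_trans xb).
by rewrite ler_wpM2l// lerD2l -mulrBr ler_wpM2l//; exact: v_unit.
Qed.

Definition KD : R := 2 * E * (KW * (4 * B)) + E * (8 * B + 4 * B ^+ 2 * X) * (4 * B)
  + (2 * (E * (4 * B ^+ 2)) + E * (4 * B ^+ 2 + KS) * (4 * B)) + E * (4 * B)
  + (2 * E + E * (4 * B)).

(** The factors are exchanged one at a time: kernel, [pS], then [pyx], and finally [ph], with the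
    [prb] term surviving only for [p] because [pk q = 0]. The five summands of [KD] correspond to
    these five terms. *)
Lemma segment_diff :
  `|\int[leb]_(x in `[a, b]) (pkern p xi x * pW p x - pkern q xi x * pW q x)| <=
  KD * e * w.
Proof.
have hkp := pkern_bmeas pB xi; have hkq := pkern_bmeas qB xi.
have hWp := pW_bmeas pB; have hSp := pS_bmeas pB; have hSq := pS_bmeas qB.
have b1 : bmeas (fun x => (pkern p xi x - pkern q xi x) * pW p x).
  by apply: bmeasM => //; exact: bmeasB.
have b2 : bmeas (fun x => pkern q xi x * (pS p x - pS q x) * pyx p x).
  by apply: bmeasM; [apply: bmeasM => //; exact: bmeasB|exact: adm_yx pB].
have b3 : bmeas (fun x => pkern q xi x * pS q x * (pyx p x - pyx q x)).
  apply: bmeasM; first exact: bmeasM.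
  by apply: bmeasB; [exact: adm_yx pB|exact: adm_yx qB].
have b4 : bmeas (fun x => pkern q xi x * (2 * (pk p * prb p x))).
  apply: bmeasM => //.
  by do 2 apply: bmeasZ; exact: adm_rb pB.
have b5 : bmeas (fun x => pkern q xi x * (ph p x - ph q x)).
  by apply: bmeasM => //; apply: bmeasB; [exact: adm_h pB|exact: adm_h qB].
have -> : (fun x => pkern p xi x * pW p x - pkern q xi x * pW q x) =
  (fun x => (pkern p xi x - pkern q xi x) * pW p x +
   (pkern q xi x * (pS p x - pS q x) * pyx p x +
   (pkern q xi x * pS q x * (pyx p x - pyx q x) +
   (pkern q xi x * (2 * (pk p * prb p x)) +
   pkern q xi x * (ph p x - ph q x))))).
  by apply/funext => x; rewrite /pW (close_k0 pq); ring.
have b45 := bmeasD b4 b5; have b345 := bmeasD b3 b45; have b2345 := bmeasD b2 b345.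
rewrite (Rintegral_segD _ _ b1 b2345) (Rintegral_segD _ _ b2 b345).
rewrite (Rintegral_segD _ _ b3 b45) (Rintegral_segD _ _ b4 b5).
have h45 := le_trans (ler_normD _ _) (lerD rb_term_diff h_term_diff).
have h345 := le_trans (ler_normD _ _) (lerD yx_term_diff h45).
have h2345 := le_trans (ler_normD _ _) (lerD S_term_diff h345).
apply: le_trans (le_trans (ler_normD _ _) (lerD kernel_term_diff h2345)) _.
by rewrite le_eqVlt; apply/orP; left; apply/eqP; rewrite /KD; ring.
Qed.

End Piece.

Lemma right_window xi (j : nat) x : xi + j%:R <= x <= xi + j.+1%:R ->
  expR (- `|xi - x|) <= expR (- j%:R).
Proof. by move=> /andP[h _]; exact: exp_kernel_right. Qed.

Lemma left_window xi (j : nat) x : xi - j.+1%:R <= x <= xi - j%:R ->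
  expR (- `|xi - x|) <= expR (- j%:R).
Proof. by move=> /andP[_ h]; exact: exp_kernel_left. Qed.

Lemma window_le (xi : R) (j : nat) : [/\ xi + j%:R <= xi + j.+1%:R,
  xi + j.+1%:R <= xi + j%:R + 1, xi - j.+1%:R <= xi - j%:R &
  xi - j%:R <= xi - j.+1%:R + 1].
Proof. by rewrite -natr1; split; lra. Qed.

Lemma kernel_diff_bmeas xi :
  bmeas (fun x => pkern p xi x * pW p x - pkern q xi x * pW q x).
Proof.
have hkp := pkern_bmeas pB xi; have hkq := pkern_bmeas qB xi.
have hWp := pW_bmeas pB; have hWq := pW_bmeas qB.
by apply: bmeasB; exact: bmeasM.
Qed.

Lemma P_integral_diff xi :
  `|\int[leb]_(x in setT) (pkern p xi x * pW p x) -
    \int[leb]_(x in setT) (pkern q xi x * pW q x)| <= 4 * (KD * e).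
Proof.
have ip := pkern_integrable pB xi (pW_bmeas pB).
have iq := pkern_integrable qB xi (pW_bmeas qB).
rewrite -RintegralB//; apply: (@line_bound _ _ xi).
- exact: kernel_diff_bmeas.
- exact: integrableBR.
- move=> j; have [h1 h2 h3 h4] := window_le xi j.
  by apply: segment_diff => //; exact: right_window.
- move=> j; have [h1 h2 h3 h4] := window_le xi j.
  by apply: segment_diff => //; exact: left_window.
Qed.

Lemma Q_integral_diff xi :
  `|\int[leb]_(x in setT) (Num.sg (xi - x) * pkern p xi x * pW p x) -
    \int[leb]_(x in setT) (Num.sg (xi - x) * pkern q xi x * pW q x)| <= 4 * (KD * e).
Proof.
have hs := sg_bmeas xi.
have comm r : (fun x => Num.sg (xi - x) * pkern r xi x * pW r x) =
    (fun x => pkern r xi x * (Num.sg (xi - x) * pW r x)).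
  by apply/funext => x; ring.
rewrite !comm.
have ip := pkern_integrable pB xi (bmeasM hs (pW_bmeas pB)).
have iq := pkern_integrable qB xi (bmeasM hs (pW_bmeas qB)).
rewrite -RintegralB//.
have E1 : (fun x => pkern p xi x * (Num.sg (xi - x) * pW p x) -
    pkern q xi x * (Num.sg (xi - x) * pW q x)) =
    (fun x => Num.sg (xi - x) * (pkern p xi x * pW p x - pkern q xi x * pW q x)).
  by apply/funext => x; ring.
have hd := kernel_diff_bmeas xi.
rewrite E1; apply: (@line_bound _ _ xi).
- exact: bmeasM.
- by have := integrableBR measurableT ip iq; rewrite E1.
- move=> j; have [h1 h2 h3 h4] := window_le xi j.
  rewrite Rintegral_sg//; last by left; rewrite lerDl.
  by apply: segment_diff => //; exact: right_window.
- move=> j; have [h1 h2 h3 h4] := window_le xi j.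
  rewrite Rintegral_sg//; last by right; rewrite gerDl oppr_le0.
  by apply: segment_diff => //; exact: left_window.
Qed.

Lemma gy_diff (f : R -> R) (fL : forall x y, `|f x - f y| <= X * `|x - y|)
    (fB : forall x, `|f x| <= X) xi :
  `|pc p ^+ 2 * f (py p xi) - pc q ^+ 2 * f (py q xi)| <= (2 * B * X + B ^+ 2 * X) * e.
Proof.
have h1 := le_trans (sqr_dist (adm_cB pB) (adm_cB qB)) (ler_wpM2l _ (close_c pq)).
have {h1} : `|pc p ^+ 2 - pc q ^+ 2| <= 2 * B * e by apply: h1; rewrite mulr_ge0.
have : `|pc q ^+ 2| <= B ^+ 2 by rewrite normrX lerXn2r ?nnegrE// (adm_cB qB).
move: (pc p ^+ 2) (pc q ^+ 2) => c c' hc' hcc.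
rewrite (_ : _ - _ = (c - c') * f (py p xi) + c' * (f (py p xi) - f (py q xi))); last by ring.
rewrite (le_trans (ler_normD _ _))// !normrM mulrDl lerD//.
  by rewrite mulrAC ler_pM.
rewrite -mulrA ler_pM//.
rewrite (le_trans (fL _ _))// ler_wpM2l//; exact: close_y pq xi.
Qed.

(** One constant for both [P] and [Q]: the factor 4 of [line_bound] cancels against [4^-1], the
    middle term comes from [c^2 g] or [c^2 g'], and [B] pays for [k^2 / 2] in [P]. *)
Definition KQ : R := KD + (2 * B * X + B ^+ 2 * X) + B.

Lemma pQ_diff xi : `|pQ p xi - pQ q xi| <= KQ * e.
Proof.
rewrite /pQ; have h := gy_diff gdL gdB xi; have h1 := Q_integral_diff xi.
move: h1; set ip := \int[leb]_(x in setT) (Num.sg (xi - x) * pkern p xi x * pW p x).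
set iq := \int[leb]_(x in setT) (Num.sg (xi - x) * pkern q xi x * pW q x) => h1.
move: h; set c := pc p ^+ 2 * gd (py p xi); set c' := pc q ^+ 2 * gd (py q xi) => h.
rewrite (_ : _ - _ = (c - c') - 4^-1 * (ip - iq)); last by ring.
rewrite (le_trans (ler_normB _ _))// normrM (@ger0_norm _ (4^-1 : R)) ?invr_ge0//.
have Be : 0 <= B * e by rewrite mulr_ge0.
by rewrite /KQ; lra.
Qed.

Lemma pP_diff xi : `|pP p xi - pP q xi| <= KQ * e.
Proof.
rewrite /pP; have h := gy_diff gL gB xi; have h1 := P_integral_diff xi.
move: h1; set ip := \int[leb]_(x in setT) (pkern p xi x * pW p x).
set iq := \int[leb]_(x in setT) (pkern q xi x * pW q x) => h1.
move: h; set c := pc p ^+ 2 * g (py p xi); set c' := pc q ^+ 2 * g (py q xi) => h.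
rewrite (close_k0 pq) expr0n/= mulr0 addr0.
have : `|pk p ^+ 2| <= B * e.
  by rewrite normrX expr2 ler_pM// ?(adm_kB pB)// (close_k pq).
move: (pk p ^+ 2) => k2 hk2.
rewrite (_ : _ - _ = (c - c') + 4^-1 * (ip - iq) + 2^-1 * k2); last by ring.
rewrite (le_trans (ler_normD _ _))// (le_trans (lerD (ler_normD _ _) (lexx _)))//.
rewrite !normrM (@ger0_norm _ (4^-1 : R)) ?(@ger0_norm _ (2^-1 : R)) ?invr_ge0//.
have Be : 0 <= B * e by rewrite mulr_ge0.
by rewrite /KQ; lra.
Qed.

Definition KAd : R := KQ + 3 * B.

Lemma pA_diff xi : `|pA p xi - pA q xi| <= KAd * e.
Proof.
rewrite /pA; have h := pP_diff xi.
have h1 := sqr_dist (adm_UB pB xi) (adm_UB qB xi).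
have : `|pk p ^+ 2| <= B * e.
  by rewrite normrX expr2 ler_pM// ?(adm_kB pB)// (close_k pq).
move: (pk p ^+ 2) => k2 hk2.
rewrite (close_k0 pq) expr0n/= mulr0 addr0.
rewrite (_ : _ - _ = (pU p xi ^+ 2 - pU q xi ^+ 2) + 2^-1 * k2 -
   (pP p xi - pP q xi)); last by ring.
rewrite (le_trans (ler_normB _ _))// (le_trans (lerD (ler_normD _ _) (lexx _)))//.
rewrite normrM [`|2^-1|]ger0_norm ?invr_ge0//.
have h3 : `|pU p xi ^+ 2 - pU q xi ^+ 2| <= 2 * B * e.
  by rewrite (le_trans h1)// ler_wpM2l ?mulr_ge0// (close_U pq).
have Be : 0 <= B * e by rewrite mulr_ge0.
by rewrite /KAd; lra.
Qed.

End Two.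

(** * Size and variation of [P] and of the energy coefficient along one profile *)

Section Oscillation.
Variable p : profile.
Hypothesis pB : admissible B p.

Lemma kernel_absW_le xi :
  \int[leb]_(x in setT) (pkern p xi x * `|pW p x|) <= 4 * (E * (KW * (4 * B))).
Proof.
have hW := bmeas_norm (pW_bmeas pB); have hk := pkern_bmeas pB xi.
rewrite (le_trans (ler_norm _))//.
have pc a b w : a <= b -> b <= a + 1 -> (forall x, a <= x <= b -> expR (- `|xi - x|) <= w) ->
    `|\int[leb]_(x in `[a, b]) (pkern p xi x * `|pW p x|)| <= E * (KW * (4 * B)) * w.
  move=> ab ba xw.
  have w0 : 0 <= w by apply: le_trans (xw a _); [exact: expR_ge0|rewrite lexx].
  apply: (@le_trans _ _ (\int[leb]_(x in `[a, b]) (E * w * `|pW p x|))).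
    apply: norm_Rintegral_seg => //; first exact: bmeasM.
      by apply: bmeasM => //; exact: bmeas_cst.
    move=> x xab; rewrite normrM normr_id ler_wpM2r//.
    by rewrite ger0_norm ?pkern_ge0// pkern_w// xw.
  rewrite Rintegral_segZ// [leRHS](_ : _ = E * w * (KW * (4 * B))); last by ring.
  by rewrite ler_wpM2l ?mulr_ge0// pW_unit.
apply: (@line_bound _ _ xi).
- exact: bmeasM.
- exact: pkern_integrable.
- move=> j; have [h1 h2 h3 h4] := window_le xi j.
  by apply: pc => //; exact: right_window.
- move=> j; have [h1 h2 h3 h4] := window_le xi j.
  by apply: pc => //; exact: left_window.
Qed.

Definition KP : R := 2 * (E * (KW * (4 * B))) + B ^+ 2 * X.

(** Kernels centred at [a] and [b] differ by at most [|y(b) - y(a)|] times their sum, which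
    dominates each of them. The variation of [P] is thus controlled by that of [y], which makes [pA]
    an admissible weight for [abel_estimate]. *)
Lemma pP_var a b : `|pP p b - pP p a| <= KP * `|py p b - py p a|.
Proof.
have hW := pW_bmeas pB; have haW := bmeas_norm hW.
have ia := pkern_integrable pB a hW; have ib := pkern_integrable pB b hW.
have iaa := pkern_integrable pB a haW; have ibb := pkern_integrable pB b haW.
pose d : R := `|py p b - py p a|; rewrite -/d.
rewrite /pP (_ : _ - _ = 4^-1 * (\int[leb]_(x in setT) (pkern p b x * pW p x) -
   \int[leb]_(x in setT) (pkern p a x * pW p x)) +
   pc p ^+ 2 * (g (py p b) - g (py p a))); last by ring.
rewrite (le_trans (ler_normD _ _))// (normrM (_ ^+ 2)) (normrM 4^-1) (@ger0_norm _ (4^-1 : R))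
  ?invr_ge0//.
have h2 : `|pc p ^+ 2| * `|g (py p b) - g (py p a)| <= B ^+ 2 * (X * d).
  by rewrite ler_pM// normrX lerXn2r ?nnegrE// (adm_cB pB).
suff h1 : `|\int[leb]_(x in setT) (pkern p b x * pW p x) -
   \int[leb]_(x in setT) (pkern p a x * pW p x)| <= d * (8 * (E * (KW * (4 * B)))).
    have q0 : 0 <= (4^-1 : R) by rewrite invr_ge0.
  apply: le_trans (lerD (ler_wpM2l q0 h1) h2) _.
  by clear h1 h2; rewrite /KP; lra.
rewrite -RintegralB//.
have i1 : leb.-integrable setT (EFin \o (fun x => pkern p b x * pW p x - pkern p a x * pW p x)).
  exact: integrableBR.
have i2 : leb.-integrable setT (EFin \o (fun x => pkern p b x * `|pW p x| + pkern p a x * `|pW p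
  x|)).
  exact: integrableDR.
apply: (le_trans (le_normr_Rintegral _ i1)) => //.
apply: (@le_trans _ _ (\int[leb]_(x in setT) (d * (pkern p b x * `|pW p x| + pkern p a x * `|pW p
  x|)))).
  apply: le_Rintegral => //.
  - exact: integrable_normR.
  - exact: integrableZR.
  move=> x _; rewrite -mulrBl normrM -mulrDl mulrA ler_wpM2r//.
  have hb : expR (- `|py p b - py p x|) <= pkern p b x + pkern p a x by rewrite lerDl pkern_ge0.
  have ha : expR (- `|py p a - py p x|) <= pkern p b x + pkern p a x by rewrite lerDr pkern_ge0.
  rewrite (le_trans (expR_dist hb ha))// ler_wpM2r ?addr_ge0 ?pkern_ge0//.
  rewrite (le_trans (ler_dist_dist _ _))// /d (_ : _ - _ - _ = py p b - py p a)//; ring.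
rewrite RintegralZl//; apply: ler_wpM2l; first exact: normr_ge0.
rewrite (RintegralD _ ibb iaa)//.
apply: le_trans (lerD (kernel_absW_le b) (kernel_absW_le a)) _.
by clear h2; lra.
Qed.

Definition SA : R := 2 * B ^+ 2 + E * (KW * (4 * B)) + B ^+ 2 * X.

Lemma pA_le x : `|pA p x| <= SA.
Proof.
have hW := pW_bmeas pB; have haW := bmeas_norm hW.
have i1 := pkern_integrable pB x hW; have i2 := pkern_integrable pB x haW.
have h1 : `|\int[leb]_(eta in setT) (pkern p x eta * pW p eta)| <= 4 * (E * (KW * (4 * B))).
  apply: le_trans (kernel_absW_le x).
  apply: (le_trans (le_normr_Rintegral _ i1)) => //.
  apply: le_Rintegral => //; first exact: integrable_normR.
  by move=> eta _; rewrite normrM (ger0_norm (pkern_ge0 _ _ _)).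
rewrite /pA /pP (_ : _ - _ = pU p x ^+ 2 - 4^-1 * \int[leb]_(eta in setT) (pkern p x eta * pW p eta)
   - pc p ^+ 2 * g (py p x)); last by ring.
rewrite (le_trans (ler_normB _ _))// (le_trans (lerD (ler_normB _ _) (lexx _)))//.
have h2 : `|pU p x ^+ 2| <= B ^+ 2 by rewrite normrX lerXn2r ?nnegrE// (adm_UB pB).
have h3 : `|pc p ^+ 2 * g (py p x)| <= B ^+ 2 * X.
  by rewrite normrM ler_pM// normrX lerXn2r ?nnegrE// (adm_cB pB).
rewrite (normrM 4^-1) (@ger0_norm _ (4^-1 : R)) ?invr_ge0//.
have q0 : 0 <= (4^-1 : R) by rewrite invr_ge0.
apply: le_trans (lerD (lerD h2 (ler_wpM2l q0 h1)) h3) _.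
clear h1; by have := sqr_ge0 B; rewrite /SA; lra.
Qed.

Definition KA : R := B + KP.

Lemma KA_ge0 : 0 <= KA.
Proof. by rewrite /KA /KP !addr_ge0 ?mulr_ge0// sqr_ge0. Qed.

Lemma pA_var a b : a <= b -> `|pA p b - pA p a| <= KA * (pv p b - pv p a).
Proof.
move=> ab; rewrite /pA (_ : _ - _ = (pU p b ^+ 2 - pU p a ^+ 2) - (pP p b - pP p a)); last by ring.
rewrite (le_trans (ler_normB _ _))//.
have h1 := sqr_dist (adm_UB pB b) (adm_UB pB a).
have h2 : 2 * B * `|pU p b - pU p a| <= 2 * B * (2^-1 * (pv p b - pv p a)).
  by rewrite ler_wpM2l ?mulr_ge0// U_le_v.
have h3 : KP * `|py p b - py p a| <= KP * (pv p b - pv p a).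
  rewrite ler_wpM2l ?y_le_v// /KP addr_ge0 ?mulr_ge0// sqr_ge0//.
by have := pP_var a b; rewrite /KA; lra.
Qed.

Lemma pA_bmeas : bmeas (pA p).
Proof.
apply: (@bmeas_cont _ _ SA); last exact: pA_le.
have KA0 := KA_ge0.
have [M hM] := (pvx_bmeas pB).2.
apply: (@lip_continuous _ _ (KA * M)) => x y xy.
rewrite (le_trans (pA_var xy))// -mulrA ler_wpM2l//.
rewrite (le_trans (ler_norm _))//.
exact: primitive_lip (pvx_bmeas pB) hM (pv_primitive pB) x y xy.
Qed.

End Oscillation.

Definition KE : R := 4 * B * KAd + (4 * SA + 8 * B * KA).

(** The difference of the coefficients is paired with [pUx p], controlled by [pvx p], and the
    difference of [pUx] with the coefficient of [q], where [abel_estimate] needs only the closeness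
    of [pU]. *)
Lemma energy_diff p q (e : R) a b : 0 <= e -> admissible B p -> admissible B q ->
  profile_close e p q -> a <= b -> b <= a + 1 ->
  `|\int[leb]_(x in `[a, b]) (2 * pA p x * pUx p x) -
    \int[leb]_(x in `[a, b]) (2 * pA q x * pUx q x)| <= KE * e.
Proof.
move=> e0 pB qB pq ab ba.
have hAp := pA_bmeas pB; have hAq := pA_bmeas qB.
have hUp := adm_Ux pB; have hUq := adm_Ux qB.
have b2 := bmeas_cst (2 : R).
have bp : bmeas (fun x => 2 * pA p x * pUx p x) by apply: bmeasM => //; exact: bmeasM.
have bq : bmeas (fun x => 2 * pA q x * pUx q x) by apply: bmeasM => //; exact: bmeasM.
rewrite -Rintegral_segB//.
have b3 : bmeas (fun x => (pA p x - pA q x) * pUx p x).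
  by apply: bmeasM => //; exact: bmeasB.
have b4 : bmeas (fun x => pA q x * (pUx p x - pUx q x)).
  by apply: bmeasM => //; exact: bmeasB.
have -> : (fun x => 2 * pA p x * pUx p x - 2 * pA q x * pUx q x) =
    (fun x => 2 * ((pA p x - pA q x) * pUx p x + pA q x * (pUx p x - pUx q x))).
  by apply/funext => x; ring.
rewrite Rintegral_segZ; last exact: bmeasD.
rewrite (Rintegral_segD _ _ b3 b4) normrM ger0_norm//.
have KAd0 : 0 <= KAd * e by apply: le_trans (pA_diff e0 pB qB pq a).
have KA0 := KA_ge0.
have h1 : `|\int[leb]_(x in `[a, b]) ((pA p x - pA q x) * pUx p x)| <= KAd * e * (2 * B).
  apply: (@le_trans _ _ (\int[leb]_(x in `[a, b]) (KAd * e * (2^-1 * pvx p x)))).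
    have hv := pvx_bmeas pB.
    apply: norm_Rintegral_seg => //.
      by do 2 apply: bmeasZ.
    by move=> x _; rewrite normrM ler_pM// ?Ux_le// pA_diff.
  rewrite !Rintegral_segZ; first last.
  - by apply: bmeasZ; exact: pvx_bmeas.
  - exact: pvx_bmeas.
  rewrite -pv_primitive// ler_wpM2l//.
  by have := v_unit pB ab ba; lra.
have h2 : `|\int[leb]_(x in `[a, b]) (pA q x * (pUx p x - pUx q x))| <=
    e * (2 * SA + KA * (4 * B)).
  have h := @abel_estimate R (pA q) (fun x => KA * pv q x)
    (fun x => pU p x - pU q x) (fun x => pUx p x - pUx q x) a b SA e ab e0.
  apply: (le_trans (h _ _ _ _ _ _)) => //.
  - exact: bmeasB.
  - move=> x y xy; rewrite Rintegral_segB// -(adm_U pB)// -(adm_U qB)//; ring.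
  - by move=> x y ax xy yb; rewrite -mulrBr pA_var.
  - by move=> x _; exact: pA_le.
  - by move=> x _; exact: close_U pq x.
  by rewrite ler_wpM2l// lerD2l -mulrBr ler_wpM2l// v_unit.
rewrite /KE; have := ler_normD (\int[leb]_(x in `[a, b]) ((pA p x - pA q x) * pUx p x))
  (\int[leb]_(x in `[a, b]) (pA q x * (pUx p x - pUx q x))).
lra.
Qed.

End Fixed.
End Profiles.

(** * Families of functions of time *)

Section Time.
Context {R : realType}.
Implicit Types (s t r T e L : R).

(** Uniformity in [i] expresses continuity of a curve in a supremum norm while only scalar functions
    are handled. *)
Definition equicontinuous_at (I : Type) (F : I -> R -> R) (s : R) :=
  forall e, 0 < e -> exists2 d : R, 0 < d &
    forall r, 0 <= r -> `|r - s| < d -> forall i, `|F i r - F i s| <= e.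

(** A uniform bound at one time persists nearby by equicontinuity; real induction replaces the
    covering argument for [[0, T]]. *)
Lemma equicontinuous_bounded (I : Type) (F : I -> R -> R) T : 0 <= T ->
  (forall s, 0 <= s <= T -> equicontinuous_at F s) ->
  (forall s, 0 <= s <= T -> exists M, forall i, `|F i s| <= M) ->
  exists M, forall s, 0 <= s <= T -> forall i, `|F i s| <= M.
Proof.
move=> T0 Fc Fb.
pose P s := exists M, forall r, 0 <= r <= s -> forall i, `|F i r| <= M.
have loc s : 0 <= s <= T -> exists M, exists2 d : R, 0 < d &
    forall r, 0 <= r -> `|r - s| < d -> forall i, `|F i r| <= M.
  move=> sT; have [M hM] := Fb _ sT; have [d d0 hd] := Fc _ sT _ (@ltr01 R).
  exists (M + 1), d => // r r0 rs i.
  rewrite (_ : F i r = F i s + (F i r - F i s)); last by ring.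
  by rewrite (le_trans (ler_normD _ _))// lerD// hd.
have step s d M M' r0 : 0 <= r0 -> r0 <= s -> 0 < d -> s - d < r0 ->
   (forall r, 0 <= r <= r0 -> forall i, `|F i r| <= M) ->
   (forall r, 0 <= r -> `|r - s| < d -> forall i, `|F i r| <= M') ->
   forall r, 0 <= r -> r < s + d -> forall i, `|F i r| <= Num.max M M'.
  move=> r00 r0s d0 sd h1 h2 r r0' rsd i; rewrite le_max.
  have [rr|rr] := leP r r0; first by rewrite h1 ?r0'.
  apply/orP; right; apply: h2 => //; rewrite ltr_distl rsd andbT; lra.
have H : forall s, 0 <= s <= T -> P s.
  apply: real_induction => s sT hs.
  - have [M' [d d0 hd]] := loc _ sT.
    have /andP[s0 _] := sT.
    have [s00|sN0] := eqVneq s 0.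
      exists M' => r /andP[r0 rs] i; apply: hd => //.
      by rewrite (_ : r = 0) ?s00 ?subrr ?normr0//; apply/eqP; rewrite eq_le r0 -s00 rs.
    have sp : 0 < s by rewrite lt_neqAle eq_sym sN0.
    (* The induction hypothesis covers times up to [r0], and the local bound covers times after
       [s - d]; placing [r0] between [s - d] and [s] makes the two ranges overlap. *)
    pose r0 := Num.max 0 (s - d / 2).
    have r0s : r0 < s by rewrite /r0 gt_max sp/= gtrBl divr_gt0.
    have [|M hM] := hs r0; first by rewrite r0s andbT /r0 le_max lexx.
    exists (Num.max M M') => r /andP[r00 rs]; apply: (step s d M M' r0) => //.
    + by rewrite /r0 le_max lexx.
    + exact: ltW.
    + by rewrite /r0 lt_max; apply/orP; right; lra.
    + by rewrite (le_lt_trans rs)// ltrDl.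
  - have /andP[s0 sT'] := sT; have sT2 : 0 <= s <= T by rewrite s0 ltW.
    have [M' [d d0 hd]] := loc _ sT2.
    have [|M hM] := hs s; first by rewrite s0 lexx.
    exists (d / 2); first by rewrite divr_gt0.
    move=> r /andP[sr rsd]; exists (Num.max M M') => r' /andP[r'0 r'r].
    apply: (step s d M M' s) => //; lra.
have [|M hM] := H T; first by rewrite T0 lexx.
by exists M.
Qed.

(** Mean value inequality: [phi - f] and [phi + f] are nondecreasing. Derivatives are asked for only
    inside the interval, as at time 0 they are one-sided. *)
Lemma derive_bound (f df phi dphi : R -> R) T : 0 <= T ->
  {within `[0, T], continuous f} -> {within `[0, T], continuous phi} ->
  (forall s, 0 < s < T -> is_derive s (1 : R) f (df s)) ->
  (forall s, 0 < s < T -> is_derive s (1 : R) phi (dphi s)) ->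
  (forall s, 0 < s < T -> `|df s| <= dphi s) ->
  `|f T - f 0| <= phi T - phi 0.
Proof.
move=> T0 cf cphi hf hphi hle.
have key (g dg : R -> R) : {within `[0, T], continuous g} ->
    (forall s, 0 < s < T -> is_derive s (1 : R) g (dg s)) ->
    (forall s, 0 < s < T -> `|dg s| <= dphi s) -> g T - g 0 <= phi T - phi 0.
  move=> cg hg gle.
  rewrite -subr_ge0 (_ : _ - _ = (phi - g) T - (phi - g) 0); last by rewrite !fctE; ring.
  have d s : s \in `]0, T[ -> is_derive s (1 : R) (phi - g) (dphi s - dg s).
    by rewrite in_itv/= => sT; apply: is_deriveB; [exact: hphi|exact: hg].
  rewrite subr_ge0; apply: (@ger0_derive1_le_cc _ (phi - g) 0 T) => //.
  - by move=> s sT; have [] := d _ sT.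
  - move=> s sT; have [h1 h2] := d _ sT.
    rewrite derive1E h2 subr_ge0 (le_trans (ler_norm _))// gle//.
  - apply/subspace_continuousP => x xT.
    by apply: cvgB; [move/subspace_continuousP : cphi|move/subspace_continuousP : cg]; exact.
  - by rewrite in_itv/= lexx.
  - by rewrite in_itv/= lexx andbT.
rewrite ler_norml; apply/andP; split; last exact: key hf hle.
rewrite lerNl (_ : - _ = (- f) T - (- f) 0); last by rewrite !fctE; ring.
apply: (key _ (fun s => - df s)).
- apply/subspace_continuousP => x xT.
  by apply: cvgN; move/subspace_continuousP : cf; exact.
- by move=> s sT; apply: is_deriveN; exact: hf.
- by move=> s sT; rewrite normrN hle.
Qed.

Lemma equicontinuous_within (I : Type) (F : I -> R -> R) T :
  (forall s, 0 <= s <= T -> equicontinuous_at F s) ->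
  forall i t, t <= T -> {within `[0, t], continuous (F i)}.
Proof.
move=> Fc i t tT; apply/subspace_continuousP => s /=; rewrite in_itv/= => /andP[s0 st].
apply/cvgrPdist_le => e e0.
have [|d d0 hd] := Fc s _ _ e0; first by rewrite s0 (le_trans st).
rewrite near_withinE; apply/nbhs_ballP; exists d => //= r.
rewrite /ball/= distrC => rs; rewrite in_itv/= => /andP[r0 rt].
by rewrite distrC; exact: hd.
Qed.

(* With [eps] as initial bound, the derivative estimate only holds as long as
   all members stay below 1; the strict gain [eps] at each time lets the bound
   [2 eps exp (L s)] propagate. *)
Lemma gronwall_family (I : Type) (D dD : I -> R -> R) (eps L T : R) :
  0 < eps -> 0 <= L -> 2 * eps * expR (L * T) <= 1 ->
  (forall i, `|D i 0| <= eps) ->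
  (forall s, 0 <= s <= T -> equicontinuous_at D s) ->
  (forall i s, 0 < s < T -> is_derive s (1 : R) (D i) (dD i s)) ->
  (forall s e, 0 < s < T -> eps <= e -> e <= 1 -> (forall i, `|D i s| <= e) ->
     forall i, `|dD i s| <= L * e) ->
  forall s, 0 <= s <= T -> forall i, `|D i s| <= 2 * eps * expR (L * s).
Proof.
move=> eps0 L0 epsT D0 Dc Dd Dl.
pose b s := 2 * eps * expR (L * s).
have beps s : 0 <= s -> eps <= b s.
  move=> s0; rewrite /b -[leLHS]mulr1 ler_pM// ?(ltW eps0)//; first lra.
  by rewrite -expR0 ler_expR mulr_ge0.
have b1 s : s <= T -> b s <= 1.
  move=> sT; rewrite (le_trans _ epsT)// /b ler_wpM2l ?mulr_ge0 ?(ltW eps0)//.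
  by rewrite ler_expR ler_wpM2l.
have db s : is_derive s (1 : R) b (L * b s).
  apply: is_derive_eq; rewrite /b /GRing.scale/=; ring.
have cb (A : set R) : {within A, continuous b}.
  apply: continuous_subspaceT => s; apply: differentiable_continuous.
  by apply/derivable1_diffP; have [] := db s.
(* The gain arises at time 0: [b 0] equals [2 * eps] while the family starts below [eps]. The
   derivative estimate is called only at times before [s], where the bound is already known. *)
have strict s : 0 <= s <= T -> (forall r, 0 < r < s -> forall i, `|D i r| <= b r) ->
    forall i, `|D i s| <= b s - eps.
  move=> /andP[s0 sT] hr i.
  have : `|D i s - D i 0| <= b s - b 0.
    apply: (@derive_bound (D i) (dD i) b (fun r => L * b r)) => //.
    - exact: (equicontinuous_within Dc).
    - by move=> r /andP[r0 rs]; apply: Dd; rewrite r0 (lt_le_trans rs).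
    - move=> r /andP[r0 rs]; apply: Dl.
      + by rewrite r0 (lt_le_trans rs).
      + exact/beps/ltW.
      + by apply: b1; rewrite (le_trans (ltW rs)).
      + by apply: hr; rewrite r0.
  have := D0 i; have := ler_normD (D i s - D i 0) (D i 0); rewrite subrK.
  rewrite {2}/b mulr0 expR0 mulr1; lra.
apply: real_induction => s sT hs.
- move=> i; have := strict s sT; move=> /(_ _ i) h; apply: (le_trans (h _)).
    by move=> r /andP[r0 rs]; apply: hs; rewrite ltW.
  by rewrite lerBlDr lerDl ltW.
- have /andP[s0 sT'] := sT; have sT2 : 0 <= s <= T by rewrite s0 ltW.
  have hst : forall i, `|D i s| <= b s - eps.
    by apply: strict => // r /andP[r0 rs]; apply: hs; rewrite !ltW.
  have [d d0 hd] := Dc _ sT2 _ eps0.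
  exists (d / 2); first by rewrite divr_gt0.
  move=> r /andP[sr rsd] i.
  have h1 : `|D i r - D i s| <= eps.
    apply: hd; first exact: le_trans sr.
    by rewrite ger0_norm ?subr_ge0//; lra.
  have h2 : `|D i s| <= b s - eps.
    exact: hst.
  have h3 : b s <= b r by rewrite /b ler_wpM2l ?mulr_ge0 ?(ltW eps0)// ler_expR ler_wpM2l.
  have := ler_normD (D i r - D i s) (D i s); rewrite subrK.
  rewrite -/(b r); lra.
Qed.

Lemma near_time (P : R -> Prop) t :
  (\forall s \near within [set s | 0 <= s] t^', P s) <->
  exists2 d : R, 0 < d & forall s, 0 <= s -> s != t -> `|s - t| < d -> P s.
Proof.
rewrite near_withinE /dnbhs near_withinE; split.
- move=> /nbhs_ballP[d /= d0 hd]; exists d => // s s0 st sd.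
  by apply: hd => //; rewrite /ball/= distrC.
- move=> [d d0 hd]; apply/nbhs_ballP; exists d => //= s.
  by rewrite /ball/= distrC => sd st s0; exact: hd.
Qed.

Lemma time_derivP (f : R -> R) t l : time_deriv f t l -> forall e, 0 < e ->
  exists2 d : R, 0 < d & forall s, 0 <= s -> s != t -> `|s - t| < d ->
    `|(s - t)^-1 * (f s - f t) - l| <= e.
Proof.
move=> h e e0; apply/near_time.
move/cvgrPdist_le : h => /(_ _ e0); apply: filterS => s.
by rewrite distrC.
Qed.

Lemma time_deriv_is_derive (f : R -> R) t l : 0 < t -> time_deriv f t l ->
  is_derive t (1 : R) f l.
Proof.
move=> t0 h.
have H : h^-1 *: ((f \o shift t) (h *: (1 : R)) - f t) @[h --> 0^'] --> l.
  apply/cvgrPdist_le => e e0; have [d d0 hd] := time_derivP h e0.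
  (* Increments smaller than [t] keep the time nonnegative, where [time_deriv] gives information. *)
  rewrite /dnbhs near_withinE; apply/nbhs_ballP; exists (Num.min d t);
    first by rewrite /= lt_min d0.
  move=> k; rewrite /ball/= sub0r normrN lt_min => /andP[kd kt] k0.
  have := hd (k + t); rewrite addrK /GRing.scale/= mulr1 distrC; apply => //.
    by move: kt; rewrite ltr_norml => /andP[h1 _]; lra.
  by rewrite -subr_eq0 addrK.
apply: DeriveDef; first by apply/cvg_ex; exists l.
exact: cvg_lim H.
Qed.

Lemma time_deriv0_const (f : R -> R) : (forall t, 0 <= t -> time_deriv f t 0) ->
  forall t, 0 <= t -> f t = f 0.
Proof.
move=> hf t t0; apply/eqP; rewrite -subr_eq0 -normr_le0.
have := @derive_bound f (fun=> 0) (fun=> 0) (fun=> 0) t t0; rewrite subrr; apply => //.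
- apply/subspace_continuousP => s /=; rewrite in_itv/= => /andP[s0 st].
  apply/cvgrPdist_le => e e0.
  have [d d0 hd] := time_derivP (hf _ s0) ltr01.
  rewrite near_withinE; apply/nbhs_ballP; exists (Num.min d e); first by rewrite /= lt_min d0.
  move=> r /=; rewrite /ball/= distrC lt_min => /andP[rd re]; rewrite in_itv/= => /andP[r0 _].
  have [->|rs] := eqVneq r s; first by rewrite subrr normr0 ltW.
  have := hd _ r0 rs rd; rewrite subr0 normrM normfV ler_pdivrMl ?normr_gt0 ?subr_eq0//.
  by rewrite mulr1 distrC => /le_trans; apply; rewrite ltW.
- by apply: continuous_subspaceT => s; exact: cst_continuous.
- by move=> s /andP[s0 _]; apply: time_deriv_is_derive => //; apply: hf; exact: ltW.
- by move=> s _; rewrite normr0.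
Qed.

End Time.

(** * Weak derivatives and function spaces *)

Section WeakDerivatives.
Context {R : realType}.
Implicit Types (f g phi chi : R -> R) (a b c x y k : R).
Local Notation leb := (@lebesgue_measure R).

Lemma locint_seg f a b : locally_integrable setT f ->
  leb.-integrable `[a, b] (EFin \o f).
Proof.
move=> [mf _ hf]; apply/integrableP; split.
  by apply/measurable_EFinR; exact: measurable_funTS.
by apply: hf => //; exact: segment_compact.
Qed.

Lemma derivableT_continuous f : (forall x, derivable f x 1) -> continuous f.
Proof.
by move=> df x; apply/differentiable_continuous/derivable1_diffP; exact: df.
Qed.

Lemma smooth_continuous f n : smooth f -> continuous (derive1n n f).
Proof. by move=> sf; apply: derivableT_continuous => x; exact: sf. Qed.

Lemma derive1_near f g x : (\forall y \near x, f y = g y) -> derive1 f x = derive1 g x.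
Proof. by move=> fg; rewrite !derive1E; exact: near_eq_derive. Qed.

Lemma smooth_affine f k c : smooth f -> forall n,
  derive1n n (fun x => f (k * (x - c))) = (fun x => k ^+ n * derive1n n f (k * (x - c))).
Proof.
move=> sf; elim=> [|n ih]; first by apply/funext => x; rewrite !derive1n0 mul1r.
rewrite derive1nS ih; apply/funext => x; rewrite derive1E.
have d1 : is_derive (k * (x - c)) 1 (derive1n n f) (derive1n n.+1 f (k * (x - c))).
  by rewrite derive1nS derive1E; apply: DeriveDef => //; exact: sf.
have d2 : is_derive x 1 (fun x => k * (x - c)) k.
  by apply: is_derive_eq; rewrite /GRing.scale/=; ring.
have d3 := @is_derive1_comp _ (derive1n n f) (fun x => k * (x - c)) x _ _ d1 d2.
have d4 : is_derive x 1 (fun x => k ^+ n * derive1n n f (k * (x - c))) (k ^+ n.+1 * derive1n n.+1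
  f (k * (x - c))).
  by apply: is_derive_eq; rewrite /GRing.scale/= exprS; ring.
by rewrite derive_val.
Qed.

Lemma smooth_affine_smooth f k c : smooth f -> smooth (fun x => f (k * (x - c))).
Proof.
move=> sf n x; rewrite smooth_affine//.
have d1 : is_derive (k * (x - c)) 1 (derive1n n f) (derive1n n.+1 f (k * (x - c))).
  by rewrite derive1nS derive1E; apply: DeriveDef => //; exact: sf.
have d2 : is_derive x 1 (fun x => k * (x - c)) k.
  by apply: is_derive_eq; rewrite /GRing.scale/=; ring.
have d3 := @is_derive1_comp _ (derive1n n f) (fun x => k * (x - c)) x _ _ d1 d2.
exact: ex_derive.
Qed.

Lemma derive1nB f g : smooth f -> smooth g -> forall n,
  derive1n n (fun x => f x - g x) = (fun x => derive1n n f x - derive1n n g x).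
Proof.
move=> sf sg; elim=> [|n ih]; first by apply/funext => x; rewrite !derive1n0.
rewrite derive1nS ih; apply/funext => x; rewrite !derive1nS derive1E !derive1E.
by rewrite deriveB.
Qed.

Lemma smoothB f g : smooth f -> smooth g -> smooth (fun x => f x - g x).
Proof.
by move=> sf sg n x; rewrite derive1nB//; apply: derivableB; [exact: sf|exact: sg].
Qed.

Section Cutoff.
Variable chi : R -> R.
Hypothesis cchi : cutoff chi.

Lemma cutoff_smooth : smooth chi. Proof. by case: cchi. Qed.

Lemma cutoff_cont : continuous chi.
Proof. exact: (@smooth_continuous chi 0%N cutoff_smooth). Qed.

Lemma cutoff_is_derive x : is_derive x (1 : R) chi (derive1 chi x).
Proof. by apply: DeriveDef; [exact: (@cutoff_smooth 0%N _)|rewrite derive1E]. Qed.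

Lemma cutoff_cont1 : continuous (derive1 chi).
Proof. exact: (@smooth_continuous chi 1%N cutoff_smooth). Qed.

Lemma cutoff_incr x y : x <= y -> chi x <= chi y.
Proof.
move=> xy; have [_ _ _ h] := cchi.
apply: (@ger0_derive1_le_cc _ chi x y) => //.
- by move=> z _; exact: (@cutoff_smooth 0%N _).
- by apply: continuous_subspaceT; exact: cutoff_cont.
- by rewrite in_itv/= lexx.
- by rewrite in_itv/= lexx andbT.
Qed.

(** The definition speaks of negative [x] only; the value at 0 follows by continuity. *)
Lemma cutoff_le0 x : x <= 0 -> chi x = 0.
Proof.
have [_ h0 _ _] := cchi.
rewrite le_eqVlt => /predU1P[->|]; last exact: h0.
apply/eqP; rewrite -normr_le0; apply/ler_addgt0Pr => e e0; rewrite add0r.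
have /cvgrPdist_le/(_ _ e0)/nbhs_ballP[d /= d0 hd] := @cutoff_cont 0.
have := hd (- (d / 2)); rewrite /ball/= sub0r opprK.
rewrite (h0 (- (d / 2))) ?oppr_lt0 ?divr_gt0// subr0; apply.
by rewrite ger0_norm ?divr_ge0 ?ltW//; lra.
Qed.

Lemma cutoff_01 x : 0 <= chi x <= 1.
Proof.
have [_ h0 h1 _] := cchi; apply/andP; split.
  have [/cutoff_le0->//|x0] := leP x 0.
  by rewrite -(cutoff_le0 (lexx 0)) cutoff_incr// ltW.
have [x1|/ltW x1] := leP 1 x; first by rewrite h1.
by rewrite -(h1 1)// cutoff_incr.
Qed.

Lemma cutoff_norm x : `|chi x| <= 1.
Proof. by have /andP[h0 h1] := cutoff_01 x; rewrite ger0_norm. Qed.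

Lemma cutoff_d0 n x : (0 < n)%N -> x < 0 \/ 1 < x -> derive1n n chi x = 0.
Proof.
have [_ h0 h1 _] := cchi.
case: n => // n _ [x0|x1].
- elim: n x x0 => [|n ih] x x0; rewrite derive1nS (@derive1_near _ (fun=> 0));
  try exact: derive1_cst.
    by near=> y; rewrite derive1n0 h0//; near: y; exact: lt_nbhsl.
  by near=> y; apply: ih; near: y; exact: lt_nbhsl.
- elim: n x x1 => [|n ih] x x1; rewrite derive1nS.
    rewrite (@derive1_near _ (fun=> 1)); first exact: derive1_cst.
    by near=> y; rewrite derive1n0 h1// ltW//; near: y; exact: lt_nbhsr.
  rewrite (@derive1_near _ (fun=> 0)); first exact: derive1_cst.
  by near=> y; apply: ih; near: y; exact: lt_nbhsr.
Unshelve. all: by end_near. Qed.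

(* As [k] tends to infinity this tends to the indicator function of ]a, b], and
   its derivative to the difference of the Dirac masses at [a] and [b]. *)
Definition bump a b k x := chi (k * (x - a)) - chi (k * (x - b)).

Lemma bump_test a b k : a <= b -> 0 < k -> test_function (bump a b k).
Proof.
move=> ab k0; split.
  apply: smoothB; apply: smooth_affine_smooth; exact: cutoff_smooth.
exists (`|a| + `|b| + k^-1) => x hx; rewrite /bump.
have [_ h0 h1 _] := cchi.
have ki : 0 < k^-1 by rewrite invr_gt0.
have [x0|x0] := leP 0 x.
  rewrite (ger0_norm x0) in hx.
  have e (z : R) : z + k^-1 <= x -> 1 <= k * (x - z).
    by move=> zx; rewrite -ler_pdivrMl// mulr1; lra.
  rewrite !h1 ?subrr//; apply: e.
    have := ler_norm b; have := normr_ge0 a; lra.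
  have := ler_norm a; have := normr_ge0 b; lra.
rewrite (ltr0_norm x0) in hx.
have e (z : R) : x < z -> k * (x - z) < 0.
  by move=> zx; rewrite pmulr_rlt0// subr_lt0.
rewrite !h0 ?subrr//; apply: e.
  have := ler_norm (- b); rewrite normrN; have := normr_ge0 a; lra.
have := ler_norm (- a); rewrite normrN; have := normr_ge0 b; lra.
Qed.

Lemma bump_derive a b k x : derive1 (bump a b k) x =
  k * derive1 chi (k * (x - a)) - k * derive1 chi (k * (x - b)).
Proof.
have := @derive1nB (fun x => chi (k * (x - a))) (fun x => chi (k * (x - b)))
  (@smooth_affine_smooth chi _ _ cutoff_smooth) (@smooth_affine_smooth chi _ _ cutoff_smooth) 1%N.
rewrite !smooth_affine//; [|exact: cutoff_smooth..].
by rewrite !derive1n1 !expr1 /bump => ->.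
Qed.

Definition mollifier c k x := k * derive1 chi (k * (x - c)).

Lemma mollifier_cont c k : continuous (mollifier c k).
Proof.
move=> x; apply: cvgM; first exact: cvg_cst.
apply: (@continuous_comp _ _ _ (fun x => k * (x - c)) (derive1 chi)); last exact: cutoff_cont1.
by apply: cvgM; [exact: cvg_cst|apply: cvgB; [exact: cvg_id|exact: cvg_cst]].
Qed.

Lemma mollifier_supp c k x : 0 < k -> ~~ (x \in `[c, c + k^-1]) -> mollifier c k x = 0.
Proof.
move=> k0; rewrite in_itv/= negb_and -!ltNge => h.
rewrite /mollifier -derive1n1 cutoff_d0 ?mulr0//.
case/orP : h => h; [left|right].
  by rewrite pmulr_rlt0// subr_lt0.
by rewrite -ltr_pdivrMl// mulr1; lra.
Qed.

Lemma mollifier_int c k : 0 < k -> \int[leb]_(x in `[c, c + k^-1]) mollifier c k x = 1.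
Proof.
move=> k0; have ki : 0 < k^-1 by rewrite invr_gt0.
have sc := @smooth_affine_smooth chi k c cutoff_smooth.
have cc : c < c + k^-1 by rewrite ltrDl.
rewrite /Rintegral (@continuous_FTC2 _ _ (fun x => chi (k * (x - c))))//=.
- have [_ _ h1 _] := cchi.
  have -> : k * (c - c) = 0 by rewrite subrr mulr0.
  rewrite (cutoff_le0 (lexx 0)) h1 ?subr0//.
  by rewrite [c + _]addrC addrK mulfV ?gt_eqF.
- by apply: continuous_subspaceT; exact: mollifier_cont.
- have cs := @smooth_continuous _ 0%N sc.
  split; first by move=> x _; exact: (sc 0%N).
    by apply: cvg_at_right_filter; exact: cs.
  by apply: cvg_at_left_filter; exact: cs.
- move=> x _; have := @smooth_affine chi k c cutoff_smooth 1%N.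
  by rewrite !derive1n1 expr1 => ->.
Qed.

Lemma Rintegral_supp (f : R -> R) a b : (forall x, ~~ (x \in `[a, b]) -> f x = 0) ->
  \int[leb]_(x in setT) f x = \int[leb]_(x in `[a, b]) f x.
Proof.
move=> hf; rewrite [RHS]Rintegral_mkcond; apply: eq_Rintegral => x _.
rewrite patchE; case: ifPn => //; rewrite notin_setE/= => /negP; exact: hf.
Qed.

Lemma mollifier_lim f c : continuous f ->
  \int[leb]_(x in setT) (f x * mollifier c n.+1%:R x) @[n --> \oo] --> f c.
Proof.
move=> cf; apply/cvgrPdist_le => e e0.
have /cvgrPdist_le/(_ _ e0)/nbhs_ballP[d /= d0 hd] := cf c.
near=> n; have n0 : 0 < n.+1%:R :> R by [].
have nd : n.+1%:R^-1 < d.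
  by near: n; exact: near_infty_natSinv_lt (PosNum d0).
rewrite (@Rintegral_supp _ c (c + n.+1%:R^-1)); last first.
  by move=> x hx; rewrite mollifier_supp// mulr0.
have cm := @mollifier_cont c n.+1%:R.
have sg (u : R -> R) : continuous u -> leb.-integrable `[c, c + n.+1%:R^-1] (EFin \o u).
  move=> cu; apply: continuous_compact_integrable; first exact: segment_compact.
  exact: continuous_subspaceT.
have m0 x : 0 <= mollifier c n.+1%:R x.
  by rewrite mulr_ge0//; have [_ _ _] := cchi; exact.
have cfm : continuous (fun x => f x * mollifier c n.+1%:R x) by move=> x; apply: cvgM;
  [exact: cf|exact: cm].
have scm (u : R) : leb.-integrable `[c, c + n.+1%:R^-1] (EFin \o (fun x => u * mollifier c n.+1%:R
  x)).
  by apply: sg => x; apply: cvgM; [exact: cvg_cst|exact: cm].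
have E (u : R) : u = \int[leb]_(x in `[c, c + n.+1%:R^-1]) (u * mollifier c n.+1%:R x).
  by rewrite RintegralZl ?mollifier_int ?mulr1//; exact: sg.
rewrite [X in `|X - _|]E -RintegralB//; last exact: sg.
apply: (le_trans (le_normr_Rintegral _ _)) => //.
  apply: sg => x; apply: cvgB; last exact: cfm.
  by apply: cvgM; [exact: cvg_cst|exact: cm].
rewrite [leRHS]E.
apply: le_Rintegral => //.
- apply: sg => x; apply: cvg_norm; apply: cvgB; last exact: cfm.
  by apply: cvgM; [exact: cvg_cst|exact: cm].
move=> x; rewrite /= in_itv/= => /andP[cx xc].
rewrite -mulrBl normrM (ger0_norm (m0 _)) ler_wpM2r//; apply: hd.
by rewrite /ball/= distrC ger0_norm ?subr_ge0//; apply: le_lt_trans nd; rewrite lerBlDl.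
Unshelve. all: by end_near. Qed.

Lemma bump_cvg a b x : a <= b ->
  bump a b n.+1%:R x @[n --> \oo] --> ((a < x <= b)%R%:R : R).
Proof.
have [_ h0 h1 _] := cchi => ab.
have big (c : R) : c < x -> \forall n \near \oo, chi (n.+1%:R * (x - c)) = 1.
  move=> cx; near=> n; apply: h1; rewrite -ler_pdivrMr ?subr_gt0// div1r.
  apply: (@le_trans _ _ n%:R); last by rewrite ler_nat.
  near: n; exists (Num.bound (x - c)^-1) => // m /= hm.
  by rewrite (le_trans (ltW (archi_boundP _))) ?ler_nat// invr_ge0 subr_ge0 ltW.
have small (c : R) : x <= c -> forall n, chi (n.+1%:R * (x - c)) = 0.
  by move=> xc n; apply: cutoff_le0; rewrite mulr_ge0_le0// subr_le0.
apply: cvg_near_cst; have [ax|xa] := ltP a x; have [xb|bx] := leP x b => /=.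
- by apply: filterS (big _ ax) => n h; rewrite /bump h (small b)// subr0.
- by apply: filterS2 (big _ ax) (big _ bx) => n h h'; rewrite /bump h h' subrr.
- by apply: nearW => n; rewrite /bump !small// ?subrr.
- by have := lt_le_trans bx (le_trans xa ab); rewrite ltxx.
Unshelve. all: by end_near. Qed.

(** For [1 <= k] the transition layer after [b] has length at most 1, hence a dominating function
    independent of [k]. *)
Lemma bump_bound a b k x : a <= b -> 1 <= k ->
  `|bump a b k x| <= ((x \in `[a, b + 1])%:R : R).
Proof.
move=> ab k1; have [_ h0 h1 _] := cchi; have k0 : 0 < k by rewrite (lt_le_trans ltr01).
have /andP[p1 p2] := cutoff_01 (k * (x - a)); have /andP[p3 p4] := cutoff_01 (k * (x - b)).
rewrite in_itv/=; have [ax|xa] := leP a x; have [xb|bx] := leP x (b + 1) => /=.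
- by rewrite /bump ler_norml; lra.
- rewrite /bump !h1 ?subrr ?normr0//.
    rewrite -[leLHS]mulr1 ler_pM//; lra.
  rewrite -[leLHS]mulr1 ler_pM//; lra.
- by rewrite /bump !h0 ?subrr ?normr0// pmulr_rlt0// subr_lt0// (lt_le_trans xa).
- by rewrite /bump !h0 ?subrr ?normr0// pmulr_rlt0// subr_lt0// (lt_le_trans xa).
Qed.

Lemma bump_cont a b k : continuous (bump a b k).
Proof.
have e (c : R) : continuous (fun x => chi (k * (x - c))).
  by have := @smooth_continuous _ 0%N (@smooth_affine_smooth chi k c cutoff_smooth).
by move=> x; apply: cvgB; exact: e.
Qed.

Lemma mollifier_integrable f c k : 0 < k -> continuous f ->
  leb.-integrable setT (EFin \o (fun x => f x * mollifier c k x)).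
Proof.
move=> k0 cf; have cm : continuous (fun x => f x * mollifier c k x).
  by move=> x; apply: cvgM; [exact: cf|exact: mollifier_cont].
have : leb.-integrable `[c, c + k^-1] (EFin \o (fun x => f x * mollifier c k x)).
  by apply: continuous_compact_integrable; [exact: segment_compact|exact: continuous_subspaceT].
move/integrable_mkcond => /(_ (measurable_itv _)).
apply: eq_integrable => // x _; rewrite patchE; case: ifPn => //=.
by rewrite notin_setE/= => /negP h; rewrite mollifier_supp// mulr0.
Qed.

(** The definition is tested with [bump a b k]. As [k] grows, the left side tends to [f a - f b] by
    continuity of [f], and the integral against [g] to that over []a, b]] by dominated
    convergence. *)
Lemma weak_derivative_FTC f g : continuous f -> weak_derivative f g -> primitive f g.
Proof.
move=> cf [lf lg fg] a b ab.
have tst (n : nat) : \int[leb]_(x in setT) (f x * derive1 (bump a b n.+1%:R) x) =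
    - \int[leb]_(x in setT) (g x * bump a b n.+1%:R x).
  by apply: fg; apply: bump_test.
have L : \int[leb]_(x in setT) (f x * derive1 (bump a b n.+1%:R) x) @[n --> \oo] --> f a - f b.
  have -> : (fun n => \int[leb]_(x in setT) (f x * derive1 (bump a b n.+1%:R) x)) =
    (fun n => \int[leb]_(x in setT) (f x * mollifier a n.+1%:R x) -
       \int[leb]_(x in setT) (f x * mollifier b n.+1%:R x)).
    apply/funext => n; rewrite -RintegralB//; [|exact: mollifier_integrable..].
    by apply: eq_Rintegral => x _; rewrite bump_derive mulrBr.
  by apply: cvgB; exact: mollifier_lim.
have G : \int[leb]_(x in setT) (g x * bump a b n.+1%:R x) @[n --> \oo] -->
    \int[leb]_(x in `[a, b]) g x.
  have -> : \int[leb]_(x in `[a, b]) g x =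
      \int[leb]_(x in setT) (g x * (a < x <= b)%R%:R).
    have ig : leb.-integrable `]a, b] (EFin \o g).
      by apply: integrableS (locint_seg a b lg) => //; apply: subset_itvr; rewrite bnd_simp.
    rewrite -(Rintegral_itv_obnd_cbnd ig) Rintegral_mkcond.
    apply: eq_Rintegral => x _; rewrite patchE mem_setE in_itv/=.
    by case: ifP; rewrite ?mulr1 ?mulr0.
  have mg : measurable_fun setT g by case: lg.
  have dom : leb.-integrable setT (fun x => (`|g x| * (x \in `[a, b + 1])%:R)%:E).
    have : leb.-integrable `[a, b + 1] (EFin \o (fun x => `|g x|)).
      by apply: integrable_normR => //; exact: locint_seg.
    move/integrable_mkcond => /(_ (measurable_itv _)).
    apply: eq_integrable => // x _; rewrite patchE mem_setE.
    by case: ifP; rewrite ?mulr1 ?mulr0.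
  have lim_int : leb.-integrable setT (EFin \o (fun x => g x * (a < x <= b)%R%:R)).
    apply: (le_integrable _ _ _ dom) => //.
    - apply/measurable_EFinR; apply: measurable_funM => //.
      rewrite (_ : (fun x => _) = \1_(`]a, b] : set R)); first exact: measurable_indic.
      by apply/funext => x; rewrite indicE mem_setE in_itv.
    - move=> x _; rewrite /= lee_fin normrM [leRHS]ger0_norm ?mulr_ge0// ler_wpM2l//.
      rewrite ger0_norm// in_itv/=; case: (boolP (a < x <= b)) => [/andP[ax xb]|_];
        last exact: ler0n.
      by rewrite (ltW ax) (le_trans xb) ?lerDl.
  apply: (@fine_cvg _ _ _ _ (fun n => \int[leb]_x (g x * bump a b n.+1%:R x)%:E)%E).
  rewrite fineK; last exact: integrable_fin_num.
  apply: (@dominated_cvg _ _ _ leb setT measurableT _ _ (fun x => (`|g x| * (x \in `[a, b +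
    1])%:R)%:E)) => //.
  - move=> n; apply/measurable_EFinR; apply: measurable_funM => //.
    by apply: continuous_measurable_fun; exact: bump_cont.
  - move=> x _; apply: cvg_EFin; first exact: nearW.
    apply: cvgM; first exact: cvg_cst.
    exact: bump_cvg.
  - move=> n x _; rewrite /= lee_fin normrM ler_wpM2l// bump_bound//.
    by rewrite ler1n.
have {}L : - (f a - f b) = \int[leb]_(x in `[a, b]) g x.
  have e : (fun n => \int[leb]_(x in setT) (g x * bump a b n.+1%:R x)) =
     (fun n => - \int[leb]_(x in setT) (f x * derive1 (bump a b n.+1%:R) x)).
    by apply/funext => n; rewrite tst opprK.
  rewrite e in G; apply: (cvg_unique (@Rhausdorff R) _ G).
  exact: cvgN.
by rewrite -L opprB.
Qed.

End Cutoff.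

(** The primitive of [f - g] based at [x - 1] vanishes near [x], and at almost every [x] its
    derivative is [f x - g x] by Lebesgue differentiation. *)
Lemma ae_unique f g : locally_integrable setT f -> locally_integrable setT g ->
  (forall a b, a <= b -> \int[leb]_(x in `[a, b]) f x = \int[leb]_(x in `[a, b]) g x) ->
  {ae leb, forall x, f x = g x}.
Proof.
move=> lf lg fg; have lfg := locally_integrableB lf lg.
have := lebesgue_differentiation lfg.
apply: filterS => [|x hx]; first exact: (ae_filter_ringOfSetsType leb).
have xx : x < x + 1 by rewrite ltrDl.
have [] := @FTC1_lebesgue_pt R (f \- g) (BLeft (x - 1)) x (x + 1) xx _ _ hx.
- exact: locint_seg.
- by rewrite lte_fin gtrBl.
move=> _; rewrite (_ : (fun y => _) = cst 0) ?derive1_cst.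
  by move=> /esym/eqP; rewrite subr_eq0 => /eqP.
apply/funext => y; have [xy|yx] := leP (x - 1) y.
  by rewrite RintegralB ?fg ?subrr//; exact: locint_seg.
by rewrite set_itv_ge ?Rintegral_set0// bnd_simp -ltNge.
Qed.

Lemma continuous_locint f : continuous f -> locally_integrable setT f.
Proof.
move=> cf; split => //; [exact: continuous_measurable_fun|exact: openT|].
move=> K _ cK; have := @continuous_compact_integrable R f K cK (continuous_subspaceT cf).
by move=> /integrableP[].
Qed.

Lemma support_bounded phi (M : R) : continuous phi ->
  (forall x, M < `|x| -> phi x = 0) -> exists K : R, forall x, `|phi x| <= K.
Proof.
move=> cphi hM.
  have [x0|x0] := ltP (- `|M|) `|M|; last first.
    exists `|phi 0| => x; have [->//|xN] := eqVneq x 0.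
    by rewrite hM ?normr0// (le_lt_trans (ler_norm _))// (@le_lt_trans _ _ 0) ?normr_gt0//; lra.
  have cab : {within `[- `|M|, `|M|], continuous (fun x => `|phi x|)}.
    by apply: continuous_subspaceT => x; apply: cvg_norm; exact: cphi.
  have [c _ hc] := EVT_max (ltW x0) cab.
  exists `|phi c| => x; have [h|h] := leP `|x| `|M|.
    by apply: hc; rewrite in_itv/= -ler_norml.
  by rewrite hM ?normr0// (le_lt_trans (ler_norm _)).
Qed.

Lemma test_integrable f phi : locally_integrable setT f -> continuous phi ->
  (exists M : R, forall x, M < `|x| -> phi x = 0) ->
  leb.-integrable setT (EFin \o (fun x => f x * phi x)).
Proof.
move=> lf cphi [M hM].
have [K hK] := support_bounded cphi hM.
have [mf _ _] := lf.
have : leb.-integrable `[- `|M|, `|M|] (EFin \o (fun x => K * `|f x|)).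
  by apply: integrableZR => //; apply: integrable_normR => //; exact: locint_seg.
move/integrable_mkcond => /(_ (measurable_itv _)).
apply: le_integrable => //.
  apply/measurable_EFinR; apply: measurable_funM => //.
  exact: continuous_measurable_fun.
move=> x _; rewrite patchE mem_setE in_itv/=; case: ifPn => h.
  rewrite /= lee_fin !normrM normr_id mulrC ler_wpM2r//.
  by rewrite (le_trans (hK x))// ler_norm.
by rewrite /= hM ?mulr0// (le_lt_trans (ler_norm _))// ltNge ler_norml.
Qed.

Lemma test_derive phi : test_function phi ->
  continuous (derive1 phi) /\ exists M : R, forall x, M < `|x| -> derive1 phi x = 0.
Proof.
move=> [sphi [M hM]]; split; first exact: (@smooth_continuous _ 1%N sphi).
exists M => x hx; rewrite (@derive1_near _ (fun=> 0)); first exact: derive1_cst.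
near=> y; apply: hM; near: y.
have : M < `|x| by [].
have := @norm_continuous _ R x => /cvgr_gt; exact.
Unshelve. all: by end_near. Qed.

Lemma weak_derivativeD f1 f2 g1 g2 : weak_derivative f1 g1 -> weak_derivative f2 g2 ->
  weak_derivative (fun x => f1 x + f2 x) (fun x => g1 x + g2 x).
Proof.
move=> [lf1 lg1 h1] [lf2 lg2 h2]; split; [exact: locally_integrableD..|].
move=> phi tphi; have [c1 s1] := test_derive tphi.
have [sphi s0] := tphi; have c0 := @smooth_continuous _ 0%N sphi.
have i1 := test_integrable lf1 c1 s1; have i2 := test_integrable lf2 c1 s1.
have i3 := test_integrable lg1 c0 s0; have i4 := test_integrable lg2 c0 s0.
under eq_Rintegral do rewrite mulrDl; under [in RHS]eq_Rintegral do rewrite mulrDl.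
by rewrite !RintegralD// h1// h2// opprD.
Qed.

Lemma weak_derivativeZ f g k : weak_derivative f g ->
  weak_derivative (fun x => k * f x) (fun x => k * g x).
Proof.
move=> [lf lg h].
have lZ u : locally_integrable setT u -> locally_integrable setT (fun x => k * u x).
  move=> [mu ou hu]; split => //; first exact: measurable_funM.
  move=> K KT cK; have mK : measurable (K : set (measurableTypeR R)) by exact: compact_measurable.
  have : leb.-integrable K (EFin \o u).
    apply/integrableP; split; last exact: hu.
    by apply/measurable_EFinR; exact: measurable_funTS.
  by move=> ui; have /integrableP[] := integrableZR k mK ui.
split; [exact: lZ..|] => phi tphi; have [c1 s1] := test_derive tphi.
have [sphi s0] := tphi; have c0 := @smooth_continuous _ 0%N sphi.
have i1 := test_integrable lf c1 s1; have i3 := test_integrable lg c0 s0.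
under eq_Rintegral do rewrite -mulrA; under [in RHS]eq_Rintegral do rewrite -mulrA.
by rewrite !RintegralZl// h// mulrN.
Qed.

Lemma weak_derivativeB f1 f2 g1 g2 : weak_derivative f1 g1 -> weak_derivative f2 g2 ->
  weak_derivative (fun x => f1 x - f2 x) (fun x => g1 x - g2 x).
Proof.
move=> h1 /(weak_derivativeZ (-1)) h2; have := weak_derivativeD h1 h2.
by congr weak_derivative; apply/funext => x; rewrite mulN1r.
Qed.

Lemma weak_derivative_C1 f : (forall x, derivable f x 1) -> continuous (derive1 f) ->
  weak_derivative f (derive1 f).
Proof.
move=> df cdf; have cf := derivableT_continuous df.
split; [exact: continuous_locint..|] => phi tphi.
have [c1 _] := test_derive tphi; have [sphi [M hM]] := tphi.
have c0 := @smooth_continuous _ 0%N sphi.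
(* The added 1 puts the endpoints strictly outside the support of [phi], so the boundary terms
   vanish. *)
pose N : R := `|M| + 1; have N0 : - N < N by rewrite /N; have := normr_ge0 M; lra.
have out x : ~~ (x \in `[- N, N]) -> `|M| < `|x|.
  rewrite in_itv/= -ler_norml -ltNge => /(lt_trans _); apply; rewrite /N; lra.
have [_ [M' hM']] := test_derive tphi.
have dphi0 x : ~~ (x \in `[- N, N]) -> derive1 phi x = 0.
  move=> /out hx; rewrite (@derive1_near _ (fun=> 0)); first exact: derive1_cst.
  near=> y; apply: hM; apply: (le_lt_trans (ler_norm _)); near: y.
  by have := @norm_continuous _ R x => /cvgr_gt; exact.
have phi0 x : ~~ (x \in `[- N, N]) -> phi x = 0.
  by move=> /out hx; rewrite hM// (le_lt_trans (ler_norm _)).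
rewrite (@Rintegral_supp _ (- N) N); last by move=> x /dphi0 ->; rewrite mulr0.
rewrite [in RHS](@Rintegral_supp _ (- N) N); last by move=> x /phi0 ->; rewrite mulr0.
have LR (u : R -> R) : (forall x, derivable u x 1) -> derivable_oo_LRcontinuous u (- N) N.
  move=> du; have cu := derivableT_continuous du; split; first by move=> x _; exact: du.
    by apply: cvg_at_right_filter; exact: cu.
  by apply: cvg_at_left_filter; exact: cu.
have e1 : phi N = 0.
  by apply: hM; rewrite /N ger0_norm; have := ler_norm M; have := normr_ge0 M; lra.
have e2 : phi (- N) = 0.
  by apply: hM; rewrite /N normrN ger0_norm; have := ler_norm M; have := normr_ge0 M; lra.
have h1 : {within `[- N, N], continuous (derive1 f)} by exact: continuous_subspaceT.
have h2 : {within `[- N, N], continuous (derive1 phi)} by exact: continuous_subspaceT.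
have h3 : derivable_oo_LRcontinuous f (- N) N by exact: LR.
have h4 : derivable_oo_LRcontinuous phi (- N) N by apply: LR => x; exact: (sphi 0%N).
rewrite (@Rintegration_by_parts R f phi (derive1 f) (derive1 phi) (- N) N N0 h1 h3 (fun _ _ =>
  erefl) h2 h4 (fun _ _ => erefl)).
by rewrite e1 e2 !mulr0 subrr sub0r.
Unshelve. all: by end_near. Qed.

Lemma wdP f : (exists g, weak_derivative f g) -> weak_derivative f (wd f).
Proof. by move=> [g fg]; rewrite /wd; exact: xgetPex (ex_intro _ g fg). Qed.

Lemma weak_derivative_unique chi f g1 g2 : cutoff chi -> continuous f ->
  weak_derivative f g1 -> weak_derivative f g2 -> {ae leb, forall x, g1 x = g2 x}.
Proof.
move=> cchi cf h1 h2; have [_ l1 _] := h1; have [_ l2 _] := h2.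
apply: ae_unique => // a b ab.
by rewrite -(weak_derivative_FTC cchi cf h1)// -(weak_derivative_FTC cchi cf h2).
Qed.

End WeakDerivatives.

(** * Pointwise and local consequences of the [L^2], [H^1] and [L^oo] norms *)

Section Norms.
Context {R : realType}.
Implicit Types (f g : R -> R) (a b c x y n : R).
Local Notation leb := (@lebesgue_measure R).

Lemma poweR_half_le (I : \bar R) n : (0 <= I)%E -> 0 <= n ->
  (I `^ 2^-1 <= n%:E)%E = (I <= (n ^+ 2)%:E)%E.
Proof.
move=> + n0; case: I => [r| |//] => [r0|_]; last first.
  by rewrite poweRyr ?invr_eq0 ?pnatr_eq0// !leye_eq.
rewrite poweR_EFin !lee_fin powR12_sqrt//.
by rewrite -{2}(sqr_sqrtr r0) ler_sqr ?nnegrE ?sqrtr_ge0.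
Qed.

Lemma le_integral_EFin f g : measurable_fun setT f -> measurable_fun setT g ->
  (forall x, 0 <= f x) -> (forall x, f x <= g x) ->
  (\int[leb]_x (f x)%:E <= \int[leb]_x (g x)%:E)%E.
Proof.
move=> mf mg f0 fg; apply: ge0_le_integral => //.
- by move=> x _; rewrite lee_fin.
- exact/measurable_EFinR.
- exact/measurable_EFinR.
- by move=> x _; rewrite lee_fin.
Qed.

(** Integrated over a segment with a well-chosen weight [m], this plays the role of the
    Cauchy-Schwarz inequality. *)
Lemma norm_le_amgm (m x : R) : 0 < m -> `|x| <= 2^-1 * (m + m^-1 * x ^+ 2).
Proof.
move=> m0; rewrite ler_pdivlMl// -(ler_pM2l m0) [leRHS]mulrDr.
rewrite (mulrA m m^-1) mulfV ?gt_eqF// mul1r -(real_normK (num_real x)).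
by have := sqr_ge0 (m - `|x|); nra.
Qed.

Lemma L2_normE f : L2_norm f = ((\int[leb]_x ((f x) ^+ 2)%:E) `^ 2^-1)%E.
Proof.
rewrite /L2_norm unlock; congr (_ `^ _)%E; apply: eq_integral => x _.
have -> : `|(EFin \o f) x|%E = (`|f x|)%:E by [].
by rewrite poweR_EFin powR_mulrn// real_normK ?num_real.
Qed.

Lemma L2_norm_le f n : 0 <= n ->
  (L2_norm f <= n%:E)%E = (\int[leb]_x ((f x) ^+ 2)%:E <= (n ^+ 2)%:E)%E.
Proof.
by move=> n0; rewrite L2_normE poweR_half_le// integral_ge0// => x _; rewrite lee_fin sqr_ge0.
Qed.

Lemma H1_norm_le f n : 0 <= n ->
  (H1_norm f <= n%:E)%E = (\int[leb]_x ((f x) ^+ 2 + (wd f x) ^+ 2)%:E <= (n ^+ 2)%:E)%E.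
Proof.
move=> n0; rewrite /H1_norm poweR_half_le// integral_ge0// => x _.
by rewrite lee_fin addr_ge0 ?sqr_ge0.
Qed.

Lemma L2_meas f : L2 f -> measurable_fun setT f.
Proof. by move=> /andP[mf _]; have := set_mem mf. Qed.

Lemma L2_sqr_integrable f : L2 f -> leb.-integrable setT (EFin \o (fun x => f x ^+ 2)).
Proof.
move=> hf; have mf := L2_meas hf; move: hf => /andP[_ /set_mem hf].
apply/integrableP; split.
  by apply/measurable_EFinR; exact: measurable_funX.
have e : (\int[leb]_x ((f x) ^+ 2)%:E < +oo)%E.
  rewrite ltNge leye_eq; apply/negP => /eqP h.
  have : (L2_norm f < +oo)%E by exact: hf.
  by rewrite L2_normE h poweRyr ?invr_eq0 ?pnatr_eq0// ltxx.
apply: le_lt_trans e; rewrite le_eqVlt; apply/orP; left; apply/eqP.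
by apply: eq_integral => x _; rewrite /= ger0_norm ?sqr_ge0.
Qed.

Lemma L2_intro f : measurable_fun setT f -> (\int[leb]_x ((f x) ^+ 2)%:E < +oo)%E -> L2 f.
Proof.
move=> mf hf; apply/andP; split; apply: mem_set => //.
suff : (L2_norm f < +oo)%E by [].
rewrite L2_normE; move: hf; have : (0 <= \int[leb]_x ((f x) ^+ 2)%:E)%E.
  by apply: integral_ge0 => x _; rewrite lee_fin sqr_ge0.
by case: (\int[leb]_x _)%E => // r _ _; rewrite poweR_EFin ltry.
Qed.

Lemma L2_comb k f g : L2 f -> L2 g -> L2 (fun x => k * f x + g x).
Proof.
have p1 : (1 <= 2%:E :> \bar R)%E by rewrite lee_fin; lra.
exact: ((@Lfun_submod_closed _ _ R leb 2%:E p1).2 k f g).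
Qed.

Lemma L2Z k f : L2 f -> L2 (fun x => k * f x).
Proof.
move=> hf; have h0 : L2 (fun x => 0 * f x + 0 * f x) .
  have h := L2_comb (-1) hf hf; have h' := L2_comb 0 hf h.
  by move: h'; congr L2; apply/funext => x; ring.
have := L2_comb k hf h0; congr L2; apply/funext => x; ring.
Qed.

Lemma L2B f g : L2 f -> L2 g -> L2 (fun x => f x - g x).
Proof.
by move=> hf hg; have := L2_comb (-1) hg hf; congr L2; apply/funext => x; ring.
Qed.

Lemma L2_ae f g : measurable_fun setT g -> {ae leb, forall x, f x = g x} -> L2 f -> L2 g.
Proof.
move=> mg fg hf; have mf := L2_meas hf; apply: L2_intro => //.
have /integrableP[_] := L2_sqr_integrable hf.
apply: le_lt_trans; rewrite le_eqVlt; apply/orP; left; apply/eqP.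
apply: ae_eq_integral => //.
- by apply/measurable_EFinR; exact: measurable_funX.
- by apply/measurable_EFinR; apply: measurableT_comp => //; exact: measurable_funX.
apply: filterS fg => [|x fgx _]; first exact: (ae_filter_ringOfSetsType leb).
by rewrite /= fgx ger0_norm ?sqr_ge0.
Qed.

Lemma CS_seg f a b n : a <= b -> b <= a + 1 -> 0 <= n -> measurable_fun setT f ->
  leb.-integrable `[a, b] (EFin \o (fun x => f x ^+ 2)) ->
  \int[leb]_(x in `[a, b]) (f x ^+ 2) <= n ^+ 2 ->
  leb.-integrable `[a, b] (EFin \o f) /\ \int[leb]_(x in `[a, b]) `|f x| <= n.
Proof.
move=> ab ba n0 mf f2 hn.
have i1 m : leb.-integrable `[a, b] (EFin \o (fun x => 2^-1 * (m + m^-1 * f x ^+ 2))).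
  apply: integrableZR => //; apply: integrableDR => //; first exact: bmeas_itv (bmeas_cst m).
  exact: integrableZR.
have fi : leb.-integrable `[a, b] (EFin \o f).
  apply: (le_integrable _ _ _ (i1 1)) => //.
    by apply/measurable_EFinR; exact: measurable_funTS.
  move=> x _; rewrite /= lee_fin (le_trans (norm_le_amgm (f x) ltr01))// ler_norm//.
split => //; apply/ler_addgt0Pr => e e0.
(* The optimal weight on a unit segment is [n], which may be 0; [n + e] is used and [e] sent to
   0. *)
have m0 : 0 < n + e by rewrite ltr_wpDl.
apply: (@le_trans _ _ (\int[leb]_(x in `[a, b]) (2^-1 * (n + e + (n + e)^-1 * f x ^+ 2)))).
  apply: le_Rintegral => //; first exact: integrable_normR.
  by move=> x _; exact: norm_le_amgm.
rewrite RintegralZl//; last first.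
  apply: integrableDR => //; first exact: bmeas_itv (bmeas_cst (n + e)).
  exact: integrableZR.
rewrite RintegralD//; [|exact: bmeas_itv (bmeas_cst (n + e))|exact: integrableZR].
rewrite RintegralZl// Rintegral_seg_cst//.
rewrite ler_pdivrMl// mulr_natl mulr2n; apply: lerD.
  rewrite -[leRHS]mulr1 ler_wpM2l ?(ltW m0)//; lra.
rewrite ler_pdivrMl// (le_trans hn)// -expr2 lerXn2r ?nnegrE ?(ltW m0)//; lra.
Qed.

Lemma CS_unit f a b n : a <= b -> b <= a + 1 -> 0 <= n -> measurable_fun setT f ->
  (\int[leb]_x ((f x) ^+ 2)%:E <= (n ^+ 2)%:E)%E ->
  leb.-integrable `[a, b] (EFin \o f) /\ \int[leb]_(x in `[a, b]) `|f x| <= n.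
Proof.
move=> ab ba n0 mf hn.
have mf2 : measurable_fun setT (fun x => (f x ^+ 2)%:E : \bar R).
  by apply/measurable_EFinR; exact: measurable_funX.
have hn' : (\int[leb]_(x in `[a, b]) ((f x) ^+ 2)%:E <= (n ^+ 2)%:E)%E.
  apply: le_trans hn; apply: ge0_subset_integral => //.
  by move=> x _; rewrite lee_fin sqr_ge0.
have fi : leb.-integrable `[a, b] (EFin \o (fun x => f x ^+ 2)).
  apply/integrableP; split; first exact: measurable_funTS.
  apply: (le_lt_trans _ (ltry (n ^+ 2))); apply: le_trans hn'.
  rewrite le_eqVlt; apply/orP; left; apply/eqP.
  by apply: eq_integral => x _; rewrite /= ger0_norm ?sqr_ge0.
apply: CS_seg => //; rewrite -lee_fin fineK//; exact: integrable_fin_num.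
Qed.

(** For each [y] in the segment [|f x|] is at most [|f y|] plus the integral of [|g|]; the bound is
    the average over [y]. *)
Lemma pointwise_bound f g x : locally_integrable setT g -> continuous f -> primitive f g ->
  `|f x| <= \int[leb]_(y in `[x, x + 1]) `|f y| + \int[leb]_(y in `[x, x + 1]) `|g y|.
Proof.
move=> lg cf fg; have xx : x <= x + 1 by rewrite lerDl.
set G := \int[leb]_(y in `[x, x + 1]) `|g y|.
have gi a b := locint_seg a b lg.
have h y : x <= y <= x + 1 -> `|f x| <= `|f y| + G.
  move=> /andP[xy yx]; rewrite -lerBlDl (le_trans (lerB_dist _ _))// distrC fg//.
  apply: (le_trans (le_normr_Rintegral _ (gi _ _))) => //.
  rewrite /G (@Rintegral_split _ (fun y => `|g y|) x y (x + 1))//; last exact: integrable_normR.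
  by rewrite lerDl Rintegral_ge0.
have ifn : leb.-integrable `[x, x + 1] (EFin \o (fun y => `|f y|)).
  apply: continuous_compact_integrable; first exact: segment_compact.
  by apply: continuous_subspaceT => y; apply: cvg_norm; exact: cf.
have ic (k : R) : leb.-integrable `[x, x + 1] (EFin \o (fun=> k)) by exact: bmeas_itv (bmeas_cst k).
have -> : `|f x| = \int[leb]_(y in `[x, x + 1]) `|f x|.
  by rewrite Rintegral_seg_cst// addrC addKr mulr1.
have -> : G = \int[leb]_(y in `[x, x + 1]) G.
  by rewrite Rintegral_seg_cst// addrC addKr mulr1.
rewrite -RintegralD//; apply: le_Rintegral => //; exact: integrableDR.
Qed.

Section WithCutoff.
Variable chi : R -> R.
Hypothesis cchi : cutoff chi.

Lemma H1_wd f : H1 f -> [/\ weak_derivative f (wd f), locally_integrable setT (wd f),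
  primitive f (wd f) & L2 (wd f)].
Proof.
move=> [cf _ [g fg hg]]; have h := wdP (ex_intro _ g fg); have [_ lw _] := h.
split => //; first exact: (weak_derivative_FTC cchi cf h).
apply: L2_ae hg; first by case: lw.
exact: (weak_derivative_unique cchi cf fg h).
Qed.

(** Sobolev embedding on the line; the two integrals of [pointwise_bound] are each at most [n]. *)
Lemma H1_sup f n x : H1 f -> 0 <= n -> (H1_norm f <= n%:E)%E -> `|f x| <= 2 * n.
Proof.
move=> hf n0; have [_ lg fg _] := H1_wd hf; have [cf /L2_meas mf _] := hf.
have [mg _ _] := lg; rewrite H1_norm_le// => hn.
have xx : x <= x + 1 by rewrite lerDl.
have sq (u : R -> R) : measurable_fun setT u -> (forall y, u y ^+ 2 <= f y ^+ 2 + wd f y ^+ 2) ->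
    (\int[leb]_x ((u x) ^+ 2)%:E <= (n ^+ 2)%:E)%E.
  move=> mu hu; apply: le_trans hn; apply: le_integral_EFin => // [||y].
  - exact: measurable_funX.
  - by apply: measurable_funD; exact: measurable_funX.
  - exact: sqr_ge0.
have [|_ k1] := CS_unit xx (lexx _) n0 mf (sq f mf _).
  by move=> y; rewrite lerDl sqr_ge0.
have [|_ k2] := CS_unit xx (lexx _) n0 mg (sq _ mg _).
  by move=> y; rewrite lerDr sqr_ge0.
apply: (le_trans (pointwise_bound x lg cf fg)).
by rewrite mulr_natl mulr2n lerD.
Qed.

Lemma tail_small f e : (forall x, 0 <= f x) -> 0 < e ->
  leb.-integrable setT (EFin \o f) ->
  exists M, forall x, M <= x -> \int[leb]_(y in `[x, x + 1]) f y <= e.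
Proof.
move=> f0 e0 fi; have /cvgrPdist_le/(_ _ e0)[N _ /(_ N (leqnn N))] := window_cvg 0 fi.
rewrite sub0r add0r => h; exists (N%:R + 1) => x Nx.
have sub (A : set R) : measurable (A : set (measurableTypeR R)) -> leb.-integrable A (EFin \o f).
  by move=> mA; apply: integrableS fi.
have NN : (- N%:R : R) <= N%:R by have := ler0n R N; lra.
have := ler_norm (\int[leb]_(x in setT) f x - \int[leb]_(x in `[- N%:R, N%:R]) f x).
move=> /le_trans/(_ h); apply: le_trans.
rewrite lerBrDl.
have dj : [disjoint (`[(- N%:R : R), N%:R]%classic : set R) & (`[x, x + 1]%classic : set R)].
  apply/disj_setPS => y [/=]; rewrite !in_itv/= => /andP[_ yN] /andP[xy _].
  have : x <= N%:R by exact: le_trans xy yN.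
  by move=> ?; suff : false by []; lra.
have mU : measurable ((`[(- N%:R : R), N%:R]%classic `|` `[x, x + 1]%classic) : set
  (measurableTypeR R)).
  exact: measurableU.
have iU := sub _ mU.
rewrite -Rintegral_setU//.
rewrite /Rintegral fine_le//.
- exact: (integrable_fin_num mU iU).
- exact: integrable_fin_num.
apply: ge0_subset_integral => //.
- by case/integrableP : fi.
- by move=> y _; rewrite lee_fin.
Qed.

Lemma H1_vanish f : H1 f -> forall e, 0 < e -> exists M, forall x, M <= x -> `|f x| <= e.
Proof.
move=> hf e e0; have [_ lg fg hg] := H1_wd hf; have [cf hf2 _] := hf.
have n0 : 0 < e / 2 by rewrite divr_gt0.
have n2 : 0 < (e / 2) ^+ 2 by rewrite exprn_gt0.
have i1 := L2_sqr_integrable hf2; have i2 := L2_sqr_integrable hg.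
have [M1 h1] := tail_small (fun x => sqr_ge0 (f x)) n2 i1.
have [M2 h2] := tail_small (fun x => sqr_ge0 (wd f x)) n2 i2.
exists (Num.max M1 M2) => x; rewrite ge_max => /andP[x1 x2].
have xx : x <= x + 1 by rewrite lerDl.
have sub u : leb.-integrable setT (EFin \o u) -> leb.-integrable `[x, x + 1] (EFin \o u).
  by move=> hu; apply: integrableS hu.
have [_ k1] := CS_seg xx (lexx _) (ltW n0) (L2_meas hf2) (sub _ i1) (h1 _ x1).
have [_ k2] := CS_seg xx (lexx _) (ltW n0) (L2_meas hg) (sub _ i2) (h2 _ x2).
apply: (le_trans (pointwise_bound x lg cf fg)).
by rewrite [leRHS]splitr lerD.
Qed.

Lemma H1_comb k f g : H1 f -> H1 g -> H1 (fun x => k * f x + g x).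
Proof.
move=> [cf lf [f' ff' lf']] [cg lg [g' gg' lg']]; split.
- by move=> x; apply: cvgD; [apply: cvgM; [exact: cvg_cst|exact: cf]|exact: cg].
- exact: L2_comb.
- exists (fun x => k * f' x + g' x); last exact: L2_comb.
  by apply: weak_derivativeD => //; exact: weak_derivativeZ.
Qed.

Lemma H1B f g : H1 f -> H1 g -> H1 (fun x => f x - g x).
Proof.
by move=> hf hg; have := H1_comb (-1) hg hf; congr H1; apply/funext => x; ring.
Qed.

Lemma H1Z k f : H1 f -> H1 (fun x => k * f x).
Proof.
move=> hf; have h0 := H1B hf hf.
by have := H1_comb k hf h0; congr H1; apply/funext => x; rewrite subrr addr0.
Qed.

End WithCutoff.

Lemma leb_setT_gt0 : (0 < leb [set: R])%E.
Proof.
apply: (@lt_le_trans _ _ (leb `[(0 : R), 1])).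
  by rewrite leb_seg ltr01 subr0 lte_fin ltr01.
by apply: le_measure; rewrite ?inE//.
Qed.

Lemma Linf_normE f : Linf_norm f = ess_sup leb (fun x => `|f x|%:E).
Proof. by rewrite /Linf_norm unlock leb_setT_gt0. Qed.

Lemma Linf_norm_ub f n : (forall x, `|f x| <= n) -> (Linf_norm f <= n%:E)%E.
Proof.
by move=> h; rewrite Linf_normE; apply/ess_supP; apply: nearW => x; rewrite lee_fin.
Qed.

Lemma Linf_ae f : Linf f -> exists M : R, {ae leb, forall x, `|f x| <= M}.
Proof.
move=> /andP[_ /set_mem h]; have : (Linf_norm f < +oo)%E by exact: h.
rewrite Linf_normE => /ess_supr_bounded[M hM]; exists M.
exact: hM.
Qed.

(** A value above the essential supremum would persist, by continuity, on a segment of positive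
    length. *)
Lemma Linf_norm_cont f n : continuous f -> (Linf_norm f <= n%:E)%E -> forall x, `|f x| <= n.
Proof.
move=> cf; rewrite Linf_normE => /ess_supP hn x; rewrite leNgt; apply/negP => nx.
have /cvgrPdist_lt := cf x; have d0 : 0 < `|f x| - n by rewrite subr_gt0.
move=> /(_ _ d0)/nbhs_ballP[d /= dp hd].
move: hn => [N [mN N0 hN]].
have sub : `[x, x + d / 2] `<=` N.
  move=> y /=; rewrite in_itv/= => /andP[xy yx]; apply: hN => /=.
  rewrite lee_fin => hy.
  have := hd y; rewrite /ball/= distrC ger0_norm ?subr_ge0// => /(_ _) h.
  have : `|f x - f y| < `|f x| - n by apply: h; lra.
  have := lerB_dist (f x) (f y); lra.
have : (leb `[x, (x + d / 2)%R] <= leb N)%E by apply: le_measure; rewrite ?inE.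
rewrite N0 leb_seg ltrDl divr_gt0// addrC addKr lee_fin; lra.
Qed.

End Norms.

(** * The function g *)

Section Gchi.
Context {R : realType}.
Implicit Types (f g w : R -> R) (a b c x y z K : R).
Local Notation leb := (@lebesgue_measure R).

Lemma derive_lipschitz f (df : R -> R) K : (forall x, is_derive x (1 : R) f (df x)) ->
  (forall x, `|df x| <= K) -> forall x y, `|f x - f y| <= K * `|x - y|.
Proof.
move=> hf hK x y; wlog xy : x y / x <= y.
  by move=> H; have [/H//|/ltW/H] := leP x y; rewrite distrC [`|y - x|]distrC.
have cf : {within `[x, y], continuous f}.
  by apply: continuous_subspaceT; apply: derivableT_continuous => z; have [] := hf z.
have [c _ e] := MVT_segment xy (fun z _ => hf z) cf.
rewrite distrC [`|x - y|]distrC e normrM ler_wpM2r//.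
Qed.

Lemma Rintegral_seg0 f a b : (forall x, a <= x <= b -> f x = 0) ->
  \int[leb]_(x in `[a, b]) f x = 0.
Proof.
move=> f0; rewrite (@eq_Rintegral _ _ _ leb _ (fun=> 0)).
  by rewrite Rintegral_cst// mul0r.
by move=> z; rewrite inE/= in_itv/=; exact: f0.
Qed.

Section Primitive.
Variable w : R -> R.
Hypothesis cw : continuous w.
Hypothesis w0 : forall z, z < 0 -> w z = 0.

(** The base point [-1] lies strictly left of the half-line carrying [w]. It may thus be moved to
    any [- K] with [1 <= K], and 0 is interior to the range of the fundamental theorem. *)
Definition prim0 x := \int[leb]_(z in `[-1, x]) w z.

Let wi a b : leb.-integrable `[a, b] (EFin \o w).
Proof.
apply: continuous_compact_integrable; first exact: segment_compact.
exact: continuous_subspaceT.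
Qed.

Let seg0 a b : b < 0 -> \int[leb]_(z in `[a, b]) w z = 0.
Proof.
move=> b0; apply: Rintegral_seg0 => z /andP[_ zb]; apply: w0.
exact: le_lt_trans b0.
Qed.

Lemma prim0_base K x : 1 <= K -> - K <= x -> \int[leb]_(z in `[- K, x]) w z = prim0 x.
Proof.
move=> K1 Kx; have [x1|x1] := ltP x 0; first by rewrite /prim0 !seg0.
rewrite (@Rintegral_split _ w (- K) (-1) x)//; [|lra|lra].
by rewrite seg0 ?add0r//; lra.
Qed.

Lemma prim0_is_derive x : is_derive x (1 : R) prim0 (w x).
Proof.
have [x0|x0] := ltP x 0; last first.
  have x1 : x < x + 1 by rewrite ltrDl.
  have xm : -1 < x by lra.
  have [d e] := @continuous_FTC1_closed R w (-1) x (x + 1) x1 (wi _ _) xm (@cw x).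
  by apply: DeriveDef; [exact: d|rewrite -derive1E; exact: e].
rewrite w0//.
have n0 : \forall y \near x, (cst 0 : R -> R) y = prim0 y.
  by apply: filterS (lt_nbhsl x0) => y y0; rewrite /prim0/= seg0.
have d0 : is_derive x (1 : R) (cst 0 : R -> R) 0 by exact: is_derive_cst.
by apply: (near_eq_is_derive n0 d0).
Qed.

End Primitive.

Section Cutoff.
Variable chi : R -> R.
Hypothesis cchi : cutoff chi.

(** This is the second derivative of [chi ^+ 2], supported in [[0, 1]]. *)
Let m z : R := 2 * derive1 chi z ^+ 2 + 2 * (chi z * derive1n 2 chi z).

Let cm : continuous m.
Proof.
have c0 := cutoff_cont cchi; have c1 := cutoff_cont1 cchi.
have c2 := @smooth_continuous _ chi 2%N (cutoff_smooth cchi).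
have -> : m = fun z => 2 * (derive1 chi z * derive1 chi z) + 2 * (chi z * derive1n 2 chi z).
  by apply/funext => z; rewrite /m expr2.
move=> z; apply: cvgD.
  by apply: cvgM; [exact: cvg_cst|apply: cvgM; exact: c1].
by apply: cvgM; [exact: cvg_cst|apply: cvgM; [exact: c0|exact: c2]].
Qed.

Let m0 z : z < 0 \/ 1 < z -> m z = 0.
Proof.
move=> h; rewrite /m -derive1n1 !(cutoff_d0 cchi)//.
by rewrite expr0n/= !mulr0 addr0.
Qed.

Let m0l z : z < 0 -> m z = 0. Proof. by move=> ?; apply: m0; left. Qed.

Let w1 z := expR z * m z.
Let w2 z := expR (- z) * m z.

Let cw1 : continuous w1.
Proof. by move=> z; apply: cvgM; [exact: continuous_expR|exact: cm]. Qed.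

Let cw2 : continuous w2.
Proof.
move=> z; apply: cvgM; last exact: cm.
apply: (@continuous_comp _ _ _ (fun z => - z) expR); last exact: continuous_expR.
by apply: cvgN; exact: cvg_id.
Qed.

Let w10 z : z < 0 -> w1 z = 0. Proof. by move=> ?; rewrite /w1 m0l// mulr0. Qed.
Let w20 z : z < 0 -> w2 z = 0. Proof. by move=> ?; rewrite /w2 m0l// mulr0. Qed.

Let ci (u : R -> R) a b : continuous u -> leb.-integrable `[a, b] (EFin \o u).
Proof.
move=> cu; apply: continuous_compact_integrable; first exact: segment_compact.
exact: continuous_subspaceT.
Qed.

(** As [m] vanishes beyond 1, this is the integral of [w2] over the whole line. *)
Let T := prim0 w2 2.

Let ck x : continuous (fun z => expR (- `|x - z|) * m z).
Proof. by move=> z; apply: cvgM; [exact: exp_kernel_cont|exact: cm]. Qed.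

Let left_part x K : 1 <= K -> - K <= x ->
  \int[leb]_(z in `[- K, x]) (expR (- `|x - z|) * m z) = expR (- x) * prim0 w1 x.
Proof.
move=> K1 Kx; rewrite -(prim0_base cw1 w10 K1)// -RintegralZl//; last exact: ci.
apply: eq_Rintegral => z; rewrite inE/= in_itv/= => /andP[_ zx].
rewrite ger0_norm ?subr_ge0// opprB mulrA -expRD; congr (expR _ * _); ring.
Qed.

Let right_part x K : 2 <= K -> - K <= x <= K ->
  \int[leb]_(z in `[x, K]) (expR (- `|x - z|) * m z) = expR x * (T - prim0 w2 x).
Proof.
move=> K2 /andP[Kx xK]; have K1 : 1 <= K by lra.
have -> : T - prim0 w2 x = \int[leb]_(z in `[x, K]) w2 z.
  have e1 := prim0_base cw2 w20 K1 Kx.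
  have KK : - K <= K by lra.
  have e2 := prim0_base cw2 w20 K1 KK.
  have e3 : prim0 w2 K = T.
    rewrite /T /prim0 (@Rintegral_split _ w2 (-1) 2 K)//; [|lra|exact: ci].
    rewrite [X in _ + X]Rintegral_seg0 ?addr0// => z /andP[z2 _].
    by rewrite /w2 m0 ?mulr0//; right; lra.
  rewrite -e3 -e2 -e1 (@Rintegral_split _ w2 (- K) x K)//; last exact: ci.
  by rewrite addrC addKr.
rewrite -RintegralZl//; last exact: ci.
apply: eq_Rintegral => z; rewrite inE/= in_itv/= => /andP[xz _].
rewrite ler0_norm ?subr_le0// opprK mulrA -expRD; congr (expR _ * _); ring.
Qed.

Let p1 x := expR (- x) * prim0 w1 x.
Let p2 x := expR x * (T - prim0 w2 x).

(** Splitting the convolution at [x] removes the absolute value; each half is an exponential times a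
    primitive, hence differentiable. *)
Lemma g_chiE x : g_chi chi x = chi x ^+ 2 + 2^-1 * (p1 x + p2 x).
Proof.
rewrite /g_chi; congr (_ + _ * _).
pose K := `|x| + 2; have [h1 h2] : - K <= x /\ x <= K.
  by rewrite /K; have := ler_norm x; have := ler_norm (- x); rewrite normrN; split; lra.
have K2 : 2 <= K by rewrite /K lerDr.
rewrite -[LHS]/(\int[leb]_(z in setT) (expR (- `|x - z|) * m z)).
rewrite (@Rintegral_supp _ _ (- K) K); last first.
  move=> z; rewrite in_itv/= negb_and -!ltNge => hz; rewrite m0 ?mulr0//.
  by case/orP : hz => hz; [left; lra|right; lra].
rewrite (@Rintegral_split _ _ (- K) x K)//; last exact: ci.
rewrite left_part// ?right_part// ?h1//; lra.
Qed.

Let dexpN x : is_derive x (1 : R) (fun y => expR (- y)) (- expR (- x)).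
Proof.
have := @is_derive1_comp R expR (fun y => - y) x (expR (- x)) (-1) (is_derive_expR _) _.
by rewrite mulrN1; apply; apply: is_derive_eq.
Qed.

Let dp1 x : is_derive x (1 : R) p1 (m x - p1 x).
Proof.
have d1 := prim0_is_derive cw1 w10 x; have d2 := dexpN x.
apply: is_derive_eq; rewrite /GRing.scale/= /p1 /w1.
have e : expR (- x) * expR x = 1 by rewrite mulrC expRxMexpNx_1.
by rewrite mulrA e; ring.
Qed.

Let dp2 x : is_derive x (1 : R) p2 (p2 x - m x).
Proof.
have d1 := prim0_is_derive cw2 w20 x.
apply: is_derive_eq; rewrite /GRing.scale/=.
have e : expR x * expR (- x) = 1 by rewrite expRxMexpNx_1.
rewrite -[w2 x]/(expR (- x) * m x).
transitivity (p2 x - expR x * expR (- x) * m x); first by rewrite /p2; ring.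
by rewrite e mul1r.
Qed.

Let dg x := 2 * (chi x * derive1 chi x) + 2^-1 * (p2 x - p1 x).

Let d0 x : is_derive x (1 : R) chi (derive1 chi x). Proof. exact: cutoff_is_derive. Qed.

Let d1 x : is_derive x (1 : R) (derive1 chi) (derive1n 2 chi x).
Proof.
rewrite derive1nS derive1n1 derive1E; apply: DeriveDef => //.
by have sm := cutoff_smooth cchi; exact: (sm 1%N x).
Qed.

Lemma g_chi_is_derive x : is_derive x (1 : R) (g_chi chi) (dg x).
Proof.
have -> : g_chi chi = fun x => chi x ^+ 2 + 2^-1 * (p1 x + p2 x).
  by apply/funext => z; exact: g_chiE.
have e1 := d0 x; have e2 := dp1 x; have e3 := dp2 x.
by apply: is_derive_eq; rewrite /GRing.scale/= /dg; ring.
Qed.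

Lemma g_chi_derive1 x : derive1 (g_chi chi) x = dg x.
Proof. by rewrite derive1E; have := g_chi_is_derive x => h; rewrite derive_val. Qed.

(** Since [exp (- |x|) / 2] is the Green function of [1 - d^2/dx^2], differentiating the convolution
    twice produces [- m], which cancels the second derivative of [chi ^+ 2]. What remains is the
    bounded convolution itself. *)
Let ddg x : is_derive x (1 : R) dg (2^-1 * (p1 x + p2 x)).
Proof.
have e1 := d0 x; have e2 := dp1 x; have e3 := dp2 x; have e4 := d1 x.
have em : m x = 2 * derive1 chi x ^+ 2 + 2 * (chi x * derive1n 2 chi x) by [].
have [q qe] : exists q, q = derive1n 2 chi x by eexists.
rewrite -qe in e4 em.
by apply: is_derive_eq; rewrite /GRing.scale/= em; field.
Qed.

(** A single [X] suffices: [C1] bounds the derivative of [chi], and [C], the integral of [|m|],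
    bounds [p1] and [p2] since the kernel is at most 1. The formulas for [g], its derivative and its
    second derivative involve nothing else. *)
Lemma cutoff_constants : exists X : R, [/\ 0 <= X,
  forall x y, `|chi x - chi y| <= X * `|x - y|,
  forall x y, `|g_chi chi x - g_chi chi y| <= X * `|x - y|,
  forall x y, `|derive1 (g_chi chi) x - derive1 (g_chi chi) y| <= X * `|x - y| &
  (forall x, `|g_chi chi x| <= X) /\ (forall x, `|derive1 (g_chi chi) x| <= X)].
Proof.
have supp1 x : 1 < `|x| -> derive1 chi x = 0.
  move=> hx; rewrite -derive1n1 (cutoff_d0 cchi)//.
  by have [x0|x0] := leP 0 x; [right; rewrite ger0_norm in hx|left].
have [C1 hC1] := support_bounded (cutoff_cont1 cchi) supp1.
have mi a b : leb.-integrable `[a, b] (EFin \o (fun z => `|m z|)).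
  by apply: ci => z; apply: cvg_norm; exact: cm.
pose C := \int[leb]_(z in setT) `|m z|.
have seg a b : - 2 <= b -> a <= b -> \int[leb]_(z in `[a, b]) `|m z| <= C.
  move=> b2 ab; pose K := `|a| + `|b| + 2.
  have [h1 h2] : - K <= a /\ b <= K.
    rewrite /K; have := ler_norm b; have := ler_norm (- a); rewrite normrN.
    by have := normr_ge0 a; have := normr_ge0 b; split; lra.
  rewrite /C (@Rintegral_supp _ _ (- K) K); last first.
    move=> z; rewrite in_itv/= negb_and -!ltNge => hz; rewrite m0 ?normr0//.
    have := normr_ge0 a; have := normr_ge0 b => k1 k2.
    by case/orP : hz; rewrite /K => hz; [left; lra|right; lra].
  rewrite (@Rintegral_split _ _ (- K) a K)//; [|lra].
  rewrite (@Rintegral_split _ _ a b K)//.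
  by rewrite addrCA lerDl addr_ge0 ?Rintegral_ge0.
have bk x a b : - 2 <= b -> a <= b ->
    `|\int[leb]_(z in `[a, b]) (expR (- `|x - z|) * m z)| <= C.
  move=> b2 ab.
  have hi : leb.-integrable `[a, b] (EFin \o (fun z => expR (- `|x - z|) * m z)).
    by apply: ci; exact: ck.
  apply: (le_trans (le_normr_Rintegral _ hi)) => //.
  apply: le_trans (seg _ _ b2 ab); apply: le_Rintegral => //; first exact: integrable_normR.
  by move=> z _; rewrite normrM ger0_norm ?expR_ge0// -[leRHS]mul1r ler_wpM2r// exp_kernel_le1.
have bp1 x : `|p1 x| <= C.
  have [x1|x1] := leP x (-1).
    rewrite /p1 /prim0 Rintegral_seg0 ?mulr0 ?normr0; first exact: Rintegral_ge0.
    by move=> z /andP[_ zx]; rewrite w10//; lra.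
  pose K := `|x| + 2; have K1 : 1 <= K by rewrite /K; have := normr_ge0 x; lra.
  have Kx : - K <= x by rewrite /K; have := ler_norm (- x); rewrite normrN; lra.
  by rewrite /p1 -(left_part K1 Kx) bk//; lra.
have bp2 x : `|p2 x| <= C.
  pose K := `|x| + 2; have K2 : 2 <= K by rewrite /K lerDr.
  have [h1 h2] : - K <= x /\ x <= K.
    by rewrite /K; have := ler_norm x; have := ler_norm (- x); rewrite normrN; split; lra.
  by rewrite /p2 -(right_part K2) ?h1// bk//; lra.
have C10 : 0 <= C1 by exact: le_trans (hC1 0).
have C0 : 0 <= C by exact: Rintegral_ge0.
have b1 x : `|2^-1 * (p1 x + p2 x)| <= C.
  rewrite normrM ger0_norm ?invr_ge0//; have := ler_normD (p1 x) (p2 x).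
  by have := bp1 x; have := bp2 x; lra.
have b2 x : `|dg x| <= 2 * C1 + C.
  have h3 : `|chi x * derive1 chi x| <= C1.
    by rewrite normrM -[leRHS]mul1r ler_pM// cutoff_norm.
  have h4 := ler_normB (p2 x) (p1 x); have h1 := bp1 x; have h2 := bp2 x.
  rewrite /dg (le_trans (ler_normD _ _))// (normrM 2) (normrM 2^-1).
  by rewrite (@ger0_norm _ (2 : R))// (@ger0_norm _ (2^-1 : R)) ?invr_ge0//; lra.
have b3 x : `|g_chi chi x| <= 1 + C.
  rewrite g_chiE (le_trans (ler_normD _ _))// lerD// normrX.
  by rewrite -(expr1n _ 2) lerXn2r ?nnegrE// cutoff_norm.
have h1 := derive_lipschitz d0 hC1.
have h2 := derive_lipschitz g_chi_is_derive b2.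
have h3 := derive_lipschitz ddg b1.
have w (K : R) (u v : R) : K <= 1 + 2 * C1 + C -> K * `|u - v| <= (1 + 2 * C1 + C) * `|u - v|.
  by move=> hK; rewrite ler_wpM2r.
exists (1 + 2 * C1 + C); split.
- lra.
- by move=> x y; rewrite (le_trans (h1 x y))// w//; lra.
- by move=> x y; rewrite (le_trans (h2 x y))// w//; lra.
- by move=> x y; rewrite !g_chi_derive1 (le_trans (h3 x y))// w//; lra.
- split => x; first by rewrite (le_trans (b3 x))//; lra.
  by rewrite g_chi_derive1 (le_trans (b2 x))//; lra.
Qed.

End Cutoff.
End Gchi.

(** * Lagrangian states as profiles *)

Section Snapshot.
Context {R : realType}.
Implicit Types (f g : R -> R) (a b c x y xi B M : R).
Local Notation leb := (@lebesgue_measure R).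

Lemma Rintegral_ae f g (A : set R) : measurable (A : set (measurableTypeR R)) ->
  measurable_fun setT f -> measurable_fun setT g ->
  {ae leb, forall x, f x = g x} -> \int[leb]_(x in A) f x = \int[leb]_(x in A) g x.
Proof.
move=> mA mf mg fg; congr fine; apply: ae_eq_integral => //.
- by apply/measurable_EFinR; exact: measurable_funTS.
- by apply/measurable_EFinR; exact: measurable_funTS.
- by apply: filterS fg => [|x /= -> //]; exact: (ae_filter_ringOfSetsType leb).
Qed.

Lemma ae_sym f g : {ae leb, forall x, f x = g x} -> {ae leb, forall x, g x = f x}.
Proof. by apply: filterS => //; exact: (ae_filter_ringOfSetsType leb). Qed.

Lemma primitive_exists f : bmeas f -> exists D, primitive D f.
Proof.
move=> hf; pose D x := if 0 <= x then \int[leb]_(z in `[0, x]) f z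
  else - \int[leb]_(z in `[x, 0]) f z.
exists D => a b ab; rewrite /D; have hi u v := @bmeas_itv _ f u v hf.
have [a0|a0] := leP 0 a.
  rewrite (le_trans a0 ab) (@Rintegral_split _ f 0 a b)//; ring.
have [b0|b0] := leP 0 b; first by rewrite (@Rintegral_split _ f a 0 b)// 1?ltW//; ring.
by rewrite (@Rintegral_split _ f a b 0)// ?(ltW b0)//; ring.
Qed.

Lemma Linf_cont_bound f : continuous f -> Linf f -> exists2 M : R, 0 <= M & forall x, `|f x| <= M.
Proof.
move=> cf hf.
have : (Linf_norm f < +oo)%E by case/andP: hf => _ /set_mem; exact.
have : (0 <= Linf_norm f)%E by rewrite /Linf_norm Lnorm_ge0.
case E : (Linf_norm f) => [r||]// r0 _; exists r; first by rewrite -lee_fin.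
by apply: Linf_norm_cont => //; rewrite E.
Qed.

Lemma Linf_meas f : Linf f -> measurable_fun setT f.
Proof. by case/andP => /set_mem. Qed.

Lemma locint_meas f : locally_integrable setT f -> measurable_fun setT f.
Proof. by case => mf _ _; have := mf. Qed.

(* Setting all derivatives to 0 on a null set [N] preserves the relations
   defining G, while making them hold everywhere. *)
Definition zero_on (N : set R) f x : R := \1_(~` N) x * f x.

Lemma zero_on_bmeas (N : set (measurableTypeR R)) f M : measurable N -> measurable_fun setT f ->
  0 <= M -> (forall x, ~ N x -> `|f x| <= M) -> bmeas (zero_on N f).
Proof.
move=> mN mf M0 fM; split.
  apply: measurable_funM => //; apply: measurable_indic; exact: measurableC.
exists M => x; rewrite /zero_on indicE; have [xN|xN] := boolP (x \in ~` N).
  by rewrite mul1r; apply: fM; rewrite inE in xN.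
by rewrite mul0r normr0.
Qed.

Lemma zero_on_ae (N : set (measurableTypeR R)) f : measurable N -> leb N = 0%E ->
  {ae leb, forall x, zero_on N f x = f x}.
Proof.
move=> mN N0; exists N; split => // x /= h; apply: contrapT => xN; apply: h.
by rewrite /zero_on indicE mem_set// mul1r.
Qed.

Lemma zero_onP (N : set R) x :
  (~ N x /\ forall f, zero_on N f x = f x) \/ forall f, zero_on N f x = 0.
Proof.
have [xN|xN] := pselect (N x).
  by right => f; rewrite /zero_on indicE memNset ?mul0r//; exact.
by left; split => // f; rewrite /zero_on indicE mem_set// mul1r.
Qed.

(** In [rep_adm] the bound [B] is free: one profile is fixed for the state, and its admissibility is
    decided later, when bounds have been obtained by comparison with the limit. [rep_Q] and
    [rep_energy] hold since changing densities on a null set leaves the integrals unchanged. *)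
Record represents (chi : R -> R) (X : @lagrangian R) (p : @profile R) : Prop := Represents {
  rep_y : py p = ly X;
  rep_U : pU p = lU X;
  rep_c : pc p = lc chi X;
  rep_k : pk p = lk X;
  rep_H : forall a b, a <= b -> pH p b - pH p a = \int[leb]_(x in `[a, b]) lh X x;
  rep_adm : forall B, 1 <= B -> (forall x, `|lzeta X x| <= B) -> (forall x, `|lU X x| <= B) ->
    (forall a b, a <= b -> b <= a + 1 -> \int[leb]_(x in `[a, b]) lh X x <= B) ->
    `|lc chi X| <= B -> `|lk X| <= B -> admissible B p;
  rep_bounded : exists2 B : R, 1 <= B & admissible B p;
  rep_Q : lQ chi X = pQ chi (derive1 (g_chi chi)) p;
  rep_energy : forall a b, a <= b ->
    \int[leb]_(x in `[a, b]) (2 * (lU X x ^+ 2 + 2^-1 * lk X ^+ 2 - lP chi X x) * wd (lU X) x) =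
    \int[leb]_(x in `[a, b]) (2 * pA chi (g_chi chi) p x * pUx p x) }.

Section Good.
Variable chi : R -> R.
Hypothesis cchi : cutoff chi.

Lemma Hinf_cont v : Hinf chi v -> continuous v.
Proof.
move=> [c [cb _ _]]; have cc := cutoff_cont cchi.
have -> : v = fun x => Hinf_bar chi v c x + c.1 * chi (- x) + c.2 * chi x.
  by apply/funext => x; rewrite /Hinf_bar; ring.
move=> x; apply: cvgD; last by apply: cvgM; [exact: cvg_cst|exact: cc].
apply: cvgD; first exact: cb.
apply: cvgM; first exact: cvg_cst.
by apply: (@continuous_comp _ _ _ (fun z => - z) chi); [apply: cvgN; exact: cvg_id|exact: cc].
Qed.

Variable X : @lagrangian R.
Hypothesis GX : G_set chi X.

Lemma lzeta_cont : continuous (lzeta X). Proof. by case: GX => -[[]]. Qed.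

Lemma ly_cont : continuous (ly X).
Proof. by move=> x; apply: cvgD; [exact: cvg_id|exact: lzeta_cont]. Qed.

Lemma lU_cont : continuous (lU X).
Proof. by case: GX => -[_ [/Hinf_cont]]. Qed.

Lemma weak_derivative_id : weak_derivative (fun x : R => x) (fun=> 1 : R).
Proof.
have e : derive1 (fun x : R => x) = fun=> 1 :> R.
  by apply/funext => x; rewrite derive1E derive_id.
rewrite -e; apply: weak_derivative_C1; first by move=> x; exact: derivable_id.
by rewrite e; exact: cst_continuous.
Qed.

Lemma ly_weak : weak_derivative (ly X) (ly_xi X).
Proof.
apply: wdP; case: GX => _ [[_ [g gz _]] _] _ _.
by exists (fun x => 1 + g x); apply: weak_derivativeD => //; exact: weak_derivative_id.
Qed.

Lemma lU_weak : weak_derivative (lU X) (wd (lU X)).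
Proof. by apply: wdP; case: GX => _ [_ [_ [g gz _]]] _ _; exists g. Qed.

Lemma ly_xi_ae : exists M : R, {ae leb, forall x, `|ly_xi X x| <= M}.
Proof.
case: GX => _ [[_ [g gz /Linf_ae[M gM]]] _] _ _; exists (1 + M).
have e := weak_derivative_unique cchi ly_cont ly_weak (weak_derivativeD weak_derivative_id gz).
apply: filterS2 gM e => [|x h ->]; first exact: (ae_filter_ringOfSetsType leb).
by rewrite (le_trans (ler_normD _ _))// normr1 lerD2l.
Qed.

Lemma lzeta_bound : exists2 M : R, 0 <= M & forall x, `|lzeta X x| <= M.
Proof. by case: GX => _ [[hz _] _] _ _; exact: Linf_cont_bound lzeta_cont hz. Qed.

Lemma lU_bound : exists2 M : R, 0 <= M & forall x, `|lU X x| <= M.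
Proof. by case: GX => _ [_ [hz _]] _ _; exact: Linf_cont_bound lU_cont hz. Qed.

Lemma lh_meas : measurable_fun setT (lh X).
Proof. by case: GX => _ _ [/Linf_meas]. Qed.

Lemma ly_xi_meas : measurable_fun setT (ly_xi X).
Proof. by case: ly_weak => _ /locint_meas. Qed.

Lemma wdU_meas : measurable_fun setT (wd (lU X)).
Proof. by case: lU_weak => _ /locint_meas. Qed.

Lemma lrbar_meas : measurable_fun setT (lrbar X).
Proof.
apply: measurable_funB; first by case: GX => _ _ [_ /Linf_meas].
by apply: measurable_funM => //; exact: ly_xi_meas.
Qed.

Lemma good_set : exists (N : set (measurableTypeR R)) (M : R), [/\ measurable N, leb N = 0%E, 0 <=
  M &
  forall x, ~ N x -> [/\ 0 <= ly_xi X x, 0 <= lh X x,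
    ly_xi X x * lh X x = wd (lU X) x ^+ 2 + lrbar X x ^+ 2 &
    [/\ `|ly_xi X x| <= M, `|lh X x| <= M, `|wd (lU X) x| <= M & `|lrbar X x| <= M]]].
Proof.
have [M1 h1] := ly_xi_ae.
have [M2 h2] : exists M : R, {ae leb, forall x, `|lh X x| <= M}.
  by case: GX => _ _ [/Linf_ae].
case: GX => _ _ _ h3.
have [N [mN N0 hN]] : {ae leb, forall x, [/\ 0 <= ly_xi X x, 0 <= lh X x,
    ly_xi X x * lh X x = wd (lU X) x ^+ 2 + lrbar X x ^+ 2 &
    `|ly_xi X x| <= M1 /\ `|lh X x| <= M2]}.
  have fF := ae_filter_ringOfSetsType leb.
  by apply: filterS3 h1 h2 h3 => x a1 a2 [a3 a4 _ a5]; split.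
(* By the energy identity the squares of [wd (lU X)] and [lrbar X] are at most the product of the
   bounds on [y_xi] and [h], hence at most the square of this constant. *)
exists N, (1 + `|M1| + `|M2|); split => //.
move=> x xN; have /(_ x) := hN.
have [//|nP] := pselect ([/\ 0 <= ly_xi X x, 0 <= lh X x,
    ly_xi X x * lh X x = wd (lU X) x ^+ 2 + lrbar X x ^+ 2 &
    `|ly_xi X x| <= M1 /\ `|lh X x| <= M2]); last by move/(_ nP).
move=> [y0 h0 en [y1 hh1]] _; split => //.
have m1 := le_trans y1 (ler_norm M1); have m2 := le_trans hh1 (ler_norm M2).
rewrite (ger0_norm y0) in m1; rewrite (ger0_norm h0) in m2.
have n1 := normr_ge0 M1; have n2 := normr_ge0 M2.
have sq (v w : R) : ly_xi X x * lh X x = v ^+ 2 + w ^+ 2 -> `|v| <= 1 + `|M1| + `|M2|.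
  move=> e; rewrite -ler_sqr ?nnegrE ?normr_ge0// ?addr_ge0// real_normK ?num_real//.
  have : ly_xi X x * lh X x <= `|M1| * `|M2| by apply: ler_pM.
  have := sqr_ge0 w; nra.
split; [rewrite (ger0_norm y0); lra|rewrite (ger0_norm h0); lra|exact: sq en|].
by apply: (sq _ (wd (lU X) x)); rewrite addrC.
Qed.

Lemma lh_seg_bound : exists2 M : R, 0 <= M & forall a b, a <= b -> b <= a + 1 ->
  \int[leb]_(x in `[a, b]) lh X x <= M.
Proof.
have [N [M [mN N0 M0 hN]]] := good_set; exists M => // a b ab ba.
have hh := zero_on_bmeas mN lh_meas M0 (fun x xN => let: And4 _ _ _ (And4 _ h _ _) := hN x xN in h).
rewrite -(Rintegral_ae _ hh.1 lh_meas (zero_on_ae _ mN N0))//.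
have : \int[leb]_(x in `[a, b]) zero_on N (lh X) x <= \int[leb]_(x in `[a, b]) M.
  apply: Rintegral_seg => //; first exact: bmeas_cst.
  move=> x _; rewrite /zero_on indicE; have [xN|_] := boolP (x \in ~` N); last by rewrite mul0r.
  by rewrite mul1r (le_trans (ler_norm _))//; rewrite inE in xN; case: (hN x xN) => _ _ _ [].
move=> /le_trans -> //; rewrite Rintegral_seg_cst// -[leRHS]mulr1 ler_wpM2l//; lra.
Qed.

Lemma represents_exists : exists p, represents chi X p.
Proof.
have aux (m1 m2 m3 u v : R) : 0 <= m1 -> 0 <= m2 -> 0 <= m3 -> 0 <= u -> 0 <= v ->
    [/\ 1 <= 1 + m1 + m2 + m3 + u + v, m1 <= 1 + m1 + m2 + m3 + u + v,
      m2 <= 1 + m1 + m2 + m3 + u + v, m3 <= 1 + m1 + m2 + m3 + u + v &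
      u <= 1 + m1 + m2 + m3 + u + v /\ v <= 1 + m1 + m2 + m3 + u + v].
  by move=> *; repeat split; lra.
have [N [M [mN N0 M0 hN]]] := good_set.
have by1 := zero_on_bmeas mN ly_xi_meas M0 (fun x xN => let: And4 _ _ _ (And4 h _ _ _) := hN x xN
  in h).
have bh := zero_on_bmeas mN lh_meas M0 (fun x xN => let: And4 _ _ _ (And4 _ h _ _) := hN x xN in h).
have bU := zero_on_bmeas mN wdU_meas M0 (fun x xN => let: And4 _ _ _ (And4 _ _ h _) := hN x xN in
  h).
have br := zero_on_bmeas mN lrbar_meas M0 (fun x xN => let: And4 _ _ _ (And4 _ _ _ h) := hN x xN
  in h).
have [D hD] := primitive_exists bh.
pose p := Profile (ly X) (lU X) D (zero_on N (ly_xi X)) (zero_on N (wd (lU X)))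
  (zero_on N (lh X)) (zero_on N (lrbar X)) (lc chi X) (lk X).
have eH a b : a <= b -> D b - D a = \int[leb]_(x in `[a, b]) lh X x.
  move=> ab; rewrite (hD a b ab).
  by apply: Rintegral_ae => //; [exact: bh.1|exact: lh_meas|exact: zero_on_ae].
have adm B : 1 <= B -> (forall x, `|lzeta X x| <= B) -> (forall x, `|lU X x| <= B) ->
    (forall a b, a <= b -> b <= a + 1 -> \int[leb]_(x in `[a, b]) lh X x <= B) ->
    `|lc chi X| <= B -> `|lk X| <= B -> admissible B p.
  move=> B1 hz hU hh hc hk; split => //=.
  - by move=> x; have [[/hN[? _ _ _] ->]|->] := zero_onP N x.
  - by move=> x; have [[/hN[_ ? _ _] ->]|->] := zero_onP N x.
  - move=> x; have [[/hN[_ _ ? _] e]|e] := zero_onP N x; rewrite !e//.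
    by rewrite mul0r expr0n addr0.
  - move=> a b ab; rewrite (weak_derivative_FTC cchi ly_cont ly_weak)//.
    by apply: Rintegral_ae => //; [exact: ly_xi_meas|exact: by1.1|apply: ae_sym; exact: zero_on_ae].
  - move=> a b ab; rewrite (weak_derivative_FTC cchi lU_cont lU_weak)//.
    by apply: Rintegral_ae => //; [exact: wdU_meas|exact: bU.1|apply: ae_sym; exact: zero_on_ae].
  - by move=> x; rewrite /ly addrAC subrr add0r.
  - by move=> a b ab ba; rewrite eH// hh.
have [M1 M10 h1] := lzeta_bound; have [M2 M20 h2] := lU_bound.
have [M3 M30 h3] := lh_seg_bound.
pose B : R := 1 + M1 + M2 + M3 + `|lc chi X| + `|lk X|.
have [B1 B2 B3 B4 [B5 B6]] := aux _ _ _ _ _ M10 M20 M30 (normr_ge0 (lc chi X)) (normr_ge0 (lk X)).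
have pB : admissible B p.
  apply: adm => //.
  - by move=> x; exact: (le_trans (h1 x)).
  - by move=> x; exact: (le_trans (h2 x)).
  - by move=> a b ab ba; exact: (le_trans (h3 a b ab ba)).
have [C [C0 cL gL gdL [gB gdB]]] := cutoff_constants cchi.
have mchi : measurable_fun setT (fun x => chi (ly X x)).
  apply: continuous_measurable_fun => x.
  by apply: continuous_comp; [exact: ly_cont|exact: cutoff_cont].
have mPQ : measurable_fun setT (PQ_density chi X).
  have mUb : measurable_fun setT (pubar chi p).
    apply: measurable_funB; first by apply: continuous_measurable_fun; exact: lU_cont.
    by apply: measurable_funM.
  apply: measurable_funD; last exact: lh_meas.
  apply: measurable_funD.
    apply: measurable_funM; last exact: ly_xi_meas.
    apply: measurable_funD; first by apply: measurable_funM => //; apply: measurable_funX.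
    by apply: measurable_funM => //; apply: measurable_funM => //; apply: measurable_funM.
  by apply: measurable_funM => //; apply: measurable_funM => //; exact: lrbar_meas.
have eW (w : R -> R) : measurable_fun setT w ->
    \int[leb]_(eta in setT) (w eta * PQ_density chi X eta) =
    \int[leb]_(eta in setT) (w eta * pW chi p eta).
  move=> mw; apply: Rintegral_ae => //.
  - by apply: measurable_funM.
  - apply: measurable_funM => //.
    exact: (pW_bmeas (cutoff_norm cchi) cL pB).1.
  (* [pW] is linear in the densities, so at every point it equals [PQ_density] switched off on
     [N]. *)
  apply: filterS (zero_on_ae (PQ_density chi X) mN N0) => [|x <-].
    exact: (ae_filter_ringOfSetsType leb).
  rewrite /pW /zero_on /PQ_density /pS /pubar /lUbar /= /zero_on.
  ring.
have mk xi : measurable_fun setT (pkern p xi) := (pkern_bmeas pB xi).1.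
have eP xi : lP chi X xi = pP chi (g_chi chi) p xi.
  by rewrite /lP /pP -(eW _ (mk xi)).
exists p; split => //; first by exists B.
  apply/funext => xi; rewrite /lQ /pQ; congr (- (_ * _) + _).
  rewrite -(eW (fun eta => Num.sg (xi - eta) * pkern p xi eta))//.
  apply: measurable_funM => //; exact: (sg_bmeas xi).1.
move=> a b ab; rewrite (_ : (fun x => _) = fun x => 2 * pA chi (g_chi chi) p x * wd (lU X) x);
  last first.
  by apply/funext => x; rewrite /pA eP.
have mA := (pA_bmeas B1 C0 (cutoff_norm cchi) cL gL gB pB).1.
apply: Rintegral_ae => //.
- by apply: measurable_funM; [exact: measurable_funM|exact: wdU_meas].
- by apply: measurable_funM; [exact: measurable_funM|exact: bU.1].
apply: filterS (zero_on_ae (wd (lU X)) mN N0) => [|x /= -> //].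
exact: (ae_filter_ringOfSetsType leb).
Qed.

End Good.
End Snapshot.

(** * Stability of the Lagrangian flow *)

Section Curves.
Context {R : realType}.
Implicit Types (f g u v w : R -> R) (a b c x y xi t s B M : R).
Local Notation leb := (@lebesgue_measure R).

Lemma L2_bound f : L2 f -> exists2 n : R, 0 <= n & (\int[leb]_x ((f x) ^+ 2)%:E <= (n ^+ 2)%:E)%E.
Proof.
move=> /L2_sqr_integrable hf; have /integrableP[_] := hf.
have fin := integrable_fin_num measurableT hf.
exists (Num.sqrt (fine (\int[leb]_x ((f x) ^+ 2)%:E))); first exact: sqrtr_ge0.
rewrite sqr_sqrtr ?fineK//; apply: fine_ge0; apply: integral_ge0 => x _.
by rewrite lee_fin sqr_ge0.
Qed.

Lemma L2_seg f : L2 f -> exists2 n : R, 0 <= n & forall a b, a <= b -> b <= a + 1 ->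
  leb.-integrable `[a, b] (EFin \o f) /\ \int[leb]_(x in `[a, b]) `|f x| <= n.
Proof.
move=> hf; have [n n0 hn] := L2_bound hf; exists n => // a b ab ba.
exact: CS_unit ab ba n0 (L2_meas hf) hn.
Qed.

Lemma H1_bounded (chi : R -> R) f : cutoff chi -> H1 f -> exists2 M : R, 0 <= M & forall x, `|f x|
  <= M.
Proof.
move=> cchi hf; have [_ lg fg hg] := H1_wd cchi hf; have [cf hf2 _] := hf.
have [n n0 hn] := L2_seg hf2; have [m m0 hm] := L2_seg hg.
exists (n + m) => [|x]; first exact: addr_ge0.
have xx : x <= x + 1 by rewrite lerDl.
apply: le_trans (pointwise_bound x lg cf fg) _.
by apply: lerD; [exact: (hn _ _ xx (lexx _)).2|exact: (hm _ _ xx (lexx _)).2].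
Qed.

(** * Scalar functionals along a [C^1] curve in a function space *)

Section Functionals.
Variables (I : Type) (phi : I -> (R -> R) -> R) (B B' : set (R -> R)) (N : (R -> R) -> \bar R).
Variables (f f' : R -> R -> R) (C : R).
Hypothesis C0 : 0 <= C.
Hypothesis hf : C1_curve B N f f'.
Hypothesis BB' : B `<=` B'.
Hypothesis B'_comb : forall k u v w, B' u -> B' v -> B' w ->
  B' (fun x => k * (u x - v x) - w x).
Hypothesis phi_comb : forall i k u v w, B' u -> B' v -> B' w ->
  phi i (fun x => k * (u x - v x) - w x) = k * (phi i u - phi i v) - phi i w.
Hypothesis phi_le : forall i g (n : R), B' g -> 0 <= n -> (N g <= n%:E)%E -> `|phi i g| <= C * n.
Hypothesis phi_bounded : forall g, B g -> exists M : R, forall i, `|phi i g| <= M.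

(** The functionals are linear and bounded by [C * N] uniformly in [i], so convergence of difference
    quotients in norm yields scalar convergence uniform in [i]. The instances are point evaluations
    and integrals over unit segments. [B'] is a class containing [B] and closed under the
    combinations that occur. *)
Lemma curve_difference t (e : R) : 0 <= t -> 0 < e -> exists2 d : R, 0 < d &
  forall s, 0 <= s -> s != t -> `|s - t| < d -> forall i,
    `|(s - t)^-1 * (phi i (f s) - phi i (f t)) - phi i (f' t)| <= e.
Proof.
move=> t0 e0; have [Bf Bf' h _] := hf t0.
have d0 : 0 < e / (C + 1) by rewrite divr_gt0// ltr_wpDl.
have /near_time[d dp hd] : \forall s \near within [set s | 0 <= s] t^',
    (N (fun x => (s - t)^-1 * (f s x - f t x) - f' t x)%R <= (e / (C + 1))%:E)%E.
  have d0' : (0%E < (e / (C + 1))%:E)%E by rewrite lte_fin.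
  have hn : \forall s \near within [set s | 0 <= s] t^',
    (N (fun x => (s - t)^-1 * (f s x - f t x) - f' t x)%R < (e / (C + 1))%:E)%E.
    exact: (h _ (open_ereal_lt' d0')).
  by apply: filterS hn => s; exact: ltW.
exists d => // s s0 st sd i; have [Bs _ _ _] := hf s0.
have h1 := hd s s0 st sd.
rewrite -phi_comb; [|exact: BB'..].
apply: le_trans (phi_le i _ (ltW d0) h1) _; first by apply: B'_comb; exact: BB'.
by rewrite mulrCA ler_piMr ?(ltW e0)// ler_pdivrMr ?mul1r ?lerDl// ltr_wpDl.
Qed.

Lemma curve_regular t : 0 <= t ->
  (forall i, time_deriv (fun s => phi i (f s)) t (phi i (f' t))) /\
  equicontinuous_at (fun i s => phi i (f s)) t.
Proof.
move=> t0; split=> [i|e e0].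
  apply/cvgrPdist_le => e e0; have [d d0 hd] := curve_difference t0 e0.
  by apply/near_time; exists d => // s s0 st sd; rewrite distrC; exact: hd.
have [d d0 hd] := curve_difference t0 ltr01.
have [Bf Bf' _ _] := hf t0; have [M hM] := phi_bounded Bf'.
pose K := `|M| + 1; have K0 : 0 < K by rewrite ltr_wpDl.
exists (Num.min d (e / K)); first by rewrite lt_min d0 divr_gt0.
move=> r r0; rewrite lt_min => /andP[rd re] i.
have [->|rt] := eqVneq r t; first by rewrite subrr normr0 ltW.
have h := hd r r0 rt rd i; have rt0 : r - t != 0 by rewrite subr_eq0.
have -> : phi i (f r) - phi i (f t) = (r - t) * (((r - t)^-1 * (phi i (f r) - phi i (f t)) - phi i
  (f' t)) + phi i (f' t)).
  by rewrite subrK mulrA mulfV// mul1r.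
rewrite normrM; apply: (@le_trans _ _ ((e / K) * K)); last by rewrite divfK// gt_eqF.
apply: ler_pM => //; first exact: ltW.
apply: le_trans (ler_normD _ _) _; rewrite /K addrC lerD//.
exact: le_trans (hM i) (ler_norm M).
Qed.

End Functionals.

(** As an index type, this puts the energy increments on the same footing as the values of [y] and
    [U] at points. *)
Definition unit_segment := {ab : R * R | (ab.1 <= ab.2) && (ab.2 <= ab.1 + 1)}.

Definition unit_integral (i : unit_segment) f : R :=
  \int[leb]_(x in `[(sval i).1, (sval i).2]) f x.

(** All that Gronwall's argument sees of a solution, in scalar form. Derivatives are stated for
    positive times, where they are two-sided; the equicontinuity fields link them to time 0. *)
Record evolution (chi g gd : R -> R) (p : R -> @profile R) : Prop := Evolution {
  ev_adm : forall s B, 0 <= s -> 1 <= B -> (forall x, `|py (p s) x - x| <= B) ->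
    (forall x, `|pU (p s) x| <= B) ->
    (forall a b, a <= b -> b <= a + 1 -> pH (p s) b - pH (p s) a <= B) ->
    `|pc (p s)| <= B -> `|pk (p s)| <= B -> admissible B (p s);
  ev_bound : forall s, 0 <= s -> exists2 B : R, 1 <= B & admissible B (p s);
  ev_c : forall s, 0 <= s -> pc (p s) = pc (p 0);
  ev_k : forall s, 0 <= s -> pk (p s) = pk (p 0);
  ev_y_equicont : forall s, 0 <= s -> equicontinuous_at (fun xi r => py (p r) xi) s;
  ev_U_equicont : forall s, 0 <= s -> equicontinuous_at (fun xi r => pU (p r) xi) s;
  ev_H_equicont : forall s, 0 <= s -> equicontinuous_at
    (fun (i : unit_segment) r => pH (p r) (sval i).2 - pH (p r) (sval i).1) s;
  ev_dy : forall s xi, 0 < s -> is_derive s (1 : R) (fun r => py (p r) xi) (pU (p s) xi);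
  ev_dU : forall s xi, 0 < s -> is_derive s (1 : R) (fun r => pU (p r) xi) (- pQ chi gd (p s) xi);
  ev_dH : forall s a b, 0 < s -> a <= b -> b <= a + 1 ->
    is_derive s (1 : R) (fun r => pH (p r) b - pH (p r) a)
      (\int[leb]_(x in `[a, b]) (2 * pA chi g (p s) x * pUx (p s) x)) }.

Section Stability.
Variables (chi g gd : R -> R) (X : R).
Hypothesis X0 : 0 <= X.
Hypothesis chi01 : forall x, `|chi x| <= 1.
Hypothesis chiL : forall x y, `|chi x - chi y| <= X * `|x - y|.
Hypothesis gL : forall x y, `|g x - g y| <= X * `|x - y|.
Hypothesis gdL : forall x y, `|gd x - gd y| <= X * `|x - y|.
Hypothesis gB : forall x, `|g x| <= X.
Hypothesis gdB : forall x, `|gd x| <= X.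

Lemma evolution_bounded q (T : R) : 0 <= T -> evolution chi g gd q ->
  exists2 B : R, 1 <= B & forall s, 0 <= s <= T -> admissible B (q s).
Proof.
move=> T0 ev.
have F1 : forall s, 0 <= s <= T -> equicontinuous_at (fun xi r => py (q r) xi - xi) s.
  move=> s /andP[s0 _] e e0; have [d d0 hd] := ev_y_equicont ev s0 e0.
  exists d => // r r0 rs i; have := hd r r0 rs i.
  by rewrite (_ : _ - _ = (py (q r) i - i) - (py (q s) i - i))//; ring.
have [M1 h1] : exists M : R, forall s, 0 <= s <= T -> forall i, `|py (q s) i - i| <= M.
  apply: (equicontinuous_bounded T0 F1) => s /andP[s0 _].
  by have [B _ aB] := ev_bound ev s0; exists B; exact: adm_yB aB.
have [M2 h2] : exists M : R, forall s, 0 <= s <= T -> forall i, `|pU (q s) i| <= M.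
  apply: (equicontinuous_bounded T0) => s /andP[s0 _]; first exact: ev_U_equicont ev _ s0.
  by have [B _ aB] := ev_bound ev s0; exists B; exact: adm_UB aB.
have [M3 h3] : exists M : R, forall s, 0 <= s <= T -> forall i : unit_segment,
    `|pH (q s) (sval i).2 - pH (q s) (sval i).1| <= M.
  apply: (equicontinuous_bounded T0) => s /andP[s0 _]; first exact: ev_H_equicont ev _ s0.
  have [B _ aB] := ev_bound ev s0; exists B => -[[a b] /= /andP[ab ba]].
  by rewrite ger0_norm ?(H_incr aB)// (adm_HB aB).
pose B := 1 + `|M1| + `|M2| + `|M3| + `|pc (q 0)| + `|pk (q 0)|.
have n1 := normr_ge0 M1; have n2 := normr_ge0 M2; have n3 := normr_ge0 M3.
have n4 := normr_ge0 (pc (q 0)); have n5 := normr_ge0 (pk (q 0)).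
exists B => [|s sT]; first by rewrite /B; lra.
have /andP[s0 _] := sT; apply: (ev_adm ev s0).
- by rewrite /B; lra.
- by move=> x; have := h1 s sT x; have := ler_norm M1; rewrite /B; lra.
- by move=> x; have := h2 s sT x; have := ler_norm M2; rewrite /B; lra.
- move=> a b ab ba; have abP : ((a, b).1 <= (a, b).2) && ((a, b).2 <= (a, b).1 + 1) by rewrite ab.
  have /= := h3 s sT (exist _ (a, b) abP); have := ler_norm M3.
  have := ler_norm (pH (q s) b - pH (q s) a); rewrite /B; lra.
- by rewrite (ev_c ev s0) /B; lra.
- by rewrite (ev_k ev s0) /B; lra.
Qed.

(** [K] is chosen from [q] and [T] before [p] appears, so it serves the whole sequence;
    [eps * K <= 1] keeps [p] within distance 1 of [q] up to time [T]. *)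
Lemma evolution_stability q (T : R) : 0 <= T -> evolution chi g gd q -> pk (q 0) = 0 ->
  exists2 K : R, 0 < K & forall (eps : R) p, 0 < eps -> eps * K <= 1 ->
    evolution chi g gd p -> profile_close eps (p 0) (q 0) -> profile_close (eps * K) (p T) (q T).
Proof.
move=> T0 evq kq; have [B1 B11 admq1] := evolution_bounded T0 evq.
(* As long as [p] is within 1 of [q], the bounds [B1] on [q] become bounds [B] on [p], and one [B]
   fits both. *)
pose B : R := B1 + 1; have B1' : 1 <= B by rewrite /B; lra.
have BB : B1 <= B by rewrite /B lerDl.
have admq s : 0 <= s <= T -> admissible B (q s).
  move=> sT; have a1 := admq1 s sT; have /andP[s0 _] := sT; apply: (ev_adm evq) => //.
  - by move=> x; exact: le_trans (adm_yB a1 x) BB.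
  - by move=> x; exact: le_trans (adm_UB a1 x) BB.
  - by move=> a b ab ba; exact: le_trans (adm_HB a1 ab ba) BB.
  - exact: le_trans (adm_cB a1) BB.
  - exact: le_trans (adm_kB a1) BB.
(* The summands serve the equations for [y], where the rate is [U] itself, for [U] and for the
   energy. Since [c] and [k] are constant in time, they stay outside the family. *)
pose L : R := 1 + `|KQ X B| + `|KE X B|.
have KQ0 := normr_ge0 (KQ X B); have KE0 := normr_ge0 (KE X B).
have KQ1 := ler_norm (KQ X B); have KE1 := ler_norm (KE X B).
have L0 : 0 <= L by rewrite /L; lra.
exists (2 * expR (L * T)); first by rewrite mulr_gt0 ?expR_gt0.
move=> eps p e0 eK evp cl0.
pose I := (R + R + unit_segment)%type.
pose D (i : I) s := match i with
  | inl (inl xi) => py (p s) xi - py (q s) xi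
  | inl (inr xi) => pU (p s) xi - pU (q s) xi
  | inr ab => (pH (p s) (sval ab).2 - pH (p s) (sval ab).1) -
              (pH (q s) (sval ab).2 - pH (q s) (sval ab).1) end.
pose dD (i : I) s := match i with
  | inl (inl xi) => pU (p s) xi - pU (q s) xi
  | inl (inr xi) => - pQ chi gd (p s) xi - - pQ chi gd (q s) xi
  | inr ab => unit_integral ab (fun x => 2 * pA chi g (p s) x * pUx (p s) x) -
     unit_integral ab (fun x => 2 * pA chi g (q s) x * pUx (q s) x) end.
have mkclose s (e : R) : 0 <= s -> eps <= e -> (forall i, `|D i s| <= e) -> profile_close e (p s)
  (q s).
  move=> s0 ee hD; split.
  - by move=> x; exact: (hD (inl (inl x))).
  - by move=> x; exact: (hD (inl (inr x))).
  - move=> a b ab ba; have abP : ((a, b).1 <= (a, b).2) && ((a, b).2 <= (a, b).1 + 1) by rewrite ab.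
    exact: (hD (inr (exist _ (a, b) abP))).
  - by rewrite (ev_c evp s0) (ev_c evq s0) (le_trans (close_c cl0)).
  - by rewrite (ev_k evp s0) (le_trans (close_k cl0)).
  - by rewrite (ev_k evq s0).
have admp s (e : R) : 0 <= s <= T -> e <= 1 -> profile_close e (p s) (q s) -> admissible B (p s).
  move=> sT e1 cl; have a1 := admq1 s sT; have /andP[s0 _] := sT.
  apply: (ev_adm evp) => //.
  - move=> x; rewrite (_ : _ - _ = (py (p s) x - py (q s) x) + (py (q s) x - x)); last by ring.
    apply: le_trans (ler_normD _ _) _.
    have := close_y cl x; have := adm_yB a1 x; rewrite /B; lra.
  - move=> x; rewrite (_ : pU (p s) x = (pU (p s) x - pU (q s) x) + pU (q s) x); last by ring.
    apply: le_trans (ler_normD _ _) _.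
    have := close_U cl x; have := adm_UB a1 x; rewrite /B; lra.
  - move=> a b ab ba; have := close_H cl ab ba; have := adm_HB a1 ab ba.
    have := ler_norm ((pH (p s) b - pH (p s) a) - (pH (q s) b - pH (q s) a)); rewrite /B; lra.
  - rewrite (_ : pc (p s) = (pc (p s) - pc (q s)) + pc (q s)); last by ring.
    apply: le_trans (ler_normD _ _) _.
    have := close_c cl; have := adm_cB a1; rewrite /B; lra.
  - have := close_k cl; have := adm_kB a1; have := normr_ge0 (pk (q s)); rewrite /B; lra.
have eqB (J : Type) (f1 f2 : J -> R -> R) s : equicontinuous_at f1 s -> equicontinuous_at f2 s ->
    equicontinuous_at (fun i r => f1 i r - f2 i r) s.
  move=> h1 h2 e e1; have e2 : 0 < e / 2 by rewrite divr_gt0.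
  have [d1 d10 hd1] := h1 _ e2; have [d2 d20 hd2] := h2 _ e2.
  exists (Num.min d1 d2) => [|r r0]; first by rewrite lt_min d10.
  rewrite lt_min => /andP[r1 r2] i.
  rewrite (_ : _ - _ = (f1 i r - f1 i s) - (f2 i r - f2 i s)); last by ring.
  by apply: le_trans (ler_normB _ _) _; rewrite [leRHS]splitr lerD ?hd1 ?hd2.
have Dc s : 0 <= s <= T -> equicontinuous_at D s.
  move=> /andP[s0 _] e e1.
  have [d1 d10 hd1] := eqB _ _ _ _ (ev_y_equicont evp s0) (ev_y_equicont evq s0) _ e1.
  have [d2 d20 hd2] := eqB _ _ _ _ (ev_U_equicont evp s0) (ev_U_equicont evq s0) _ e1.
  have [d3 d30 hd3] := eqB _ _ _ _ (ev_H_equicont evp s0) (ev_H_equicont evq s0) _ e1.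
  exists (Num.min d1 (Num.min d2 d3)) => [|r r0]; first by rewrite !lt_min d10 d20.
  rewrite !lt_min => /and3P[r1 r2 r3] [[xi|xi]|ab]; [exact: hd1|exact: hd2|exact: hd3].
have Dd i s : 0 < s < T -> is_derive s (1 : R) (D i) (dD i s).
  move=> /andP[s0 _]; case: i => [[xi|xi]|[[a b] abP]]; rewrite /D /dD/=;
    last have /andP[/= ab ba] := abP.
  - exact: is_deriveB (ev_dy evp xi s0) (ev_dy evq xi s0).
  - exact: is_deriveB (ev_dU evp xi s0) (ev_dU evq xi s0).
  - exact: is_deriveB (ev_dH evp s0 ab ba) (ev_dH evq s0 ab ba).
have Dl s (e : R) : 0 < s < T -> eps <= e -> e <= 1 -> (forall i, `|D i s| <= e) ->
    forall i, `|dD i s| <= L * e.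
  move=> /andP[s0 sT] ee e1 hD i; have s0T : 0 <= s <= T by rewrite !ltW.
  have cl := mkclose s e (ltW s0) ee hD.
  have ap := admp s e s0T e1 cl; have aq := admq s s0T.
  have ge0 : 0 <= e by exact: le_trans (ltW e0) ee.
  case: i => [[xi|xi]|[[a b] abP]]; rewrite /dD/=; last have /andP[/= ab ba] := abP.
  - by apply: le_trans (close_U cl xi) _; rewrite -[leLHS]mul1r ler_wpM2r// /L; lra.
  - rewrite -opprD normrN.
    apply: (@le_trans _ _ (KQ X B * e)); last by rewrite ler_wpM2r// /L; lra.
    exact: (pQ_diff B1' X0 chi01 chiL gdL gdB ge0 ap aq cl xi).
  - apply: (@le_trans _ _ (KE X B * e)); last by rewrite ler_wpM2r// /L; lra.
    exact: (energy_diff B1' X0 chi01 chiL gL gB ge0 ap aq cl ab ba).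
have D0 i : `|D i 0| <= eps.
  case: i => [[xi|xi]|[[a b] abP]]; rewrite /D/=; last have /andP[/= ab ba] := abP.
  - exact: close_y cl0 xi.
  - exact: close_U cl0 xi.
  - exact: close_H cl0 _ _ ab ba.
have TT : 0 <= T <= T by rewrite T0/=.
have eK' : 2 * eps * expR (L * T) <= 1 by rewrite -mulrA mulrCA.
have := gronwall_family e0 L0 eK' D0 Dc Dd Dl TT => h.
apply: mkclose => //.
  rewrite ler_peMr ?(ltW e0)//; have : 1 <= expR (L * T) by rewrite -expR0 ler_expR mulr_ge0.
  lra.
by move=> i; rewrite mulrCA mulrA; exact: h.
Qed.

End Stability.
End Curves.

(** * Solutions of the Lagrangian system as evolutions of profiles *)

Section SolutionEvolution.
Context {R : realType}.
Implicit Types (f g u v w : R -> R) (a b c x y xi t s B M : R).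
Local Notation leb := (@lebesgue_measure R).
Variable chi : R -> R.
Hypothesis cchi : cutoff chi.
Variable X : R -> @lagrangian R.
Hypothesis HX : lagrangian_solution chi X.

Lemma solution_G s : 0 <= s -> G_set chi (X s). Proof. by case: HX => h _; exact: h. Qed.

Lemma solution_lc s : 0 <= s -> lc chi (X s) = lc chi (X 0).
Proof.
case: HX => _ [_ _ _ _ h]; apply: (time_deriv0_const (f := fun s => lc chi (X s))) => t t0.
by case: (h t t0).
Qed.

Lemma solution_lk s : 0 <= s -> lk (X s) = lk (X 0).
Proof.
case: HX => _ [_ _ _ _ h]; apply: (time_deriv0_const (f := fun s => lk (X s))) => t t0.
by case: (h t t0).
Qed.

Lemma zeta_curve s : 0 <= s ->
  (forall xi, time_deriv (fun r => lzeta (X r) xi) s (lU (X s) xi)) /\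
  equicontinuous_at (fun xi r => lzeta (X r) xi) s.
Proof.
move=> s0; case: HX => _ [h _ _ _ _].
(* Continuity is all that the evaluation bound [Linf_norm_cont] asks for, and it is plainly stable
   under linear combinations. *)
have BB : @V R `<=` [set f : R -> R | continuous f] by move=> f [].
have comb k u v w : [set f : R -> R | continuous f] u -> [set f : R -> R | continuous f] v ->
    [set f : R -> R | continuous f] w -> [set f : R -> R | continuous f] (fun x => k * (u x - v x)
      - w x).
  move=> /= cu cv cw x; apply: cvgB; last exact: cw.
  by apply: cvgM; [exact: cvg_cst|apply: cvgB; [exact: cu|exact: cv]].
have le1 (i : R) g (n : R) : [set f : R -> R | continuous f] g -> 0 <= n -> (V_norm g <= n%:E)%E ->
    `|g i| <= 1 * n.
  move=> /= cg n0 hn; rewrite mul1r; apply: Linf_norm_cont => //.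
  apply: le_trans hn; rewrite /V_norm leeDl//; exact: Lnorm_ge0.
have bd g : V g -> exists M : R, forall i, `|g i| <= M.
  by move=> [cg lg _]; have [M _ hM] := Linf_cont_bound cg lg; exists M.
exact: (@curve_regular R R (fun xi f => f xi) _ _ _ _ _ 1 ler01 h BB comb
  (fun _ _ _ _ _ _ _ _ => erefl) le1 bd _ s0).
Qed.

Lemma Ubar_curve s : 0 <= s ->
  (forall xi, time_deriv (fun r => lUbar chi (X r) xi) s
     (- lQ chi (X s) xi - lc chi (X s) * derive1 chi (ly (X s) xi) * lU (X s) xi)) /\
  equicontinuous_at (fun xi r => lUbar chi (X r) xi) s.
Proof.
move=> s0; case: HX => _ [_ h _ _ _].
have BB : @H1 R `<=` @H1 R by [].
have comb k (u v w : R -> R) : H1 u -> H1 v -> H1 w -> H1 (fun x => k * (u x - v x) - w x).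
  by move=> hu hv hw; apply: (H1B (H1Z k (H1B hu hv)) hw).
have C0 : 0 <= 2 :> R by [].
have le1 (i : R) (g : R -> R) (n : R) : H1 g -> 0 <= n -> (H1_norm g <= n%:E)%E -> `|g i| <= 2 * n.
  by move=> hg n0 hn; exact: (H1_sup cchi).
have bd (g : R -> R) : H1 g -> exists M : R, forall i, `|g i| <= M.
  by move=> hg; have [M _ hM] := H1_bounded cchi hg; exists M.
have H := @curve_regular R R (fun xi f => f xi) _ _ _ _ _ 2 C0 h BB comb
  (fun _ _ _ _ _ _ _ _ => erefl) le1 bd _ s0; exact: H.
Qed.

Lemma h_curve s : 0 <= s ->
  (forall i : @unit_segment R, time_deriv (fun r => unit_integral i (lh (X r))) s
     (unit_integral i (fun x => 2 * (lU (X s) x ^+ 2 + 2^-1 * lk (X s) ^+ 2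
           - lP chi (X s) x) * wd (lU (X s)) x))) /\
  equicontinuous_at (fun (i : @unit_segment R) r => unit_integral i (lh (X r))) s.
Proof.
move=> s0; case: HX => _ [_ _ h _ _].
have BB : @L2 R `<=` @L2 R by [].
have comb k (u v w : R -> R) : L2 u -> L2 v -> L2 w -> L2 (fun x => k * (u x - v x) - w x).
  by move=> hu hv hw; apply: (L2B (L2Z k (L2B hu hv)) hw).
have int (i : @unit_segment R) (g : R -> R) : L2 g -> leb.-integrable `[(sval i).1, (sval i).2]
  (EFin \o g).
  move=> hg; have [n n0 hn] := L2_seg hg; case: i => [[a b] abP] /=; have /andP[/= ab ba] := abP.
  exact: (hn a b ab ba).1.
have lin (i : @unit_segment R) (k : R) (u v w : R -> R) : L2 u -> L2 v -> L2 w ->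
   unit_integral i (fun x => k * (u x - v x) - w x) =
   k * (unit_integral i u - unit_integral i v)
   - unit_integral i w.
  move=> hu hv hw; rewrite /unit_integral; have iu := int i _ hu; have iv := int i _ hv;
    have iw := int i _ hw.
  have iuv := integrableBR _ iu iv.
  rewrite RintegralB//; last by apply: integrableZR => //; exact: integrableBR.
  by rewrite RintegralZl//; [rewrite RintegralB|exact: integrableBR].
have le1 (i : @unit_segment R) (g : R -> R) (n : R) : L2 g -> 0 <= n -> (L2_norm g <= n%:E)%E ->
    `|unit_integral i g| <= 1 * n.
  move=> hg n0; rewrite L2_norm_le// mul1r => hn.
  case: i => [[a b] abP] /=; have /andP[/= ab ba] := abP.
  have [i1 i2] := CS_unit ab ba n0 (L2_meas hg) hn.
  by apply: le_trans i2; exact: le_normr_Rintegral.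
have bd (g : R -> R) : L2 g -> exists M : R, forall i : @unit_segment R,
    `|unit_integral i g| <= M.
  move=> hg; have [n n0 hn] := L2_bound hg; exists (1 * n) => i; apply: le1 => //.
  by rewrite L2_norm_le.
have H := @curve_regular R _ (@unit_integral R) _ _ _ _ _ 1 ler01 h BB comb lin le1 bd _ s0.
exact: H.
Qed.

Lemma near_time_eq f g s l : 0 < s -> (forall r, 0 <= r -> f r = g r) ->
  is_derive s (1 : R) f l -> is_derive s (1 : R) g l.
Proof.
move=> s0 fg; apply: near_eq_is_derive.
by apply: filterS (lt_nbhsr s0) => r /ltW; exact: fg.
Qed.

Lemma ly_curve s xi : 0 < s -> is_derive s (1 : R) (fun r => ly (X r) xi) (lU (X s) xi).
Proof.
move=> s0; have /(time_deriv_is_derive s0) h := (zeta_curve (ltW s0)).1 xi.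
have hc : is_derive s (1 : R) (cst xi : R -> R) 0 by exact: is_derive_cst.
by have := is_deriveD hc h; rewrite add0r.
Qed.

Lemma lU_E r xi : 0 <= r -> lUbar chi (X r) xi + lc chi (X 0) * chi (ly (X r) xi) = lU (X r) xi.
Proof. by move=> r0; rewrite /lUbar (solution_lc r0) subrK. Qed.

(** The term with [derive1 chi] in the equation for [lUbar] is cancelled by the chain rule for
    [c * chi (y)], because [c] is constant and [y] moves with speed [U]. *)
Lemma lU_curve s xi : 0 < s -> is_derive s (1 : R) (fun r => lU (X r) xi) (- lQ chi (X s) xi).
Proof.
move=> s0; have /(time_deriv_is_derive s0) h := (Ubar_curve (ltW s0)).1 xi.
apply: (near_time_eq s0 (f := fun r => lUbar chi (X r) xi + lc chi (X 0) * chi (ly (X r) xi))).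
  by move=> r r0; exact: lU_E.
have hy := ly_curve xi s0.
have hc : is_derive s (1 : R) (fun r => chi (ly (X r) xi)) (lU (X s) xi * derive1 chi (ly (X s)
  xi)).
  have hchi := cutoff_is_derive cchi (ly (X s) xi).
  have := @is_derive1_comp R chi (fun r => ly (X r) xi) s _ _ hchi hy.
  by rewrite mulrC.
apply: is_derive_eq; rewrite /GRing.scale/= (solution_lc (ltW s0)); ring.
Qed.

Lemma lU_equicontinuous s : 0 <= s -> equicontinuous_at (fun xi r => lU (X r) xi) s.
Proof.
move=> s0 e e0; have [C [C0 cL _ _ _]] := cutoff_constants cchi.
have e2 : 0 < e / 2 by rewrite divr_gt0.
pose K : R := 1 + `|lc chi (X 0)| * C.
have K0 : 0 < K by rewrite ltr_wpDr// mulr_ge0.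
have [d1 d10 hd1] := (Ubar_curve s0).2 _ e2.
have eK : 0 < e / 2 / K by rewrite divr_gt0.
have [d2 d20 hd2] := (zeta_curve s0).2 _ eK.
exists (Num.min d1 d2) => [|r r0]; first by rewrite lt_min d10.
rewrite lt_min => /andP[r1 r2] xi; rewrite -!lU_E//.
rewrite (_ : _ - _ = (lUbar chi (X r) xi - lUbar chi (X s) xi) +
  lc chi (X 0) * (chi (ly (X r) xi) - chi (ly (X s) xi))); last by ring.
apply: le_trans (ler_normD _ _) _; rewrite [leRHS]splitr lerD ?hd1// normrM.
apply: (@le_trans _ _ (`|lc chi (X 0)| * (C * (e / 2 / K)))).
  rewrite ler_wpM2l// (le_trans (cL _ _))// ler_wpM2l//.
  by rewrite (_ : _ - _ = lzeta (X r) xi - lzeta (X s) xi) ?hd2// /ly; ring.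
have tK : e / 2 / K * K = e / 2 by rewrite divfK// gt_eqF.
move: tK eK; set w := e / 2 / K; rewrite /K => <- w0; rewrite mulrDr mulr1 mulrA [leRHS]addrC.
by rewrite [w * _]mulrC lerDl ltW.
Qed.

Lemma solution_evolution : exists2 p, evolution chi (g_chi chi) (derive1 (g_chi chi)) p &
  forall s, 0 <= s -> [/\ py (p s) = ly (X s), pU (p s) = lU (X s), pc (p s) = lc chi (X s),
    pk (p s) = lk (X s) & forall a b, a <= b ->
    pH (p s) b - pH (p s) a = \int[leb]_(x in `[a, b]) lh (X s) x].
Proof.
(* The choice of profiles must be total in [s]; for negative times a profile of [X 0] fills in. *)
have sn s : exists p, 0 <= s -> represents chi (X s) p.
  have [s0|s0] := leP 0 s.
    by have [p hp] := represents_exists cchi (solution_G s0); exists p => _.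
  by have [p _] := represents_exists cchi (solution_G (lexx 0)); exists p.
have [p hp] := choice sn; exists p; last first.
  by move=> s s0; have [e1 e2 e3 e4 e5 _ _ _ _] := hp s s0.
split.
- move=> s B s0 B1 hy hU hH hc hk; have [e1 e2 e3 e4 e5 e6 _ _ _] := hp s s0.
  apply: e6 => //.
  + by move=> x; have := hy x; rewrite e1 /ly addrAC subrr add0r.
  + by rewrite -e2.
  + by move=> a b ab ba; rewrite -e5//; exact: hH.
  + by rewrite -e3.
  + by rewrite -e4.
- by move=> s s0; exact: rep_bounded (hp s s0).
- move=> s s0; rewrite (rep_c (hp s s0)) (rep_c (hp 0 (lexx 0))).
  exact: solution_lc.
- move=> s s0; rewrite (rep_k (hp s s0)) (rep_k (hp 0 (lexx 0))).
  exact: solution_lk.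
- move=> s s0 e e0; have [d d0 hd] := (zeta_curve s0).2 _ e0; exists d => // r r0 rs xi.
  rewrite (rep_y (hp s s0)) (rep_y (hp r r0)).
  by rewrite (_ : _ - _ = lzeta (X r) xi - lzeta (X s) xi) ?hd// /ly; ring.
- move=> s s0 e e0; have [d d0 hd] := lU_equicontinuous s0 e0; exists d => // r r0 rs xi.
  rewrite (rep_U (hp s s0)) (rep_U (hp r r0)).
  exact: hd.
- move=> s s0 e e0; have [d d0 hd] := (h_curve s0).2 _ e0; exists d => // r r0 rs i.
  have h := hd r r0 rs i; case: i h => -[a b] abP /= h; have /andP[/= ab ba] := abP.
  by rewrite (rep_H (hp s s0) ab) (rep_H (hp r r0) ab).
- move=> s xi s0; rewrite (rep_U (hp s (ltW s0))).
  apply: (near_time_eq s0 (f := fun r => ly (X r) xi)); last exact: ly_curve.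
  by move=> r r0; rewrite (rep_y (hp r r0)).
- move=> s xi s0; rewrite -(rep_Q (hp s (ltW s0))).
  apply: (near_time_eq s0 (f := fun r => lU (X r) xi)); last exact: lU_curve.
  by move=> r r0; rewrite (rep_U (hp r r0)).
- move=> s a b s0 ab ba; rewrite -(rep_energy (hp s (ltW s0)) ab).
  have abP : ((a, b).1 <= (a, b).2) && ((a, b).2 <= (a, b).1 + 1) by rewrite ab.
  have h := time_deriv_is_derive s0 ((h_curve (ltW s0)).1 (exist _ (a, b) abP)).
  by apply: near_time_eq s0 _ h => r r0; rewrite (rep_H (hp r r0) ab).
Qed.

End SolutionEvolution.

(** * Initial data *)

Section InitialData.
Context {R : realType}.
Implicit Types (f g u v w : R -> R) (a b c k x y xi t s B M e : R).
Local Notation leb := (@lebesgue_measure R).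

(** Far out, the integral of [c ^+ 2] over a unit segment is arbitrarily small, yet it equals
    [c ^+ 2]. *)
Lemma L2_cst_eq0 c : L2 (fun=> c : R) -> c = 0.
Proof.
move=> hc; have i := L2_sqr_integrable hc.
apply/eqP; rewrite -normr_le0; apply/ler_addgt0Pr => e e0; rewrite add0r.
have e2 : 0 < e ^+ 2 by rewrite exprn_gt0.
have [M hM] := tail_small (fun x => sqr_ge0 c) e2 i.
have MM : M <= M + 1 by rewrite lerDl.
have := hM M (lexx _); rewrite Rintegral_seg_cst// addrAC subrr add0r mulr1.
by rewrite -(real_normK (num_real c)) ler_sqr ?nnegrE ?(ltW e0).
Qed.

Lemma const_partE f k : L2 (fun x => f x - k) -> const_part f = k.
Proof.
move=> h; rewrite /const_part.
have /= h' := @xgetPex _ 0 [set k | L2 (fun x => f x - k)] (ex_intro _ k h).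
set k' := xget _ _ in h' *; apply/eqP; rewrite eq_sym -subr_eq0; apply/eqP/L2_cst_eq0.
by have := L2B h' h; congr L2; apply/funext => x; ring.
Qed.

Lemma const_part_ae f g : measurable_fun setT f -> measurable_fun setT g ->
  {ae leb, forall x, f x = g x} -> const_part f = const_part g.
Proof.
move=> mf mg fg; rewrite /const_part; congr xget; apply/funext => k; apply/propext.
have fF := ae_filter_ringOfSetsType leb.
have mk u : measurable_fun setT u -> measurable_fun setT (fun x => u x - k).
  by move=> mu; apply: measurable_funB.
by split; apply: L2_ae; (try exact: mk); apply: filterS fg => x ->.
Qed.

Section Ly.
Implicit Types mu nu : {finite_measure set (measurableTypeR R) -> \bar R}.

Lemma L_y_set mu xi : [set y : R | (mu `]-oo, y[%classic + y%:E < xi%:E)%E] !=set0 /\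
  has_ubound [set y : R | (mu `]-oo, y[%classic + y%:E < xi%:E)%E].
Proof.
have fin : mu setT \is a fin_num by exact: fin_num_measure.
split.
  exists (xi - fine (mu setT) - 1) => /=.
  apply: (@le_lt_trans _ _ (mu setT + (xi - fine (mu setT) - 1)%:E)%E).
    rewrite leeD2r//; apply: le_measure; rewrite ?inE//.
  rewrite -(fineK fin) -EFinD lte_fin; lra.
exists xi => y /= h; rewrite -lee_fin ltW//; apply: le_lt_trans h.
by rewrite leeDr// measure_ge0.
Qed.

(** If [y] is admissible for [mu] then [y - e] is for [nu]: moving left by [e] compensates for the
    mass that [nu] may have in excess. *)
Lemma L_y_le mu nu e : 0 <= e ->
  (forall y, (nu `]-oo, y[%classic <= mu `]-oo, y[%classic + e%:E)%E) ->
  forall xi, L_y mu xi <= L_y nu xi + e.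
Proof.
move=> e0 h xi; have [n1 b1] := L_y_set mu xi; have [n2 b2] := L_y_set nu xi.
apply: ge_sup => // y /= hy; rewrite -lerBlDr; apply: (ub_le_sup b2) => /=.
apply: le_lt_trans hy; apply: (@le_trans _ _ (mu `]-oo, (y - e)%R[%classic + e%:E + (y - e)%:E)%E).
  by rewrite leeD2r.
rewrite -addeA -EFinD (addrC e) subrK leeD2r//; apply: le_measure; rewrite ?inE//.
by apply: subset_itvl; rewrite bnd_simp; lra.
Qed.

Lemma density_le mu nu f g (D : R -> R) e : has_density mu f -> has_density nu g ->
  measurable_fun setT f -> measurable_fun setT g -> measurable_fun setT D ->
  (forall x, 0 <= f x) -> (forall x, 0 <= g x) -> (forall x, 0 <= D x) ->
  (forall x, f x <= g x + D x) -> (\int[leb]_x (D x)%:E <= e%:E)%E ->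
  forall A : set (measurableTypeR R), measurable A -> (mu A <= nu A + e%:E)%E.
Proof.
move=> hf hg mf mg mD f0 g0 D0 fgD De A mA; rewrite (hf A mA) (hg A mA).
have mE u : measurable_fun setT u -> measurable_fun A (fun x => (u x)%:E).
  by move=> mu'; apply/measurable_EFinR; exact: measurable_funTS.
apply: (@le_trans _ _ (\int[leb]_(x in A) ((g x)%:E + (D x)%:E))%E).
  apply: ge0_le_integral => //.
  - by move=> x _; rewrite lee_fin.
  - exact: mE.
  - by apply: emeasurable_funD; exact: mE.
  - by move=> x _; rewrite -EFinD lee_fin.
rewrite ge0_integralD//; [|by move=> x _; rewrite lee_fin|exact: mE|by move=> x _;
  rewrite lee_fin|exact: mE].
rewrite leeD2l//; apply: le_trans De; apply: ge0_subset_integral => //.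
- exact/measurable_EFinR.
- by move=> x _; rewrite lee_fin.
Qed.

End Ly.

Lemma integral_comb (f1 f2 f3 : R -> R) (c1 c2 e1 e2 e3 : R) : 0 <= c1 -> 0 <= c2 ->
  measurable_fun setT f1 -> measurable_fun setT f2 -> measurable_fun setT f3 ->
  (\int[leb]_x ((f1 x) ^+ 2)%:E <= e1%:E)%E -> (\int[leb]_x ((f2 x) ^+ 2)%:E <= e2%:E)%E ->
  (\int[leb]_x ((f3 x) ^+ 2)%:E <= e3%:E)%E ->
  (\int[leb]_x (c1 * f1 x ^+ 2 + c2 * f2 x ^+ 2 + f3 x ^+ 2)%:E <= (c1 * e1 + c2 * e2 + e3)%:E)%E.
Proof.
move=> c10 c20 m1 m2 m3 h1 h2 h3.
have mE u : measurable_fun setT u -> measurable_fun setT (fun x => (u x ^+ 2)%:E : \bar R).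
  by move=> mu; apply/measurable_EFinR; exact: measurable_funX.
have g0 u x : (0 <= (u x ^+ 2)%:E)%E by rewrite lee_fin sqr_ge0.
have -> : (\int[leb]_x (c1 * f1 x ^+ 2 + c2 * f2 x ^+ 2 + f3 x ^+ 2)%:E =
    \int[leb]_x (c1%:E * (f1 x ^+ 2)%:E + c2%:E * (f2 x ^+ 2)%:E + (f3 x ^+ 2)%:E))%E.
  by apply: eq_integral => x _; rewrite 2!EFinD (EFinM c1) (EFinM c2).
have k1 x : (0 <= c1%:E * (f1 x ^+ 2)%:E)%E by rewrite mule_ge0.
have k2 x : (0 <= c2%:E * (f2 x ^+ 2)%:E)%E by rewrite mule_ge0.
have n1 : measurable_fun setT (fun x => c1%:E * (f1 x ^+ 2)%:E)%E.
  by apply: measurable_funeM; exact: mE.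
have n2 : measurable_fun setT (fun x => c2%:E * (f2 x ^+ 2)%:E)%E.
  by apply: measurable_funeM; exact: mE.
rewrite ge0_integralD//; [|by move=> x _; rewrite adde_ge0|exact: emeasurable_funD|exact: mE].
rewrite ge0_integralD// ge0_integralZl//; last exact: mE.
rewrite ge0_integralZl//; last exact: mE.
by rewrite !EFinD !EFinM !leeD// lee_wpmul2l.
Qed.

Lemma L2_density (mu : {finite_measure set (measurableTypeR R) -> \bar R}) f g :
  has_density mu (fun x => f x ^+ 2 + g x ^+ 2) -> measurable_fun setT f ->
  measurable_fun setT g -> L2 f.
Proof.
move=> h mf mg; apply: L2_intro => //.
apply: (@le_lt_trans _ _ (mu setT)).
  rewrite (h _ measurableT); apply: le_integral_EFin => [||y|y].
  - exact: measurable_funX.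
  - by apply: measurable_funD; exact: measurable_funX.
  - exact: sqr_ge0.
  - by rewrite lerDl sqr_ge0.
by rewrite ltey_eq fin_num_measure.
Qed.

(** By weighted AM-GM an increment is at most half of [m * |x - y| + J / m]. The choice of [m] makes
    the second term at most [e], and then [d = e / m] does so for the first. *)
Lemma uniformly_continuous_primitive f g : locally_integrable setT g -> L2 g -> primitive f g ->
  forall e, 0 < e -> exists2 d : R, 0 < d & forall x y, `|x - y| <= d -> `|f x - f y| <= e.
Proof.
move=> lg hg fg e e0; have i2 := L2_sqr_integrable hg.
pose J : R := \int[leb]_(x in setT) (g x ^+ 2).
have J0 : 0 <= J by apply: Rintegral_ge0 => x _; exact: sqr_ge0.
pose m : R := (J + 1) / e; have m0 : 0 < m by rewrite divr_gt0// ltr_wpDl.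
exists (e / m); first by rewrite divr_gt0.
move=> x y; wlog xy : x y / x <= y.
  by move=> H; have [/H//|/ltW/H] := leP x y; rewrite distrC [`|f y - f x|]distrC.
rewrite distrC [`|f x - f y|]distrC ger0_norm ?subr_ge0// => xd.
have ig := locint_seg x y lg.
have i2' : leb.-integrable `[x, y] (EFin \o (fun z => g z ^+ 2)) by apply: integrableS i2.
have i3 : leb.-integrable `[x, y] (EFin \o (fun z => 2^-1 * (m + m^-1 * g z ^+ 2))).
  apply: integrableZR => //; apply: integrableDR => //; first exact: bmeas_itv (bmeas_cst m).
  exact: integrableZR.
rewrite fg//; apply: (le_trans (le_normr_Rintegral _ ig)) => //.
apply: (@le_trans _ _ (\int[leb]_(z in `[x, y]) (2^-1 * (m + m^-1 * g z ^+ 2)))).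
  apply: le_Rintegral => //; first exact: integrable_normR.
  by move=> z _; exact: norm_le_amgm.
have i4 : leb.-integrable `[x, y] (EFin \o (fun z => m^-1 * g z ^+ 2)) by exact: integrableZR.
have i5 : leb.-integrable `[x, y] (EFin \o (fun=> m)) by exact: bmeas_itv (bmeas_cst m).
rewrite RintegralZl//; last exact: integrableDR.
rewrite RintegralD// Rintegral_seg_cst// RintegralZl//.
have JJ : \int[leb]_(z in `[x, y]) (g z ^+ 2) <= J.
  rewrite /J /Rintegral fine_le//.
  - exact: integrable_fin_num.
  - exact: integrable_fin_num.
  apply: ge0_subset_integral => //; first by case/integrableP : i2.
  by move=> z _; rewrite lee_fin sqr_ge0.
have h1 : m * (y - x) <= e by rewrite -ler_pdivlMl// mulrC.
have h2 : m^-1 * \int[leb]_(z in `[x, y]) (g z ^+ 2) <= e.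
  rewrite ler_pdivrMl// (le_trans JJ)// /m divfK ?gt_eqF// lerDl//.
by rewrite ler_pdivrMl// mulr_natl mulr2n lerD.
Qed.

(** * The space [H_oo]: asymptotes, weak derivatives and norm estimates *)

Section CutoffSpaces.
Variable chi : R -> R.
Hypothesis cchi : cutoff chi.

Lemma Hinf_coefP v : Hinf chi v -> H1 (Hinf_bar chi v (Hinf_coef chi v)).
Proof. by move=> h; exact: (@xgetPex _ (0, 0) [set c | H1 (Hinf_bar chi v c)] h). Qed.

Lemma HinfB u v : Hinf chi u -> Hinf chi v -> Hinf chi (fun x => u x - v x).
Proof.
move=> [c hc] [c' hc']; exists (c.1 - c'.1, c.2 - c'.2).
by have := H1B hc hc'; congr H1; apply/funext => x; rewrite /Hinf_bar/=; ring.
Qed.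

(** Reads [c_+] off the values near plus infinity, so that uniform closeness of two functions forces
    closeness of their constants. *)
Lemma Hinf_lim v : Hinf chi v -> forall e, 0 < e ->
  exists M : R, forall x, M <= x -> `|v x - (Hinf_coef chi v).2| <= e.
Proof.
move=> /Hinf_coefP hv e e0; have [M hM] := H1_vanish cchi hv e0.
case: cchi => _ _ chi1 _.
exists (Num.max M 1) => x; rewrite ge_max => /andP[Mx x1].
have := hM x Mx; rewrite /Hinf_bar (chi1 x)// mulr1 (cutoff_le0 cchi) ?mulr0 ?subr0//.
by rewrite oppr_le0 (le_trans ler01).
Qed.

Lemma cutoffN_is_derive x : is_derive x (1 : R) (fun z => chi (- z)) (- derive1 chi (- x)).
Proof.
have h := cutoff_is_derive cchi (- x).
have h2 : is_derive x (1 : R) (fun z : R => - z) (-1) by apply: is_derive_eq.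
by have := @is_derive1_comp R chi (fun z => - z) x _ _ h h2; rewrite mulrN1.
Qed.

Lemma cutoffN_derive1 : derive1 (fun z => chi (- z)) = fun x => - derive1 chi (- x).
Proof.
by apply/funext => x; rewrite derive1E; have := cutoffN_is_derive x => h; rewrite derive_val.
Qed.

Lemma cutoffN_cont1 : continuous (fun x => - derive1 chi (- x)).
Proof.
move=> x; apply: cvgN; apply: (@continuous_comp _ _ _ (fun z : R => - z) (derive1 chi)).
  by apply: cvgN; exact: cvg_id.
exact: cutoff_cont1.
Qed.

Lemma Hinf_weak v (c := Hinf_coef chi v) : Hinf chi v ->
  weak_derivative v (fun x => wd (Hinf_bar chi v c) x + c.1 * (- derive1 chi (- x)) + c.2 *
    derive1 chi x).
Proof.
move=> hv; have hb := Hinf_coefP hv; have [wb _ _ _] := H1_wd cchi hb.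
have vE : v = fun x => Hinf_bar chi v c x + c.1 * chi (- x) + c.2 * chi x.
  by apply/funext => x; rewrite /Hinf_bar; ring.
rewrite [X in weak_derivative X]vE; apply: weak_derivativeD.
  apply: weak_derivativeD; first exact: wb.
  apply: weak_derivativeZ; rewrite -cutoffN_derive1; apply: weak_derivative_C1.
    by move=> x; have [] := cutoffN_is_derive x.
  by rewrite cutoffN_derive1; exact: cutoffN_cont1.
apply: weak_derivativeZ; apply: weak_derivative_C1; last exact: cutoff_cont1.
by move=> x; have [] := cutoff_is_derive cchi x.
Qed.

Lemma Hinf_wd v : Hinf chi v -> weak_derivative v (wd v).
Proof. by move=> hv; apply: wdP; eexists; exact: Hinf_weak. Qed.

Lemma Hinf_norm_le v (n : R) : (Hinf_norm chi v <= n%:E)%E ->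
  [/\ (H1_norm (Hinf_bar chi v (Hinf_coef chi v)) <= n%:E)%E,
     `|(Hinf_coef chi v).1| <= n & `|(Hinf_coef chi v).2| <= n].
Proof.
rewrite /Hinf_norm; set c := Hinf_coef chi v.
have H0 : (0 <= H1_norm (Hinf_bar chi v c))%E by exact: poweR_ge0.
move: H0; set A := H1_norm _ => A0 h.
split.
- by apply: le_trans h; rewrite -addeA leeDl// adde_ge0.
- by rewrite -lee_fin; apply: le_trans h; rewrite addeAC leeDr// adde_ge0.
- by rewrite -lee_fin; apply: le_trans h; rewrite leeDr// adde_ge0.
Qed.

Lemma Hinf_sup v (n : R) x : Hinf chi v -> 0 <= n -> (Hinf_norm chi v <= n%:E)%E -> `|v x| <= 4 * n.
Proof.
move=> hv n0 /Hinf_norm_le[h1 h2 h3]; set c := Hinf_coef chi v in h1 h2 h3.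
have hb := H1_sup cchi x (Hinf_coefP hv) n0 h1.
have -> : v x = Hinf_bar chi v c x + c.1 * chi (- x) + c.2 * chi x by rewrite /Hinf_bar; ring.
have k1 : `|c.1 * chi (- x)| <= n * 1 by rewrite normrM ler_pM// cutoff_norm.
have k2 : `|c.2 * chi x| <= n * 1 by rewrite normrM ler_pM// cutoff_norm.
apply: le_trans (ler_normD _ _) _; have := ler_normD (Hinf_bar chi v c x) (c.1 * chi (- x)).
move: hb; rewrite -/c; lra.
Qed.

Lemma L2_bump f : continuous f -> (forall x, 1 < `|x| -> f x = 0) -> L2 f.
Proof.
move=> cf f0; have [C hC] := support_bounded cf f0.
have mf : measurable_fun setT f by exact: continuous_measurable_fun.
apply: L2_intro => //; have := test_integrable (continuous_locint cf) cf (ex_intro _ 1 f0).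
rewrite (_ : (fun x => f x * f x) = fun x => f x ^+ 2); last by apply/funext => x; rewrite expr2.
move=> /integrableP[_]; apply: le_lt_trans; apply: ge0_le_integral => //.
- by move=> x _; rewrite lee_fin sqr_ge0.
- by apply/measurable_EFinR; exact: measurable_funX.
- by apply: measurableT_comp => //; apply/measurable_EFinR; exact: measurable_funX.
- by move=> x _ /=; rewrite lee_fin ler_norm.
Qed.

Lemma derive1_cutoff_supp x : 1 < `|x| -> derive1 chi x = 0.
Proof.
move=> hx; rewrite -derive1n1 (cutoff_d0 cchi)//.
by have [x0|x0] := leP 0 x; [right; rewrite ger0_norm in hx|left].
Qed.

(** Up to a null set [wd v] is the sum of an [L^2] part and of two fixed compactly supported
    functions weighted by [c_-] and [c_+]; [q1] and [q2] bound the [L^2] norms of the latter. *)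
Lemma Hinf_wd_sqr : exists2 K : R, 0 <= K & forall v (n : R), Hinf chi v -> 0 <= n ->
  (Hinf_norm chi v <= n%:E)%E -> (\int[leb]_x ((wd v x) ^+ 2)%:E <= (K * n ^+ 2)%:E)%E.
Proof.
have [q1 q10 hq1] := L2_bound (L2_bump (cutoff_cont1 cchi) derive1_cutoff_supp).
have sN x : 1 < `|x| -> - derive1 chi (- x) = 0.
  by move=> x1; rewrite derive1_cutoff_supp ?oppr0 ?normrN.
have [q2 q20 hq2] := L2_bound (L2_bump cutoffN_cont1 sN).
exists (3 * q2 ^+ 2 + 3 * q1 ^+ 2 + 4) => [|v n hv n0 /Hinf_norm_le[h1 h2 h3]].
  by rewrite !addr_ge0 ?mulr_ge0 ?sqr_ge0.
set c := Hinf_coef chi v in h1 h2 h3.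
have hb := Hinf_coefP hv; have [wb lb _ L2b] := H1_wd cchi hb.
have [_ lw _] := Hinf_wd hv; have mw := locint_meas lw; have mb := locint_meas lb.
have ae := weak_derivative_unique cchi (Hinf_cont cchi hv) (Hinf_wd hv) (Hinf_weak hv).
have m1 : measurable_fun setT (derive1 chi).
  by apply: continuous_measurable_fun; exact: cutoff_cont1.
have m2 : measurable_fun setT (fun x => - derive1 chi (- x)).
  by apply: continuous_measurable_fun; exact: cutoffN_cont1.
(* The square of a sum of three terms is at most three times the sum of squares. In [integral_comb]
   the last function carries no coefficient, so a weight 4, above 3, is hidden in the factor 2. *)
have hb2 : (\int[leb]_x ((2 * wd (Hinf_bar chi v c) x) ^+ 2)%:E <= (4 * n ^+ 2)%:E)%E.
  have -> : (\int[leb]_x ((2 * wd (Hinf_bar chi v c) x) ^+ 2)%:E =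
      \int[leb]_x (4%:E * ((wd (Hinf_bar chi v c) x) ^+ 2)%:E))%E.
    by apply: eq_integral => x _; rewrite -EFinM; congr EFin; ring.
  rewrite ge0_integralZl//; [|by apply/measurable_EFinR; exact: measurable_funX|by move=> x _;
    rewrite lee_fin sqr_ge0].
  rewrite EFinM lee_wpmul2l//; move: h1; rewrite H1_norm_le//; apply: le_trans.
  apply: le_integral_EFin => [||y|y]; first exact: measurable_funX.
  - apply: measurable_funD; last exact: measurable_funX.
    by apply: measurable_funX; case: hb => _ /L2_meas.
  - exact: sqr_ge0.
  - by rewrite lerDr sqr_ge0.
have c10 : 0 <= 3 * c.1 ^+ 2 by rewrite mulr_ge0 ?sqr_ge0.
have c20 : 0 <= 3 * c.2 ^+ 2 by rewrite mulr_ge0 ?sqr_ge0.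
have m3 : measurable_fun setT (fun x => 2 * wd (Hinf_bar chi v c) x) by exact: measurable_funM.
have H := integral_comb c10 c20 m2 m1 m3 hq2 hq1 hb2.
pose G x : R := wd (Hinf_bar chi v c) x + c.1 * - derive1 chi (- x) + c.2 * derive1 chi x.
have mG : measurable_fun setT G.
  by do 2 (apply: measurable_funD => //; last exact: measurable_funM).
have -> : (\int[leb]_x ((wd v x) ^+ 2)%:E = \int[leb]_x ((G x) ^+ 2)%:E)%E.
  apply: ae_eq_integral => //; try by apply/measurable_EFinR; exact: measurable_funX.
  by apply: filterS ae => [|x /= -> //]; exact: (ae_filter_ringOfSetsType leb).
apply: (@le_trans _ _ (3 * c.1 ^+ 2 * q2 ^+ 2 + 3 * c.2 ^+ 2 * q1 ^+ 2 + 4 * n ^+ 2)%:E);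
  last first.
  have s1 : c.1 ^+ 2 <= n ^+ 2 by rewrite -(real_normK (num_real c.1)) lerXn2r ?nnegrE.
  have s2 : c.2 ^+ 2 <= n ^+ 2 by rewrite -(real_normK (num_real c.2)) lerXn2r ?nnegrE.
  have := ler_wpM2r (sqr_ge0 q2) s1; have := ler_wpM2r (sqr_ge0 q1) s2.
  rewrite lee_fin; move: (q1 ^+ 2) (q2 ^+ 2) (c.1 ^+ 2) (c.2 ^+ 2) (n ^+ 2).
  by clear => *; lra.
apply: le_trans H; apply: le_integral_EFin => [||x|x]; first exact: measurable_funX.
- apply: measurable_funD; last exact: measurable_funX.
  by apply: measurable_funD; apply: measurable_funM => //; exact: measurable_funX.
- exact: sqr_ge0.
- rewrite /G; move: (wd _ x) (- derive1 chi (- x)) (derive1 chi x) => w u1 u2.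
  have := sqr_ge0 (c.1 * u1 - c.2 * u2); have := sqr_ge0 (w - c.1 * u1);
    have := sqr_ge0 (w - c.2 * u2).
  by have := sqr_ge0 w; nra.
Qed.

End CutoffSpaces.
End InitialData.

(** * Convergence in Eulerian coordinates *)

Section Convergence.
Context {R : realType}.
Implicit Types (f g u v w : R -> R) (a b c k x y xi t s B M e : R).
Local Notation leb := (@lebesgue_measure R).
Local Notation radon := {finite_measure set (measurableTypeR R) -> \bar R}.
Variable chi : R -> R.
Hypothesis cchi : cutoff chi.
Local Notation evol := (evolution chi (g_chi chi) (derive1 (g_chi chi))).

(** Collects what the comparison takes from [T_t]: the data produced by [L], the right asymptote of
    [U], and the relation between [u(t)] and the state at time [t]. The constant [k] is read from
    any measurable representative of [r], since [const_part] ignores null sets. *)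
Lemma semigroup_evolution t u0 rho0 (mu0 : radon) d : 0 <= t ->
  semigroup_T chi t (Eul u0 rho0 mu0) d ->
  exists p, [/\ evol p,
    [/\ py (p 0) = L_y mu0, forall x, pU (p 0) x = u0 (L_y mu0 x) &
      forall a b, a <= b -> pH (p 0) b - pH (p 0) a = (b - a) - (L_y mu0 b - L_y mu0 a)],
    forall e, 0 < e -> exists M, forall x, M <= x -> `|pU (p 0) x - pc (p 0)| <= e,
    forall xi, eu d (py (p t) xi) = pU (p t) xi &
    forall f, measurable_fun setT f ->
      {ae leb, forall xi, rho0 (L_y mu0 xi) * wd (L_y mu0) xi = f xi} ->
      pk (p 0) = const_part f].
Proof.
move=> t0 [Y [X [HX eX0 eXt]] [_ hM _ _]].
have [p evp hp] := solution_evolution cchi HX.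
have [e1 e2 e3 e4 e5] := hp 0 (lexx 0); have [e1t e2t _ _ _] := hp t t0.
have [z1 z2 z3 z4] := eX0; have [w1 w2 _ _] := eXt.
have G := solution_G HX (lexx 0).
have yE : ly (X 0) = L_y mu0.
  by apply/funext => xi; rewrite /ly z1 /= addrC subrK.
exists p; split => //.
- split; first by rewrite e1.
    by move=> x; rewrite e2 z2.
  move=> a b ab; rewrite e5//; have lw := ly_weak G; have [_ li _] := lw.
  have my := ly_xi_meas G.
  rewrite (Rintegral_ae _ (lh_meas G) (g := fun x => 1 - ly_xi (X 0) x))//; last 2 first.
  + exact: measurable_funB.
  + by apply: filterS z3 => [|x /= ->]; [exact: (ae_filter_ringOfSetsType leb)|rewrite /ly_xi yE].
  rewrite RintegralB//; [|exact: bmeas_itv (bmeas_cst 1)|exact: locint_seg].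
  rewrite Rintegral_seg_cst// mul1r -(weak_derivative_FTC cchi (ly_cont G) lw)//.
  by rewrite yE.
- move=> e e0; case: G => -[_ [hU _] _ _] _ _ _.
  by have := Hinf_lim cchi hU e0; rewrite e2 e3.
- by move=> xi; rewrite e1t e2t /ly w1 w2; exact: hM.
- move=> f mf ae; rewrite e4 /lk; apply: const_part_ae => //.
    by case: G => _ _ [_ /Linf_meas].
  have fF := ae_filter_ringOfSetsType leb.
  by apply: filterS2 z4 ae => x /= -> ->.
Qed.

(** At [t = 0] the state goes straight from [L] to [M], and the decomposition [rho = k + rhobar] in
    [M] identifies the constant. This avoids a change of variables in [rho0 (y) * y_xi]. *)
Lemma semigroup_const_part u0 rho0 (mu0 : radon) d :
  semigroup_T chi 0 (Eul u0 rho0 mu0) d ->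
  exists f, [/\ measurable_fun setT f,
    {ae leb, forall xi, rho0 (L_y mu0 xi) * wd (L_y mu0) xi = f xi} &
    const_part f = const_part (erho d)].
Proof.
move=> [Y [X [HX [_ _ _ z4] [_ _ _ w4]]] [[GY _] _ _ [rb [hrb hk _]]]].
exists (lr Y); split.
- by case: GY => _ _ [_ /Linf_meas].
- have fF := ae_filter_ringOfSetsType leb.
  by apply: filterS2 z4 w4 => x /= -> ->.
- rewrite -/(lk Y); apply/esym/const_partE.
  by move: hrb; congr L2; apply/funext => x; rewrite hk addrC addKr.
Qed.

Lemma H_long B (p : @profile R) (n : nat) : admissible B p -> forall a b, a <= b -> b <= a + n%:R ->
  pH p b - pH p a <= n%:R * B.
Proof.
move=> pB; elim: n => [|n IH] a b ab ba.
  rewrite addr0 in ba; have -> : b = a by apply/eqP; rewrite eq_le ba ab.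
  by rewrite subrr mul0r.
have B0 : 0 <= B by exact: le_trans (adm_yB pB 0).
have [ba1|ba1] := leP b (a + 1).
  apply: le_trans (adm_HB pB ab ba1) _; rewrite -[leLHS]mul1r ler_wpM2r//.
  by rewrite ler1n.
have aa : a <= a + 1 by rewrite lerDl.
have h1 := adm_HB pB aa (lexx _).
have h2 : pH p b - pH p (a + 1) <= n%:R * B.
  by apply: IH; [exact: ltW|rewrite -addrA nat1r].
by rewrite -[n.+1%:R]natr1 mulrDl mul1r; lra.
Qed.

Lemma y_surjective B (p : @profile R) : admissible B p -> forall x, exists xi, py p xi = x.
Proof.
move=> pB x; have cy : {within `[x - B, x + B], continuous (py p)}.
  by apply: continuous_subspaceT; exact: y_cont pB.
have B0 : 0 <= B by exact: le_trans (adm_yB pB 0).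
have xB : x - B <= x + B by lra.
have /ler_normlP[h1 h2] := adm_yB pB (x - B); have /ler_normlP[h3 h4] := adm_yB pB (x + B).
have [|xi _ e] := IVT xB cy (v := x); last by exists xi.
by rewrite ge_min le_max; apply/andP; split; apply/orP; [left|right]; lra.
Qed.

(** [y] may be flat or nearly so, hence continuity of [U] in [xi] would not do: the modulus is with
    respect to [y], as the Eulerian function requires. *)
Lemma U_modulus B (p : @profile R) : admissible B p -> forall e, 0 < e ->
  exists2 d : R, 0 < d & forall x y, `|py p x - py p y| <= d -> `|pU p x - pU p y| <= e.
Proof.
move=> pB e e0; have B0 : 0 <= B by exact: le_trans (adm_yB pB 0).
(* Points whose images under [y] are within 1 lie at distance at most [1 + 2 * B], so [J] bounds the
   energy between them; [m] then makes [J / m] at most [e]. *)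
pose n := (Num.truncn (1 + 2 * B)).+1; pose J : R := n%:R * B.
have J0 : 0 <= J by rewrite mulr_ge0.
pose m : R := (J + 1) / e; have m0 : 0 < m by rewrite divr_gt0// ltr_wpDl.
exists (Num.min 1 (e / m)); first by rewrite lt_min ltr01 divr_gt0.
move=> x y; wlog xy : x y / x <= y.
  by move=> H; have [/H//|/ltW/H] := leP x y; rewrite distrC [`|pU p y - pU p x|]distrC.
rewrite le_min distrC [`|pU p x - _|]distrC ger0_norm ?(y_incr pB)// => /andP[d1 dm].
have yx : y <= x + n%:R.
  have hn : 1 + 2 * B <= n%:R by rewrite ltW// Num.Theory.truncnS_gt.
  have /ler_normlP[h1 h2] := adm_yB pB x; have /ler_normlP[h3 h4] := adm_yB pB y; lra.
have hH := H_long pB xy yx.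
(* AM-GM and the energy identity *)
have am (z : R) : `|pUx p z| <= 2^-1 * (m * pyx p z + m^-1 * ph p z).
  have h0 := adm_h0 pB z; have y0 := adm_yx0 pB z; have en := adm_energy pB z.
  have hs : 0 <= m * pyx p z + m^-1 * ph p z by rewrite addr_ge0// mulr_ge0// ?invr_ge0 ltW.
  rewrite -ler_sqr ?nnegrE ?normr_ge0// ?mulr_ge0// real_normK ?num_real//.
  have mm : (m * pyx p z) * (m^-1 * ph p z) = pyx p z * ph p z.
    by rewrite mulrACA mulfV ?gt_eqF// mul1r.
  have := sqr_ge0 (m * pyx p z - m^-1 * ph p z); have := sqr_ge0 (prb p z).
  move: mm; move: (m * pyx p z) (m^-1 * ph p z) => a b; rewrite en => ab; nra.
have by1 := adm_yx pB; have bh := adm_h pB.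
rewrite (adm_U pB)//; apply: (@le_trans _ _ (\int[leb]_(z in `[x, y]) (2^-1 * (m * pyx p z + m^-1
  * ph p z)))).
  apply: norm_Rintegral_seg => //; first exact: adm_Ux pB.
  by apply: bmeasZ; apply: bmeasD; exact: bmeasZ.
rewrite Rintegral_segZ; last by apply: bmeasD; exact: bmeasZ.
rewrite Rintegral_segD; [|exact: bmeasZ|exact: bmeasZ]; rewrite !Rintegral_segZ//.
rewrite -(adm_y pB)// -(adm_H pB)//.
have h1 : m * (py p y - py p x) <= e by rewrite -ler_pdivlMl// mulrC.
have h2 : m^-1 * (pH p y - pH p x) <= e.
  by rewrite ler_pdivrMl// (le_trans hH)// /m divfK ?gt_eqF// lerDl.
by rewrite ler_pdivrMl// mulr_natl mulr2n lerD.
Qed.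

(** Choose [xi] and [eta] with [py p xi = x = py q eta]. Then [py q xi] is within [d] of [py q eta],
    and the modulus of continuity involved is that of [q] alone, so [d] does not depend on [p]. *)
Lemma close_eulerian B (q : @profile R) : admissible B q -> forall e, 0 < e ->
  exists2 d : R, 0 < d & forall (p : @profile R) u v B', admissible B' p -> profile_close d p q ->
    (forall xi, u (py p xi) = pU p xi) -> (forall xi, v (py q xi) = pU q xi) ->
    forall x, `|u x - v x| <= e.
Proof.
move=> qB e e0; have e2 : 0 < e / 2 by rewrite divr_gt0.
have [d d0 hd] := U_modulus qB e2.
exists (Num.min d (e / 2)) => [|p u v B' pB cl hu hv x]; first by rewrite lt_min d0.
have [xi <-] := y_surjective pB x; have [eta he] := y_surjective qB (py p xi).
rewrite hu -he hv (_ : _ - _ = (pU p xi - pU q xi) + (pU q xi - pU q eta)); last by ring.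
apply: le_trans (ler_normD _ _) _; rewrite [leRHS]splitr; apply: lerD.
  by apply: le_trans (close_U cl xi) _; rewrite ge_min lexx orbT.
apply: hd; rewrite he distrC; apply: le_trans (close_y cl xi) _.
by rewrite ge_min lexx.
Qed.

End Convergence.

(** * Closeness of the Lagrangian initial data *)

Section InitialProfiles.
Context {R : realType}.
Implicit Types (f g u v w : R -> R) (a b c k x y xi t s B M e : R).
Local Notation leb := (@lebesgue_measure R).
Local Notation radon := {finite_measure set (measurableTypeR R) -> \bar R}.
Variable chi : R -> R.
Hypothesis cchi : cutoff chi.

(** Young's inequality with a free weight: [l] is fixed first, to make the term with the limit [a]
    small, and the difference [b - a] then absorbs the large factor [1 + l^-1]. *)
Lemma sqr_perturbation (l a b : R) : 0 < l ->
  `|b ^+ 2 - a ^+ 2| <= l * a ^+ 2 + (1 + l^-1) * (b - a) ^+ 2.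
Proof.
move=> l0; have li : 0 <= l^-1 by rewrite invr_ge0 ltW.
have cross c : 2 * (a * c) <= l * a ^+ 2 + l^-1 * c ^+ 2.
  have := mulr_ge0 li (sqr_ge0 (l * a - c)).
  have -> : l^-1 * (l * a - c) ^+ 2 =
    l^-1 * l * l * a ^+ 2 - 2 * (l^-1 * l) * a * c + l^-1 * c ^+ 2 by ring.
  rewrite mulVf ?gt_eqF// !mul1r !mulr1 -mulrA; lra.
have := cross (b - a); have := cross (- (b - a)); rewrite sqrrN (mulrDl 1 l^-1) mul1r ler_norml.
move: (l * a ^+ 2) (l^-1 * _) => z1 z2; have := sqr_ge0 (b - a) => *.
by apply/andP; split; nra.
Qed.

Lemma initial_close u0 (mu0 : radon) : Hinf chi u0 -> has_density mu0 (fun x => wd u0 x ^+ 2) ->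
  forall e, 0 < e -> exists2 n : R, 0 < n &
  forall v rho (mu : radon) (p q : @profile R), Hinf chi v -> L2const rho ->
    (Hinf_norm chi (fun x => v x - u0 x)%R <= n%:E)%E -> (L2const_norm rho <= n%:E)%E ->
    has_density mu (fun x => wd v x ^+ 2 + L2_part rho x ^+ 2) ->
    py p = L_y mu -> py q = L_y mu0 ->
    (forall x, pU p x = v (L_y mu x)) -> (forall x, pU q x = u0 (L_y mu0 x)) ->
    (forall a b, a <= b -> pH p b - pH p a = (b - a) - (L_y mu b - L_y mu a)) ->
    (forall a b, a <= b -> pH q b - pH q a = (b - a) - (L_y mu0 b - L_y mu0 a)) ->
    (forall e, 0 < e -> exists M, forall x, M <= x -> `|pU p x - pc p| <= e) ->
    (forall e, 0 < e -> exists M, forall x, M <= x -> `|pU q x - pc q| <= e) ->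
    pk p = const_part rho -> pk q = 0 -> profile_close e p q.
Proof.
move=> hu0 hmu0 e e0.
have wu := Hinf_wd cchi hu0; have [_ lu _] := wu; have mu_w := locint_meas lu.
have Lw : L2 (wd u0).
  apply: (@L2_density _ mu0 (wd u0) (cst 0)) => //.
  by move=> A mA; rewrite hmu0//; apply: eq_integral => x _; rewrite expr0n/= addr0.
have [W W0 hW] := L2_bound Lw.
have [K K0 hK] := Hinf_wd_sqr cchi.
have e2 : 0 < e / 2 by rewrite divr_gt0.
have fu := weak_derivative_FTC cchi (Hinf_cont cchi hu0) wu.
have [d d0 hd] := uniformly_continuous_primitive lu Lw fu e2.
(* The target accuracy for [L_y]: [e / 2] suffices for [y] and for increments of the energy, and [d]
   controls the resulting shift in the argument of [u0]. *)
pose e1 : R := Num.min (e / 2) d; have e10 : 0 < e1 by rewrite lt_min e2.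
pose W1 : R := W ^+ 2 + 1; have W10 : 0 < W1 by rewrite ltr_wpDl// sqr_ge0.
(* Makes [l * W ^+ 2] at most [e1 / 3], with [W] bounding the [L^2] norm of [wd u0]. *)
pose l : R := e1 / 3 / W1; have l0 : 0 < l by rewrite !divr_gt0.
pose K1 : R := (1 + l^-1) * K + 1.
have li0 : 0 <= l^-1 by rewrite invr_ge0 ltW.
have K10 : 0 < K1 by rewrite ltr_wpDl// mulr_ge0// addr_ge0.
(* [n <= 1] gives [n ^+ 2 <= n]; [e / 8] turns the factor 4 of [Hinf_sup] into [e / 2]; the last
   entry keeps the terms with [wd v - wd u0] and [rho] below [e1 / 3]. *)
pose n : R := Num.min 1 (Num.min (e / 8) (e1 / 3 / K1)).
have n0 : 0 < n by rewrite !lt_min ltr01 !divr_gt0.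
have n1 : n <= 1 by rewrite ge_min lexx.
have ne : n <= e / 8 by rewrite !ge_min lexx orbT.
have nK : n * K1 <= e1 / 3 by rewrite -ler_pdivlMr// !ge_min lexx !orbT.
exists n => // v rho mu p q hv [k0 hk0] hvu hrho hmu ep eq Up Uq Hp Hq cp cq kp kq.
have hr : L2 (L2_part rho) by exact: (@xgetPex _ 0 [set k | L2 (fun x => rho x - k)] (ex_intro _
  k0 hk0)).
have mr := L2_meas hr.
have hdiff := HinfB hv hu0; have wv := Hinf_wd cchi hv; have [_ lv _] := wv.
have mv := locint_meas lv.
have md : measurable_fun setT (fun x => wd v x - wd u0 x) by exact: measurable_funB.
have hd2 : (\int[leb]_x ((wd v x - wd u0 x) ^+ 2)%:E <= (K * n ^+ 2)%:E)%E.
  apply: le_trans (hK _ _ hdiff (ltW n0) hvu); rewrite le_eqVlt; apply/orP; left; apply/eqP.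
  have [_ ld _] := Hinf_wd cchi hdiff; have mdd := locint_meas ld.
  apply: ae_eq_integral => //; try by apply/measurable_EFinR; exact: measurable_funX.
  have := weak_derivative_unique cchi (Hinf_cont cchi hdiff) (weak_derivativeB wv wu) (Hinf_wd
    cchi hdiff).
  by apply: filterS => [|x /= -> //]; exact: (ae_filter_ringOfSetsType leb).
have [rn kn] : (\int[leb]_x ((L2_part rho x) ^+ 2)%:E <= (n ^+ 2)%:E)%E /\ `|const_part rho| <= n.
  have L0 : (0 <= L2_norm (L2_part rho))%E by exact: Lnorm_ge0.
  split; first by rewrite -L2_norm_le ?(ltW n0)//; apply: le_trans hrho; rewrite leeDl.
  by rewrite -lee_fin; apply: le_trans hrho; rewrite leeDr.
(* [D] bounds the difference of the two energy densities in both directions, and its integral is at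
   most [e1]; this gives the two comparisons of measures that [L_y_le] needs. *)
pose D x : R := l * wd u0 x ^+ 2 + (1 + l^-1) * (wd v x - wd u0 x) ^+ 2 + L2_part rho x ^+ 2.
have mD : measurable_fun setT D.
  apply: measurable_funD; last exact: measurable_funX.
  by apply: measurable_funD; apply: measurable_funM => //; exact: measurable_funX.
have l10 : 0 <= 1 + l^-1 by rewrite addr_ge0.
have D0 x : 0 <= D x.
  by rewrite /D addr_ge0 ?sqr_ge0// addr_ge0// mulr_ge0 ?sqr_ge0// ltW.
have iD : (\int[leb]_x (D x)%:E <= e1%:E)%E.
  apply: le_trans (integral_comb (ltW l0) l10 mu_w md mr hW hd2 rn) _.
  rewrite lee_fin.
  have h1 : l * W ^+ 2 <= e1 / 3.
    have : l * W1 = e1 / 3 by rewrite /l divfK// gt_eqF.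
    rewrite /W1 mulrDr mulr1; move: (l * W ^+ 2) => z; lra.
  have nn : n ^+ 2 <= n by rewrite expr2 ler_piMr// ltW.
  have h2 : (1 + l^-1) * (K * n ^+ 2) + n ^+ 2 <= e1 / 3.
    apply: le_trans nK; rewrite /K1 mulrDr mulr1 mulrA lerD// mulrC ler_wpM2r//.
    by rewrite mulr_ge0.
  move: h1 h2; move: (l * W ^+ 2) ((1 + l^-1) * (K * n ^+ 2)) (n ^+ 2) => z1 z2 z3 h1 h2.
  have := e10; lra.
have le1 x : wd v x ^+ 2 + L2_part rho x ^+ 2 <= wd u0 x ^+ 2 + D x.
  have /ler_normlP[_] := sqr_perturbation (wd u0 x) (wd v x) l0.
  by rewrite /D; move: (l * _) (_ * (_ - _) ^+ 2) => z1 z2; lra.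
have le2 x : wd u0 x ^+ 2 <= wd v x ^+ 2 + L2_part rho x ^+ 2 + D x.
  have := sqr_ge0 (L2_part rho x).
  have /ler_normlP[+ _] := sqr_perturbation (wd u0 x) (wd v x) l0.
  by rewrite /D; move: (l * _) (_ * (_ - _) ^+ 2) => z1 z2; lra.
have mf : measurable_fun setT (fun x => wd v x ^+ 2 + L2_part rho x ^+ 2).
  by apply: measurable_funD; exact: measurable_funX.
have mg : measurable_fun setT (fun x => wd u0 x ^+ 2) by exact: measurable_funX.
have f0 x : 0 <= wd v x ^+ 2 + L2_part rho x ^+ 2 by rewrite addr_ge0 ?sqr_ge0.
have g0 x : 0 <= wd u0 x ^+ 2 by exact: sqr_ge0.
have c1 := density_le hmu hmu0 mf mg mD f0 g0 D0 le1 iD.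
have c2 := density_le hmu0 hmu mg mf mD g0 f0 D0 le2 iD.
have yle x : `|L_y mu x - L_y mu0 x| <= e1.
  have h1 := @L_y_le _ mu0 mu e1 (ltW e10) (fun y => c1 _ (measurable_itv _)) x.
  have h2 := @L_y_le _ mu mu0 e1 (ltW e10) (fun y => c2 _ (measurable_itv _)) x.
  by rewrite ler_norml; apply/andP; split; lra.
have e1e : e1 <= e / 2 by rewrite ge_min lexx.
have e1d : e1 <= d by rewrite ge_min lexx orbT.
have Ule x : `|pU p x - pU q x| <= e.
  rewrite Up Uq (_ : _ - _ = (v (L_y mu x) - u0 (L_y mu x)) + (u0 (L_y mu x) - u0 (L_y mu0 x)));
    last by ring.
  have k1 := Hinf_sup cchi (L_y mu x) hdiff (ltW n0) hvu.
  have k2 := hd _ _ (le_trans (yle x) e1d).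
  apply: le_trans (ler_normD _ _) _; apply: le_trans (lerD k1 k2) _; lra.
split => //.
- by move=> x; rewrite ep eq; apply: le_trans (yle x) _; lra.
- move=> a b ab _; rewrite Hp// Hq//.
  have := yle a; have := yle b; rewrite !ler_norml => /andP[a1 a2] /andP[a3 a4].
  by apply/andP; split; lra.
(* The constants [c] are limits of [U] at plus infinity, so they inherit the bound on [U], up to an
   arbitrary [z]. *)
- apply/ler_addgt0Pr => z z0; have z2 : 0 < z / 2 by rewrite divr_gt0.
  have [M1 h1] := cp _ z2; have [M2 h2] := cq _ z2.
  pose x : R := Num.max M1 M2.
  have k1 := h1 x; have k2 := h2 x; have k3 := Ule x.
  have M1x : M1 <= x by rewrite le_max lexx.
  have M2x : M2 <= x by rewrite le_max lexx orbT.
  rewrite (_ : _ - _ = (pU p x - pU q x) + ((pU q x - pc q) - (pU p x - pc p))); last by ring.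
  apply: le_trans (ler_normD _ _) _; rewrite lerD//.
  apply: le_trans (ler_normB _ _) _; rewrite [leRHS]splitr lerD//; [exact: k2|exact: k1].
- by rewrite kp (le_trans kn)//; lra.
Qed.

End InitialProfiles.

Lemma cvge0_le {R : realType} (f : nat -> \bar R) : (forall n, 0 <= f n)%E ->
  (forall e : R, 0 < e -> \forall n \near \oo, (f n <= e%:E)%E) -> f n @[n --> \oo] --> 0%E.
Proof.
move=> f0 h; apply/fine_cvgP; split.
  by apply: filterS (h _ ltr01) => n; have := f0 n; case: (f n).
apply/cvgrPdist_le => e e0; apply: filterS (h _ e0) => n /=; have := f0 n.
case: (f n) => [r| |]//; rewrite !lee_fin => r0 re.
by rewrite sub0r normrN ger0_norm.
Qed.

Theorem theorem6p3 (R : realType) (chi : R -> R) (u0 : R -> R)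
    (u0n rho0n : nat -> R -> R)
    (mu0n : nat -> {finite_measure set (measurableTypeR R) -> \bar R})
    (un rhon : nat -> R -> R -> R) (u : R -> R -> R) :
  cutoff chi ->
  H0inf chi u0 ->
  (forall n, D_set chi (Eul (u0n n) (rho0n n) (mu0n n))) ->
  (forall n, smooth (u0n n)) ->
  Hinf_norm chi (fun x => u0n n x - u0 x) @[n --> \oo] --> 0%E ->
  (forall n, smooth (rho0n n)) ->
  L2const_norm (rho0n n) @[n --> \oo] --> 0%E ->
  (forall n, exists2 d : R, 0 < d & forall x, d <= rho0n n x ^+ 2) ->
  (forall n, has_density (mu0n n)
     (fun x => wd (u0n n) x ^+ 2 + L2_part (rho0n n) x ^+ 2)) ->
  (forall n, classical_solution (u0n n) (rho0n n) (un n) (rhon n)) ->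
  (forall n (t : R), 0 <= t -> exists mu,
     semigroup_T chi t (Eul (u0n n) (rho0n n) (mu0n n)) (Eul (un n t) (rhon n t) mu)) ->
  CH_conservative_solution chi u0 u ->
  forall t : R, 0 <= t ->
    Linf_norm (fun x => un n t x - u t x) @[n --> \oo] --> 0%E.
Proof.
move=> cchi [hu0 _] hD _ cvu _ cvr _ hdens hcl hT [mu0 hmu0 hCH] t t0.
have [rho [mu /(semigroup_evolution cchi t0)[q [evq [qy qU qH] qc qu qk]]]] := hCH t t0.
(* The limit starts from [rho = 0], so its Lagrangian [r] vanishes and so does its constant part, as
   [profile_close] demands of the reference. *)
have k0 : pk (q 0) = 0.
  have c0 : @const_part R (cst 0) = 0.
    apply: const_partE; have := L2_bump (@cst_continuous R R 0) (fun _ _ => erefl).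
    by congr L2; apply/funext => x; rewrite subr0.
  rewrite -[RHS]c0; apply: qk => //.
  by apply: nearW => x; rewrite mul0r.
have [X [X0 chiL gL gdL [gB gdB]]] := cutoff_constants cchi.
have [K K0 hK] := evolution_stability X0 (cutoff_norm cchi) chiL gL gdL gB gdB t0 evq k0.
have [B B1 admq] := ev_bound evq t0.
apply: cvge0_le => [n|e e0]; first exact: Lnorm_ge0.
have [d d0 hd] := close_eulerian admq e0.
(* The bound [eps * K] at time [t] must be at most 1 for the stability estimate and at most [d] for
   the passage to Eulerian variables. *)
pose eps : R := Num.min 1 d / K.
have eps0 : 0 < eps by rewrite divr_gt0// lt_min ltr01.
have epsK : eps * K = Num.min 1 d by rewrite /eps divfK// gt_eqF.
have [m m0 hm] := initial_close cchi hu0 hmu0 eps0.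
have n1 : \forall n \near \oo, (Hinf_norm chi (fun x => u0n n x - u0 x)%R < m%:E)%E.
  by apply: (cvu _ (open_ereal_lt' _)); rewrite lte_fin.
have n2 : \forall n \near \oo, (L2const_norm (rho0n n) < m%:E)%E.
  by apply: (cvr _ (open_ereal_lt' _)); rewrite lte_fin.
apply: filterS2 n1 n2 => n /ltW h1 /ltW h2.
have [mut /(semigroup_evolution cchi t0)[p [evp [py pU' pH'] pc' pu pk']]] := hT n t t0.
(* The semigroup at time 0 identifies [k] for the n-th solution with the constant part of
   [rhon n 0], which the initial condition equates with that of [rho0n n]. *)
have [mu1 /semigroup_const_part[f [mf fae fk]]] := hT n 0 (lexx 0).
have [_ [_ r0] _] := hcl n.
have [/= [hun _] hrn _] := hD n.
have cl0 : profile_close eps (p 0) (q 0).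
  apply: (hm (u0n n) (rho0n n) (mu0n n)) => //.
  by rewrite (pk' f mf fae) fk /= r0.
have eK1 : eps * K <= 1 by rewrite epsK ge_min lexx.
have cl := hK eps p eps0 eK1 evp cl0.
have [B' _ admp] := ev_bound evp t0.
apply: Linf_norm_ub => x.
apply: (hd (p t) (un n t) (u t) B' admp _ pu qu).
have ed : eps * K <= d by rewrite epsK ge_min lexx orbT.
split.
- by move=> z; exact: le_trans (close_y cl z) ed.
- by move=> z; exact: le_trans (close_U cl z) ed.
- by move=> a b ab ba; exact: le_trans (close_H cl ab ba) ed.
- exact: le_trans (close_c cl) ed.
- exact: le_trans (close_k cl) ed.
- exact: close_k0 cl.
Qed.
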